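(* Suppose that the functions $i\mapsto c_i,\alpha_i,\lambda_i,k_i,r_i$ are all strictly positive and $\mathcal I$-measurable on $I$, that $(1+\beta)\int_I\lambda_ic_i^{\alpha_i}\,\iota(\mathrm di)<\infty$, that for all $i\in I$ $$\alpha_i\in\,]0,1[\quad\text{and}\quad \varepsilon_i:=\frac{(n_i-1)(1-\alpha_i)}{\alpha_i}-\frac{1-\overline\alpha}{1-\overline\alpha+\overline\alpha\gamma}>0,$$ and that $\int_I\lambda_i\bigl(q\,\frac{\alpha_i(n_i-1)}{(r_i-\mu)n_ik_i}\bigr)^{\alpha_i/(1-\alpha_i)}\iota(\mathrm di)<\infty$ for all constants $q>0$. Let $\varphi:[0,\infty)\to\mathbb R$ be any function that is a difference of two convex functions, satisfies $$\bigl(\overline x\,\varphi(\overline x)\bigr)'_->0\quad\text{and}\quad\lim_{\overline x\uparrow\infty}\overline x\,\varphi(\overline x)=\infty,$$ and is such that for every $\varepsilon>0$ there exist constants $\widetilde K(\varepsilon)$ and $\widetilde x(\varepsilon)>1$ with $$\overline x\,\varphi(\overline x)\le\widetilde K(\varepsilon)\,\overline x^{(1-\overline\alpha)/(1-\overline\alpha+\overline\alpha\gamma)+\varepsilon}\quad\text{for all }\overline x>\widetilde x(\varepsilon).$$ Fix $i\in I$ and let $G_i,\Gamma_i,\Phi_i,A_i,f_i,B_i$ and $w$ be the functions defined in the context. Then $w$ is a solution (in the sense specified in the context) to the HJB equation $$\max\bigl\{\mathscr L_iw(c,x,\overline x)+c^{\alpha_i}x\varphi(\overline x),\ w_c(c,x,\overline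 x)-k_i\bigr\}=0$$ with boundary condition $$w_{\overline x}(c,\overline x,\overline x)=0 .$$ Furthermore, there exist constants $K>0$ and $\vartheta_i>0$ such that $$0<x\,\Gamma_i^{\alpha_i}(x,\overline x)\le K\bigl(1+\overline x^{n_i-\vartheta_i}\bigr),\qquad 0<x\,\Phi_i^{\alpha_i}(\overline x)\le K\bigl(1+\overline x^{n_i-\vartheta_i}\bigr),$$ and $$0<w(c,x,\overline x)\le K\Bigl(1+\overline x^{n_i-\vartheta_i}+\bigl(1+\overline x^{n_i-\vartheta_i}\bigr)\bigl(c\,\Phi_i^{-1}(\overline x)\bigr)^{\alpha_i}+\overline x^{n_i-\vartheta_i}\bigl(c^{-1}\Phi_i(\overline x)\bigr)^{n_i(1-\alpha_i)-1}\Bigr)$$ for all $c>0$ and $0<x\le\overline x$, where $\Phi_i^{-1}(\overline x)$ denotes the reciprocal $1/\Phi_i(\overline x)$.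
   Context: Setting. $(I,\mathcal I,\iota)$ is a $\sigma$-finite non-atomic measure space with $\iota(I)>0$, $\{i\}\in\mathcal I$ and $\iota(\{i\})=0$ for all $i\in I$. $\beta>0$, $\gamma\in\,]0,1[$, $\mu\in\mathbb R$, $\sigma>0$ are constants. For $i\in I$, $m_i<0<n_i$ are the two roots of $\frac12\sigma^2\ell^2+(\mu-\frac12\sigma^2)\ell-r_i=0$ (under the stated hypotheses $n_i>1$, equivalently $r_i>\mu$). $\overline\alpha:=\inf\{a\in\,]0,1]\mid\iota(\alpha>a)=0\}$. A function $f:[0,\infty)\to\mathbb R$ is the difference of two convex functions if and only if it is absolutely continuous with left-hand derivative that is a function of finite variation; $f'_-$ denotes the left-hand derivative. The operator $\mathscr L_i$ acts on the variable $x$: $\mathscr L_iu=\frac12\sigma^2x^2u_{xx}+\mu xu_x-r_iu$. Functions. For $c>0$ and $0<x\le\overline x$ let $$G_i(c,\overline x)=\frac{(r_i-\mu)n_ik_i}{\alpha_i(n_i-1)}\frac{c^{1-\alpha_i}}{\varphi(\overline x)},\qquad \Gamma_i(x,\overline x)=\Bigl(\frac{\alpha_i(n_i-1)}{(r_i-\mu)n_ik_i}\Bigr)^{1/(1-\alpha_i)}\bigl(x\varphi(\overline x)\bigr)^{1/(1-\alpha_i)},\qquad \Phi_i(\overline x)=\Gamma_i(\overline x,\overline x),$$ let $\Phi_i^{\rm inv}$ be the inverse function of $\Phi_i$, and let $$A_i(\overline x)=-\frac{k_i}{\alpha_i(n_i-1)}\overline x^{-n_i}\Phi_i^{1-\alpha_i}(\overline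 x)+\frac{(1-\alpha_i)k_i}{\alpha_i}\Phi_i^{-\alpha_i}(\overline x)\int_{\overline x}^\infty y^{-n_i}(\Phi_i)'_-(y)\,\mathrm dy,$$ $$f_i(y)=-\frac{k_i}{n_i-1}y^{-\alpha_i}\bigl(\Phi_i^{\rm inv}(y)\bigr)^{-n_i}-\alpha_iy^{-1}A_i\bigl(\Phi_i^{\rm inv}(y)\bigr),\quad y>0 .$$ $B_i(\cdot,\overline x)$ is the solution to $\partial_cB_i(c,\overline x)=-\frac{k_i}{n_i-1}G_i^{-n_i}(c,\overline x)$ with $B_i(\Phi_i(\overline x),\overline x)=\Phi_i^{\alpha_i}(\overline x)A_i(\overline x)$; when $n_i(1-\alpha_i)\ne1$ this is $$B_i(c,\overline x)=\widetilde f_i(\overline x)+\frac{k_i}{(n_i-1)(n_i(1-\alpha_i)-1)}c^{-n_i(1-\alpha_i)+1}\,\overline x^{-n_i}\,\Phi_i^{n_i(1-\alpha_i)}(\overline x),$$ with $\widetilde f_i(\overline x)=\Phi_i^{\alpha_i}(\overline x)A_i(\overline x)-\frac{k_i}{(n_i-1)(n_i(1-\alpha_i)-1)}\overline x^{-n_i}\Phi_i(\overline x)$. The function $w$ is defined for $0<x\le\overline x$ by $$w(c,x,\overline x)=\begin{cases}c^{\alpha_i}\Bigl(A_i(\overline x)+\int_{\Phi_i(\overline x)}^cf_i(y)\,\mathrm dy\Bigr)x^{n_i}+\frac1{r_i-\mu}c^{\alpha_i}x\varphi(\overline x),&\text{if }\Phi_i(\overline x)\le c,\\[1mm] B_i(c,\overline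 x)x^{n_i}+\frac1{r_i-\mu}c^{\alpha_i}x\varphi(\overline x),&\text{if }\Gamma_i(x,\overline x)\le c<\Phi_i(\overline x),\\[1mm] w\bigl(\Gamma_i(x,\overline x),x,\overline x\bigr)-k_i\bigl(\Gamma_i(x,\overline x)-c\bigr),&\text{if }c<\Gamma_i(x,\overline x).\end{cases}$$ Sense of solution. For every $\overline x>0$, the function $(c,x)\mapsto w(c,x,\overline x)$ is $C^{1,2}$ on $\{c>0,\ 0<x<\overline x\}$ and the HJB equation holds at every such point; for all $c>0$ and $x>0$ the function $w(c,x,\cdot):\,]x,\infty[\,\to\mathbb R$ is the difference of two convex functions; and the boundary condition is understood as $w_{\overline x}(c,\overline x,\overline x):=\lim_{x\uparrow\overline x}w_{\overline x-}(c,x,\overline x)=0$ for all $c>0$ and $\overline x>0$, where $w_{\overline x-}$ is the left-hand partial derivative with respect to $\overline x$. *)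

(* Defs.v *)
From HB Require Import structures.
From mathcomp Require Import all_boot all_order all_algebra.
From mathcomp Require Import all_classical all_reals all_analysis.
Set Implicit Arguments.
Unset Strict Implicit.
Unset Printing Implicit Defensive.
Import Order.TTheory GRing.Theory Num.Theory.
Import numFieldNormedType.Exports.
Local Open Scope classical_set_scope.
Local Open Scope ring_scope.

Definition nonatomic d (T : measurableType d) (R : realType)
    (m : set T -> \bar R) : Prop :=
  forall A, measurable A -> (0 < m A)%E ->
    exists B, [/\ measurable B, B `<=` A, (0 < m B)%E & (m B < m A)%E].

Section real_functions.
Context {R : realType}.
Implicit Types (f phi : R -> R) (u : R -> R -> R).

(* When f : R -> R stands for a function that is only defined on D, its values
   outside D play no role. *)
Definition diff_convex (D : set R) f : Prop :=
  exists g h : R -> R, [/\ convex_function D g, convex_function D h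
    & forall x, D x -> f x = g x - h x].

Definition left_derive f (x : R) : R :=
  lim ((h^-1 * (f (x + h) - f x)) @[h --> 0^'-]).

Definition partial_c u (c x : R) : R := derive1 (u^~ x) c.
Definition partial_x u (c x : R) : R := derive1 (u c) x.
Definition partial_xx u (c x : R) : R := derive1 (partial_x u c) x.

(* For D open. *)
Definition C12_on (D : set (R * R)) u : Prop :=
  forall c x, D (c, x) ->
  [/\ derivable (u^~ x) c 1, derivable (u c) x 1
    & derivable (partial_x u c) x 1] /\
  [/\ {for (c, x), continuous (fun q : R * R => u q.1 q.2)},
      {for (c, x), continuous (fun q : R * R => partial_c u q.1 q.2)},
      {for (c, x), continuous (fun q : R * R => partial_x u q.1 q.2)}
    & {for (c, x), continuous (fun q : R * R => partial_xx u q.1 q.2)}].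

Definition generator (sigma mu r : R) u (c x : R) : R :=
  2^-1 * sigma ^+ 2 * x ^+ 2 * partial_xx u c x + mu * x * partial_x u c x
  - r * u c x.

Definition HJB_solution (sigma mu r k a : R) phi (w : R -> R -> R -> R) : Prop :=
  [/\ forall xb : R, 0 < xb ->
        C12_on [set q | 0 < q.1 /\ 0 < q.2 < xb] (fun c x => w c x xb),
      forall c x xb : R, 0 < c -> 0 < x < xb ->
        Num.max
          (generator sigma mu r (fun c x => w c x xb) c x
             + c `^ a * x * phi xb)
          (partial_c (fun c x => w c x xb) c x - k) = 0,
      forall c x : R, 0 < c -> 0 < x -> diff_convex `]x, +oo[ (w c x)
    & forall c xb : R, 0 < c -> 0 < xb ->
        left_derive (w c x) xb @[x --> xb^'-] --> 0].

End real_functions.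

(* The objects attached to a fixed index i, with r, n, k, a standing for
   r_i, n_i, k_i, alpha_i, and xb for the running maximum. *)
Section w_functions.
Context {R : realType}.
Variables (mu r n k a : R) (phi : R -> R).

Definition G_fun (c xb : R) : R :=
  (r - mu) * n * k / (a * (n - 1)) * (c `^ (1 - a) / phi xb).

Definition Gamma_fun (x xb : R) : R :=
  (a * (n - 1) / ((r - mu) * n * k)) `^ (1 - a)^-1
  * (x * phi xb) `^ (1 - a)^-1.

Definition Phi_fun (xb : R) : R := Gamma_fun xb xb.

Definition Phi_inv : R -> R := 'pinv_(fun=> 0) `]0, +oo[ Phi_fun.

Definition A_fun (xb : R) : R :=
  - (k / (a * (n - 1))) * xb `^ (- n) * Phi_fun xb `^ (1 - a)
  + (1 - a) * k / a * Phi_fun xb `^ (- a)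
    * \int[lebesgue_measure]_(y in `[xb, +oo[)
        (y `^ (- n) * left_derive Phi_fun y).

Definition f_fun (y : R) : R :=
  - (k / (n - 1)) * y `^ (- a) * Phi_inv y `^ (- n)
  - a * y^-1 * A_fun (Phi_inv y).

Definition is_B_fun (B : R -> R -> R) : Prop :=
  forall xb : R, 0 < xb ->
    (forall c : R, 0 < c ->
       is_derive c 1 (B^~ xb) (- (k / (n - 1)) * G_fun c xb `^ (- n))) /\
    B (Phi_fun xb) xb = Phi_fun xb `^ a * A_fun xb.

Definition w_high (c x xb : R) : R :=
  c `^ a
    * (A_fun xb + \int[lebesgue_measure]_(y in `[Phi_fun xb, c]) f_fun y)
    * x `^ n
  + (r - mu)^-1 * c `^ a * x * phi xb.

Definition w_mid (B : R -> R -> R) (c x xb : R) : R :=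
  B c xb * x `^ n + (r - mu)^-1 * c `^ a * x * phi xb.

(* In the last case the value at c = Gamma_fun x xb is read off one of the first
   two cases; it is the first one when x = xb. *)
Definition w_fun (B : R -> R -> R) (c x xb : R) : R :=
  if Phi_fun xb <= c then w_high c x xb
  else if Gamma_fun x xb <= c then w_mid B c x xb
  else
    (if Phi_fun xb <= Gamma_fun x xb then w_high (Gamma_fun x xb) x xb
     else w_mid B (Gamma_fun x xb) x xb)
    - k * (Gamma_fun x xb - c).

End w_functions.

Section parameters.
Context {d : measure_display} {I : measurableType d} {R : realType}.
Variables (iota : set I -> \bar R) (alpha : I -> R).

Definition alpha_bar : R :=
  inf [set a : R | 0 < a <= 1 /\ iota [set i | a < alpha i] = 0%E].

Definition growth_exponent (gamma : R) : R :=
  (1 - alpha_bar) / (1 - alpha_bar + alpha_bar * gamma).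

End parameters.

(* Main.v *)
Require Import Defs.
From HB Require Import structures.
From mathcomp Require Import all_boot all_order all_algebra.
From mathcomp Require Import all_classical all_reals all_analysis.
From mathcomp Require Import measurable_realfun ring lra.
Set Implicit Arguments.
Unset Strict Implicit.
Unset Printing Implicit Defensive.
Import Order.TTheory GRing.Theory Num.Theory.
Import numFieldNormedType.Exports.
Local Open Scope classical_set_scope.
Local Open Scope ring_scope.

(* Everything is expressed through Phi, which is an increasing bijection of ]0, +oo[ onto
   itself and a difference of convex functions. Let s be the (-n)-th power of its inverse,
   T the integral of s over [y, +oo[ and U' = y ^ (-a) s. The left-derivative form of the
   fundamental theorem of calculus turns the integral of y ^ (-n) Phi'_- over [x, +oo[ into
   T (Phi x), so A, f and B become explicit in Phi, T, U and an antiderivative E of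
   - u ^ (-n (1 - a)).

   With W c x z := coef c z x ^ n + c ^ a x phi z / (r - mu), one has
   w c x z = W m x z - k (m - c) for m := max c (Gamma x z), and Gamma is the locus where
   W_c = k. Hence w_c, w_x and w_xx are those of W at m, smooth fit is automatic, and the
   HJB equation reduces to sign conditions on either side of Gamma. The boundary condition
   holds because the left z-derivatives of the two terms of W cancel at x = z. Differences
   of convex functions are closed under products, powers, maxima and minima, hence w is one
   in z. Comparing s with a power bounds T and thereby w. *)

(** * Differences of convex functions *)

(** As [phi] is only a difference of convex functions, neither Phi nor its inverse need be
    differentiable, and s need not be either. T and U are antiderivatives of continuous expressions
    in s: they are C^1, and since s decreases T is convex and U concave. Composing them with Phi
    then costs only a chain rule for left derivatives, and s itself cancels in the c-derivative of
    the coefficient.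

    The explicit formula for B degenerates when n (1 - a) = 1. Keeping E as an antiderivative with E
    1 = 0 treats all exponents at once, and B enters only through its differential equation.

    Closure of differences of convex functions under nonlinear operations is proved on compact
    intervals, where slopes are bounded, whereas the decomposition asked for lives on an open
    half-line. Hence the explicit control functions: they can be extended from one compact interval
    to a larger one without being changed.

    The strict inequality eps_i > 0 leaves room for an exponent q < n that bounds the growth of Phi;
    it makes T finite, and theta is n - q. *)

Section delta_convex.
Context {R : realType}.
Implicit Types (f g h F : R -> R) (a b c u v w x y z L : R).

(* Three-point form: unlike the slope form it is linear in f. *)
Definition cvx a b f := forall u v w, a <= u -> u <= v -> v <= w -> w <= b ->
  f v * (w - u) <= f u * (w - v) + f w * (v - u).

Definition lip a b L f := forall u v, a <= u -> u <= v -> v <= b ->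
  `|f v - f u| <= L * (v - u).

(* h is a control function of f in the sense of Vesely and Zajicek. *)
Definition control a b f h := [/\ cvx a b (fun x => h x + f x),
  cvx a b (fun x => h x - f x) & exists L, lip a b L f /\ lip a b L h].

(** The Lipschitz clause of [control] excludes infinite slopes at the endpoints. Composition uses
    the constant as a factor of the control function, gluing uses it to size the kink. *)
Definition dcon a b f := exists h, control a b f h.

(** The three-point form is free of division and suits gluing; the convex-combination form is the
    one that composes and that [convex_function] uses. *)
Lemma cvxP a b f : cvx a b f <-> forall p q t, a <= p <= b -> a <= q <= b ->
  0 <= t <= 1 -> f (t * p + (1 - t) * q) <= t * f p + (1 - t) * f q.
Proof.
split.
- move=> cf.
  have H p q t : a <= p -> p <= q -> q <= b -> 0 <= t <= 1 ->
      f (t * p + (1 - t) * q) <= t * f p + (1 - t) * f q.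
    move=> ap pq qb /andP[t0 t1].
    have [<-|npq] := eqVneq p q.
      by rewrite -!mulrDl addrC subrK !mul1r.
    have ltpq : p < q by rewrite lt_neqAle npq.
    have := cf p (t * p + (1 - t) * q) q ap.
    have h1 : p <= t * p + (1 - t) * q.
      have : 0 <= (1 - t) * (q - p) by rewrite mulr_ge0// subr_ge0.
      lra.
    have h2 : t * p + (1 - t) * q <= q.
      have : 0 <= t * (q - p) by rewrite mulr_ge0// subr_ge0.
      lra.
    move=> /(_ h1 h2 qb) h3.
    have qp : 0 < q - p by rewrite subr_gt0.
    rewrite -(ler_pM2r qp); apply: le_trans h3 _.
    by rewrite le_eqVlt; apply/orP; left; apply/eqP; ring.
  move=> p q t /andP[ap pb] /andP[aq qb] /andP[t0 t1].
  have [pq|/ltW qp] := leP p q; first by apply: H => //; rewrite t0.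
  have := H q p (1 - t) aq qp pb; rewrite subr_ge0 gerBl t0 t1 => /(_ isT).
  by rewrite opprB addrCA subrr addr0 addrC [leRHS]addrC.
- move=> H u v w au uv vw wb.
  have [uw|nuw] := eqVneq u w.
    have -> : v = u by apply/le_anti; rewrite uv uw vw.
    by rewrite uw !subrr !mulr0 addr0.
  have ltuw : 0 < w - u by rewrite subr_gt0 lt_neqAle nuw (le_trans uv).
  have := H u w ((w - v) / (w - u)).
  rewrite au (le_trans (le_trans uv vw))//= (le_trans (le_trans au uv) vw) wb.
  have -> : 0 <= (w - v) / (w - u) <= 1.
    by rewrite divr_ge0 ?ler_pdivrMr ?mul1r//=; lra.
  move=> /(_ isT isT isT).
  have wu : w - u != 0 by rewrite gt_eqF.
  have -> : (w - v) / (w - u) * u + (1 - (w - v) / (w - u)) * w = v by field.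
  rewrite -(ler_pM2r ltuw) => /le_trans; apply.
  rewrite le_eqVlt; apply/orP; left; apply/eqP; by field.
Qed.

Lemma cvxD a b f g : cvx a b f -> cvx a b g -> cvx a b (fun x => f x + g x).
Proof.
move=> cf cg u v w au uv vw wb.
have := cf u v w au uv vw wb; have := cg u v w au uv vw wb; lra.
Qed.

Lemma cvxZ a b k f : 0 <= k -> cvx a b f -> cvx a b (fun x => k * f x).
Proof.
move=> k0 cf u v w au uv vw wb.
have := cf u v w au uv vw wb => /(ler_wpM2l k0); lra.
Qed.

Lemma cvx_affine a b k l : cvx a b (fun x => k * x + l).
Proof. move=> u v w au uv vw wb; rewrite le_eqVlt; apply/orP; left; apply/eqP; ring. Qed.

Lemma cvx_sub a b a' b' f : a <= a' -> b' <= b -> cvx a b f -> cvx a' b' f.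
Proof.
move=> aa bb cf u v w au uv vw wb; apply: cf => //.
  exact: le_trans au.
exact: le_trans wb bb.
Qed.

Lemma cvx_ext a b f g : (forall x, a <= x <= b -> f x = g x) ->
  cvx a b f -> cvx a b g.
Proof.
move=> fg cf u v w au uv vw wb.
by rewrite -!fg ?cf//; lra.
Qed.

(** For a triple straddling b, a positive combination of the inequality centred at b with convexity
    on the side containing v gives the claim, after division by the distance from b to the endpoint
    on that side. *)
Lemma cvx_glue a b c f : cvx a b f -> cvx b c f ->
  (forall u w, a <= u <= b -> b <= w <= c ->
    f b * (w - u) <= f u * (w - b) + f w * (b - u)) -> cvx a c f.
Proof.
move=> c1 c2 k u v w au uv vw wc.
have [wb|/ltW bw] := leP w b; first exact: c1.
have [bu|ub] := leP b u; first exact: c2.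
have H2 : f b * (w - u) <= f u * (w - b) + f w * (b - u).
  by apply: k; rewrite ?au ?bw ?wc ?ltW.
have uw : u < w by exact: lt_le_trans ub bw.
have [vb|/ltW bv] := leP v b.
  have H1 := c1 u v b au uv vb (lexx _).
  have bu0 : 0 < b - u by rewrite subr_gt0.
  rewrite -(ler_pM2r bu0).
  have wu0 : 0 <= w - u by rewrite subr_ge0 ltW.
  have vu0 : 0 <= v - u by rewrite subr_ge0.
  have := ler_wpM2l wu0 H1; have := ler_wpM2l vu0 H2; lra.
have H1 := c2 b v w (lexx _) bv vw wc.
have [bw'|nbw] := eqVneq b w.
  have vb : v = b by apply/le_anti; rewrite bv bw' vw.
  by rewrite vb; apply: H2.
have wb0 : 0 < w - b by rewrite subr_gt0 lt_neqAle nbw.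
rewrite -(ler_pM2r wb0).
have wu0 : 0 <= w - u by rewrite subr_ge0 ltW.
have vu0 : 0 <= w - v by rewrite subr_ge0.
have := ler_wpM2l wu0 H1; have := ler_wpM2l vu0 H2; lra.
Qed.

Lemma lip_ext a b L f g : (forall x, a <= x <= b -> f x = g x) ->
  lip a b L f -> lip a b L g.
Proof.
move=> fg lf u v au uv vb; by rewrite -!fg ?lf//; lra.
Qed.

Lemma lip_le a b L L' f : L <= L' -> lip a b L f -> lip a b L' f.
Proof.
move=> LL lf u v au uv vb; apply: le_trans (lf u v au uv vb) _.
by rewrite ler_wpM2r// subr_ge0.
Qed.

Lemma lipD a b L L' f g : lip a b L f -> lip a b L' g ->
  lip a b (L + L') (fun x => f x + g x).
Proof.
move=> lf lg u v au uv vb; have := lf u v au uv vb; have := lg u v au uv vb.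
rewrite mulrDl => h1 h2.
have -> : f v + g v - (f u + g u) = (f v - f u) + (g v - g u) by ring.
by rewrite (le_trans (ler_normD _ _))// lerD.
Qed.

Lemma lipZ a b L k f : lip a b L f -> lip a b (`|k| * L) (fun x => k * f x).
Proof.
move=> lf u v au uv vb; rewrite -mulrBr normrM -mulrA.
by rewrite ler_wpM2l// lf.
Qed.

Lemma lip_glue a b c L f : lip a b L f -> lip b c L f -> lip a c L f.
Proof.
move=> l1 l2 u v au uv vc.
have [vb|/ltW bv] := leP v b; first exact: l1.
have [bu|/ltW ub] := leP b u; first exact: l2.
have := l1 u b au ub (lexx _); have := l2 b v (lexx _) bv vc => h1 h2.
have -> : f v - f u = (f v - f b) + (f b - f u) by ring.
apply: le_trans (ler_normD _ _) _; lra.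
Qed.

End delta_convex.

(** * Operations on differences of convex functions *)

Section delta_convex_calculus.
Context {R : realType}.
Implicit Types (f g h F : R -> R) (a b c u v w x y z L : R).

Lemma lip_ge0 a b L f : a < b -> lip a b L f -> 0 <= L.
Proof.
move=> ab /(_ a b (lexx _) (ltW ab) (lexx _)) /(le_trans (normr_ge0 _)).
by rewrite pmulr_lge0// subr_gt0.
Qed.

Lemma lip_sym a b L f : lip a b L f -> forall u v, a <= u <= b -> a <= v <= b ->
  `|f v - f u| <= L * `|v - u|.
Proof.
move=> lf u v /andP[au ub] /andP[av vb].
have [uv|/ltW vu] := leP u v.
  by rewrite [X in L * X]ger0_norm ?subr_ge0// lf.
by rewrite distrC [X in L * X]distrC [X in L * X]ger0_norm ?subr_ge0// lf.
Qed.

Lemma lip_continuous a b L f x : a < x < b -> lip a b L f ->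
  {for x, continuous f}.
Proof.
move=> /andP[ax xb] lf; have L0 := lip_ge0 (lt_trans ax xb) lf.
apply/cvgrPdist_le => /= e e0.
have eL : 0 < e / (L + 1) by rewrite divr_gt0// ltr_wpDl.
near=> y.
have axb : a <= x <= b by rewrite !ltW.
have ayb : a <= y <= b.
  apply/andP; split; apply/ltW; near: y; [exact: lt_nbhsr|exact: lt_nbhsl].
apply: le_trans (lip_sym lf ayb axb) _.
have : `|x - y| <= e / (L + 1) by near: y; exact: cvgr_dist_le.
rewrite ler_pdivlMr ?ltr_wpDl// => h.
have := normr_ge0 (x - y); nra.
Unshelve. all: by end_near. Qed.

Lemma lip_pos_lbound a b L f : a <= b -> lip a b L f ->
  (forall x, a <= x <= b -> 0 < f x) ->
  exists2 lo, 0 < lo & forall x, a <= x <= b -> lo <= f x.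
Proof.
rewrite le_eqVlt => /orP[/eqP <- lf fpos|ab lf fpos].
  exists (f a); first by apply: fpos; rewrite lexx.
  by move=> x /le_anti <-.
(* Clamping the argument gives a function that is continuous on the whole line, to which the extreme
   value theorem applies; f itself is controlled only on [a, b]. *)
pose g x := f (Num.max a (Num.min x b)).
have clP x : a <= Num.max a (Num.min x b) <= b.
  by rewrite le_max lexx /= ge_max ltW//= ge_min lexx orbT.
have lg u v : u <= v -> `|g v - g u| <= L * (v - u).
  move=> uv; apply: le_trans (lip_sym lf (clP _) (clP _)) _.
  rewrite ler_wpM2l ?(lip_ge0 ab lf)//.
  have : Num.max a (Num.min u b) <= Num.max a (Num.min v b).
    by apply: le_max2 => //; exact: le_min2.
  have cl x : Num.max a (Num.min x b) = if x <= a then a else if b <= x then b else x.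
    have [xb|bx] := leP x b; last by rewrite (max_r (ltW ab)) (ltW bx) leNgt (lt_trans ab bx).
    have [xa|ax] := leP x a; first by [].
    by case: leP => // bx; apply/le_anti; rewrite xb bx.
  by move=> _; rewrite !cl ler_norml; 
  by case: (leP u a) => ?; case: (leP b u) => ?; case: (leP v a) => ?; case: (leP b v) => ?; lra.
have cg : continuous g.
  by move=> x; apply: (@lip_continuous (x - 1) (x + 1) L) => [|u v _ uv _];
    [lra|exact: lg].
have [m mab mP] := @EVT_min R g a b (ltW ab) (continuous_subspaceT cg).
have gf x : a <= x <= b -> g x = f x.
  by move=> /andP[ax xb]; rewrite /g min_l// max_r.
exists (f m).
  by apply: fpos; move: mab; rewrite in_itv.
move=> x xab; rewrite -!gf//.
by apply: mP; rewrite in_itv.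
Qed.

Lemma lip_bound a b L f : lip a b L f -> forall x, a <= x <= b ->
  `|f x| <= `|f a| + `|L| * (b - a).
Proof.
move=> lf x /andP[ax xb].
have h := lf a x (lexx _) ax xb.
have -> : f x = f a + (f x - f a) by ring.
apply: le_trans (ler_normD _ _) _; rewrite lerD2l; apply: le_trans h _.
have h1 := ler_norm L; have h2 := normr_ge0 L.
apply: le_trans (_ : `|L| * (x - a) <= _); first by rewrite ler_wpM2r// subr_ge0.
by rewrite ler_wpM2l// lerD2r.
Qed.

(* F o f + L h is convex, where L is a Lipschitz constant of F. *)
Lemma cvx_comp a b lo hi L f h F : control a b f h -> 0 <= L ->
  (forall x, a <= x <= b -> lo <= f x <= hi) ->
  cvx lo hi F -> lip lo hi L F -> cvx a b (fun x => L * h x + F (f x)).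
Proof.
move=> [c1 c2 _] L0 frange cF lF; apply/cvxP => p q t pab qab t01.
have /cvxP/(_ p q t pab qab t01) := c1; have /cvxP/(_ p q t pab qab t01) := c2.
have rab : a <= t * p + (1 - t) * q <= b.
  case/andP: t01 => t0 t1; case/andP: pab => ap pb; case/andP: qab => aq qb.
  apply/andP; split; nra.
set r := t * p + (1 - t) * q in rab *.
have mlh : lo <= t * f p + (1 - t) * f q <= hi.
  have := frange _ pab; have := frange _ qab; case/andP: t01 => t0 t1.
  move=> /andP[? ?] /andP[? ?]; apply/andP; split; nra.
have /cvxP/(_ (f p) (f q) t (frange _ pab) (frange _ qab) t01) := cF.
have := lip_sym lF mlh (frange _ rab).
set m := t * f p + (1 - t) * f q => k1 k2 k3 k4.
(* Convexity of h + f and of h - f bounds the deviation of f from the chord by that of h. *)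
have k5 : `|f r - m| <= t * h p + (1 - t) * h q - h r.
  by rewrite ler_norml; apply/andP; split; rewrite /m; lra.
have k6 : F (f r) <= F m + L * (t * h p + (1 - t) * h q - h r).
  have := ler_norm (F (f r) - F m); have := ler_wpM2l L0 k5; lra.
lra.
Qed.

Lemma dcon_ext a b f g : (forall x, a <= x <= b -> f x = g x) ->
  dcon a b f -> dcon a b g.
Proof.
move=> fg [h [c1 c2 [L [l1 l2]]]]; exists h; split.
- by apply: cvx_ext c1 => x xab; rewrite fg.
- by apply: cvx_ext c2 => x xab; rewrite fg.
- by exists L; split => //; exact: lip_ext l1.
Qed.

Lemma dcon_affine a b k l : dcon a b (fun x => k * x + l).
Proof.
exists (fun x => 0 * x + 0); split.
- by apply: cvx_ext (@cvx_affine R a b k l) => x _; ring.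
- by apply: cvx_ext (@cvx_affine R a b (- k) (- l)) => x _; ring.
- exists `|k|; split=> u v _ uv _.
    have -> : k * v + l - (k * u + l) = k * (v - u) by ring.
    by rewrite normrM (@ger0_norm _ (v - u)) ?subr_ge0.
  by rewrite !mul0r !addr0 subr0 normr0 mulr_ge0// subr_ge0.
Qed.

Lemma dcon_cst a b l : dcon a b (fun=> l).
Proof. by apply: dcon_ext (dcon_affine a b 0 l) => x _; ring. Qed.

Lemma dcon_id a b : dcon a b id.
Proof. by apply: dcon_ext (dcon_affine a b 1 0) => x _; rewrite mul1r addr0. Qed.

Lemma dconD a b f g : dcon a b f -> dcon a b g -> dcon a b (fun x => f x + g x).
Proof.
move=> [h [c1 c2 [L [l1 l2]]]] [h' [c1' c2' [L' [l1' l2']]]].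
exists (fun x => h x + h' x); split.
- by apply: cvx_ext (cvxD c1 c1') => x _; ring.
- by apply: cvx_ext (cvxD c2 c2') => x _; ring.
- by exists (L + L'); split; exact: lipD.
Qed.

Lemma dconN a b f : dcon a b f -> dcon a b (fun x => - f x).
Proof.
move=> [h [c1 c2 [L [l1 l2]]]]; exists h; split => //.
  by apply: cvx_ext c1 => x _; rewrite opprK.
exists L; split => // u v au uv vb.
by rewrite opprK addrC distrC l1.
Qed.

Lemma dconB a b f g : dcon a b f -> dcon a b g -> dcon a b (fun x => f x - g x).
Proof. by move=> df dg; apply: dconD df (dconN dg). Qed.

Lemma dcon_comp a b lo hi f F : dcon a b f ->
  (forall x, a <= x <= b -> lo <= f x <= hi) ->
  cvx lo hi F -> (exists L, lip lo hi L F) -> dcon a b (fun x => F (f x)).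
Proof.
move=> [h ch] frange cF [L0 lF0].
have lF : lip lo hi `|L0| F by apply: lip_le lF0; exact: ler_norm.
have c1 := cvx_comp ch (normr_ge0 L0) frange cF lF.
have [ch1 ch2 [M [l1 l2]]] := ch.
have ch0 : cvx a b (fun x => 2 * `|L0| * h x).
  apply: cvx_ext (cvxZ (normr_ge0 L0) (cvxD ch1 ch2)) => x _; ring.
have lFf : lip a b (`|L0| * `|M|) (fun x => F (f x)).
  move=> u v au uv vb.
  have := lip_sym lF (frange u _) (frange v _).
  rewrite au vb (le_trans uv vb) (le_trans au uv) => /(_ isT isT) k1.
  apply: le_trans k1 _; rewrite -mulrA ler_wpM2l//.
  apply: le_trans (l1 u v au uv vb) _.
  by rewrite ler_wpM2r ?subr_ge0// ler_norm.
(* With this control function, the sum with F o f is 2 (L h + F o f), convex by [cvx_comp], and the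
   difference is 2 L h, where 2 h is the sum of h + f and h - f. *)
exists (fun x => F (f x) + 2 * `|L0| * h x); split.
- apply: cvx_ext (cvxZ (ler0n _ 2) c1) => x _; ring.
- apply: cvx_ext ch0 => x _; ring.
- have l3 := lipD lFf (lipZ (2 * `|L0|) l2).
  exists (`|L0| * `|M| + `|2 * `|L0| | * `|M|); split.
    by apply: lip_le lFf; rewrite lerDl mulr_ge0.
  by apply: lip_le l3; rewrite lerD2l ler_wpM2l// ler_norm.
Qed.

Lemma dcon_sqr a b f : dcon a b f -> dcon a b (fun x => f x ^+ 2).
Proof.
move=> df; have [h [_ _ [L [lf _]]]] := df.
pose M := `|f a| + `|L| * (b - a).
apply: (@dcon_comp a b (- M) M f (fun x => x ^+ 2)) => //.
- by move=> x xab; rewrite -ler_norml; exact: (lip_bound lf).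
- apply/cvxP => p q t _ _ /andP[t0 t1]; rewrite -subr_ge0.
  have -> : t * p ^+ 2 + (1 - t) * q ^+ 2 - (t * p + (1 - t) * q) ^+ 2
    = t * (1 - t) * (p - q) ^+ 2 by ring.
  by rewrite mulr_ge0 ?sqr_ge0 ?mulr_ge0 ?subr_ge0.
- exists (2 * M) => u v Mu uv vM.
  have -> : v ^+ 2 - u ^+ 2 = (v + u) * (v - u) by ring.
  rewrite normrM (@ger0_norm _ (v - u)) ?subr_ge0// ler_wpM2r ?subr_ge0//.
  by rewrite ler_norml; lra.
Qed.

Lemma dconZ a b k f : dcon a b f -> dcon a b (fun x => k * f x).
Proof.
move=> [h [c1 c2 [L [l1 l2]]]]; exists (fun x => `|k| * h x); split.
- have [k0|k0] := leP 0 k.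
    by apply: cvx_ext (cvxZ k0 c1) => x _; rewrite ger0_norm// mulrDr.
  have k0' : 0 <= - k by lra.
  by apply: cvx_ext (cvxZ k0' c2) => x _; rewrite ltr0_norm//; ring.
- have [k0|k0] := leP 0 k.
    by apply: cvx_ext (cvxZ k0 c2) => x _; rewrite ger0_norm// mulrBr.
  have k0' : 0 <= - k by lra.
  by apply: cvx_ext (cvxZ k0' c1) => x _; rewrite ltr0_norm//; ring.
- exists (`|k| * L); split; first exact: lipZ.
  by have := lipZ (`|k|) l2; rewrite normr_id.
Qed.

(** Polarisation reduces products to squares. *)
Lemma dconM a b f g : dcon a b f -> dcon a b g -> dcon a b (fun x => f x * g x).
Proof.
move=> df dg.
have := dconZ 2^-1 (dconB (dcon_sqr (dconD df dg)) (dconD (dcon_sqr df) (dcon_sqr dg))).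
by apply: dcon_ext => x _; field.
Qed.

Lemma dcon_max a b f g : dcon a b f -> dcon a b g ->
  dcon a b (fun x => Num.max (f x) (g x)).
Proof.
move=> df dg; have dfg := dconB df dg.
have [h [_ _ [L [lf _]]]] := dfg.
have := @dcon_comp a b _ _ _ (fun x : R => Num.max x 0) dfg.
move=> /(_ (- (`|f a - g a| + `|L| * (b - a))) (`|f a - g a| + `|L| * (b - a))).
have H1 x : a <= x <= b -> - (`|f a - g a| + `|L| * (b - a)) <= f x - g x
    <= (`|f a - g a| + `|L| * (b - a)).
  by move=> xab; rewrite -ler_norml; exact: (lip_bound lf xab).
have H2 lo hi : cvx lo hi (fun x : R => Num.max x 0).
  apply/cvxP => p q t _ _ /andP[t0 t1].
  rewrite ge_max; have := le_max p p 0; have := le_max 0 p 0.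
  have := le_max q q 0; have := le_max 0 q 0; rewrite !lexx ?orbT /=.
  set x := Num.max p 0; set y := Num.max q 0 => y0 yq x0 xp.
  by apply/andP; split; nra.
have H3 lo hi : exists L, lip lo hi L (fun x : R => Num.max x 0).
  exists 1 => u v _ uv _; rewrite mul1r ler_norml /Num.max.
  by do 2 case: ltP => ?; lra.
move=> /(_ H1 (H2 _ _) (H3 _ _)) d.
apply: dcon_ext (dconD dg d) => x _; rewrite /Num.max; do 2 case: ltP => ?; lra.
Qed.

Lemma dcon_min a b f g : dcon a b f -> dcon a b g ->
  dcon a b (fun x => Num.min (f x) (g x)).
Proof.
move=> df dg; apply: dcon_ext (dconN (dcon_max (dconN df) (dconN dg))) => x _.
by rewrite /Num.max /Num.min; do 2 case: ltP => ?; lra.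
Qed.

(** The outer functions to be composed (powers, T, - U, E) may be singular at 0, so convexity and
    Lipschitz bounds are asked for only on compact subintervals of the positive half-line. *)
Definition loc_cvx F := forall lo hi, 0 < lo -> lo <= hi ->
  cvx lo hi F /\ exists L, lip lo hi L F.

(** A positive Lipschitz function on a compact interval is bounded away from 0, so its range lies in
    an interval on which F is controlled. *)
Lemma dcon_loc_cvx a b f F : dcon a b f -> a <= b ->
  (forall x, a <= x <= b -> 0 < f x) -> loc_cvx F ->
  dcon a b (fun x => F (f x)).
Proof.
move=> df ab fpos lF; have [h [_ _ [L [lf _]]]] := df.
have [lo lo0 loP] := lip_pos_lbound ab lf fpos.
pose hi := `|f a| + `|L| * (b - a).
have lohi : lo <= hi.
  apply: (le_trans (loP a _)); first by rewrite lexx.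
  apply: le_trans (ler_norm _) _.
  by apply: (lip_bound lf); rewrite lexx.
have [cF LF] := lF lo hi lo0 lohi.
apply: (@dcon_comp a b lo hi) => // x xab; rewrite loP//=.
by apply: le_trans (ler_norm _) _; exact: (lip_bound lf).
Qed.

Lemma continuous_withinW a b f : (forall x, a <= x <= b -> {for x, continuous f}) ->
  {within `[a, b], continuous f}.
Proof.
move=> cf; apply: continuous_in_subspaceT => x; rewrite inE/= in_itv/=.
exact: cf.
Qed.

Lemma MVT_pos F F' u v : 0 < u -> u < v ->
  (forall y, 0 < y -> is_derive y 1 F (F' y)) ->
  exists2 m, u < m < v & F v - F u = F' m * (v - u).
Proof.
move=> u0 uv dF.
have [| |m mab ->] := @MVT R F F' u v uv.
- by move=> x; rewrite in_itv/= => /andP[ux _]; apply: dF; exact: lt_trans ux.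
- apply: continuous_withinW => x /andP[ux _].
  have x0 : 0 < x by exact: lt_le_trans ux.
  by apply: differentiable_continuous; apply/derivable1_diffP; have [] := dF x x0.
- by exists m => //; move: mab; rewrite in_itv.
Qed.

Lemma loc_cvx_derive F F' : (forall y, 0 < y -> is_derive y 1 F (F' y)) ->
  (forall y z, 0 < y -> y <= z -> F' y <= F' z) -> loc_cvx F.
Proof.
move=> dF F'mono lo hi lo0 lohi; split.
- move=> u v w lou uv vw whi.
  have [<-|nuv] := eqVneq u v; first lra.
  have [->|nvw] := eqVneq v w; first lra.
  have ltuv : u < v by rewrite lt_neqAle nuv.
  have ltvw : v < w by rewrite lt_neqAle nvw.
  have u0 : 0 < u by exact: lt_le_trans lou.
  have [m1 /andP[um1 m1v] e1] := MVT_pos u0 ltuv dF.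
  have [m2 /andP[vm2 m2w] e2] := MVT_pos (lt_trans u0 ltuv) ltvw dF.
  have m12 : F' m1 <= F' m2.
    by apply: F'mono; [exact: lt_trans um1|exact/ltW/(lt_trans m1v)].
  have k1 : 0 <= (v - u) * (w - v) by rewrite mulr_ge0// subr_ge0.
  have := ler_wpM2l k1 m12.
  have -> : F w = F v + F' m2 * (w - v) by lra.
  have -> : F u = F v - F' m1 * (v - u) by lra.
  lra.
- exists (`|F' lo| + `|F' hi|) => u v lou uv vhi.
  have [<-|nuv] := eqVneq u v; first by rewrite !subrr normr0 mulr0.
  have u0 : 0 < u by exact: lt_le_trans lou.
  have ltuv : u < v by rewrite lt_neqAle nuv.
  have [m /andP[um mv] ->] := MVT_pos u0 ltuv dF.
  rewrite normrM (@ger0_norm _ (v - u)) ?subr_ge0// ler_wpM2r ?subr_ge0//.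
  have h1 : F' lo <= F' m by apply: F'mono => //; lra.
  have h2 : F' m <= F' hi by apply: F'mono => //; lra.
  have := ler_norm (F' hi); have := ler_norm (- F' lo); rewrite normrN.
  have := normr_ge0 (F' lo); have := normr_ge0 (F' hi).
  by rewrite ler_norml; lra.
Qed.

(** The sign of p (p - 1) decides between convexity and concavity; either is enough for a difference
    of convex functions. *)
Lemma loc_cvx_powR p : loc_cvx (fun y => y `^ p) \/ loc_cvx (fun y => - y `^ p).
Proof.
have d y : 0 < y -> is_derive y 1 (fun y : R => y `^ p) (p * y `^ (p - 1)).
  by move=> y0; exact: is_derive1_powR.
have [H|H] := leP 0 (p * (p - 1)).
- left; apply: (loc_cvx_derive d) => y z y0 yz.
  have z0 : 0 < z by exact: lt_le_trans yz.
  have [p1|p1] := leP 1 p.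
    by rewrite ler_wpM2l ?ge0_ler_powR ?nnegrE//; lra.
  have p0 : p <= 0 by nra.
  rewrite ler_wnM2l//.
  have -> : p - 1 = - (1 - p) by ring.
  rewrite !powRN lef_pV2 ?posrE ?powR_gt0//.
  by rewrite ge0_ler_powR ?nnegrE//; lra.
- right; apply: (@loc_cvx_derive _ (fun y => - (p * y `^ (p - 1)))).
    by move=> y y0; apply: is_deriveN; exact: d.
  move=> y z y0 yz; have z0 : 0 < z by exact: lt_le_trans yz.
  rewrite lerN2.
  have /andP[p0 p1] : 0 <= p <= 1 by nra.
  rewrite ler_wpM2l//.
  have -> : p - 1 = - (1 - p) by ring.
  rewrite !powRN lef_pV2 ?posrE ?powR_gt0//.
  by rewrite ge0_ler_powR ?nnegrE//; lra.
Qed.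

Lemma dcon_powR a b f p : dcon a b f -> a <= b ->
  (forall x, a <= x <= b -> 0 < f x) -> dcon a b (fun x => f x `^ p).
Proof.
move=> df ab fpos; have [lp|lp] := loc_cvx_powR p.
  exact: (dcon_loc_cvx df ab fpos lp).
apply: dcon_ext (dconN (dcon_loc_cvx df ab fpos lp)) => x _.
by rewrite opprK.
Qed.

End delta_convex_calculus.

(** * Left derivatives *)

Section left_derivative.
Context {R : realType}.
Implicit Types (f g h F : R -> R) (a b c d u v w x y z L : R).

(** A relation rather than a value: [left_derive] is a [lim], which carries information only once
    convergence is known. *)
Definition is_lderive f x d := (f y - f x) / (y - x) @[y --> x^'-] --> d.

Lemma is_lderive_shift f x d : is_lderive f x d ->
  h^-1 * (f (x + h) - f x) @[h --> 0^'-] --> d.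
Proof.
move=> fd; have sh : (x + h) @[h --> 0^'-] --> x^'-.
  move=> P H; change (\forall h \near 0^'-, P (x + h)).
  have /nbhs_left0P {}H : \forall y \near x^'-, P y by exact: H.
  by rewrite nbhs_left0P; near=> e; rewrite sub0r; near: e.
have := cvg_comp _ _ sh fd.
apply: cvg_trans; apply: near_eq_cvg; near=> h => /=.
by rewrite mulrC; congr (_^-1 * _); ring.
Unshelve. all: by end_near. Qed.

Lemma left_deriveE f x d : is_lderive f x d -> left_derive f x = d.
Proof. by move=> /is_lderive_shift fd; apply/cvg_lim. Qed.

Lemma is_lderive_near f g x d : (\forall y \near x^'-, f y = g y) -> f x = g x ->
  is_lderive f x d -> is_lderive g x d.
Proof.
move=> fg fgx; apply: cvg_trans; apply: near_eq_cvg.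
by near=> y; rewrite -fgx; congr ((_ - _) / _); near: y.
Unshelve. all: by end_near. Qed.

Lemma is_derive_lderive f x d : is_derive x 1 f d -> is_lderive f x d.
Proof.
move=> /is_derive1_caratheodory [g [fg cg <-]].
apply: cvg_trans (cvg_at_left_filter cg); apply: near_eq_cvg.
near=> y; rewrite fg mulfK// subr_eq0 lt_eqF//.
Unshelve. all: by end_near. Qed.

Lemma is_lderive_cvg f x d : is_lderive f x d -> f y @[y --> x^'-] --> f x.
Proof.
move=> fd.
have yx : (y - x) @[y --> x^'-] --> 0.
  rewrite -(subrr x); apply: cvgB; last exact: cvg_cst.
  exact: cvg_at_left_filter cvg_id.
rewrite -[X in _ --> X]add0r -[X in _ --> X + _](mulr0 d).
apply: cvg_trans (cvgD (cvgM fd yx) (cvg_cst (f x))).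
apply: near_eq_cvg; near=> y; rewrite !fctE /=.
by rewrite mulfVK ?subrK// subr_eq0 lt_eqF.
Unshelve. all: by end_near. Qed.

Lemma is_lderive_cst c x : is_lderive (fun=> c) x 0.
Proof. by apply: is_derive_lderive; exact: is_derive_cst. Qed.

Lemma is_lderiveD f g x d d' : is_lderive f x d -> is_lderive g x d' ->
  is_lderive (fun y => f y + g y) x (d + d').
Proof.
move=> fd gd; apply: cvg_trans (cvgD fd gd); apply: near_eq_cvg; near=> y.
by rewrite !fctE -mulrDl; congr (_ / _); ring.
Unshelve. all: by end_near. Qed.

Lemma is_lderiveM f g x d d' : is_lderive f x d -> is_lderive g x d' ->
  is_lderive (fun y => f y * g y) x (d * g x + f x * d').
Proof.
move=> fd gd; have fx := is_lderive_cvg fd.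
apply: cvg_trans (cvgD (cvgM fd (cvg_cst (g x))) (cvgM fx gd)).
apply: near_eq_cvg; near=> y; rewrite !fctE /=; ring.
Unshelve. all: by end_near. Qed.

Lemma is_lderiveZ f k x d : is_lderive f x d ->
  is_lderive (fun y => k * f y) x (k * d).
Proof.
by move=> fd; have := is_lderiveM (is_lderive_cst k x) fd; rewrite mul0r add0r.
Qed.

Lemma is_lderiveN f x d : is_lderive f x d -> is_lderive (fun y => - f y) x (- d).
Proof.
move=> /(@is_lderiveZ f (-1)); rewrite mulN1r; apply: is_lderive_near; last by rewrite mulN1r.
by apply: nearW => y; rewrite mulN1r.
Qed.

(** The derivative of F is two-sided because f y may approach f x from either side. The Caratheodory
    slope of F avoids dividing by f y - f x, which may vanish. *)
Lemma is_lderive_comp f F x d e : is_lderive f x d -> is_derive (f x) 1 F e ->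
  is_lderive (fun y => F (f y)) x (e * d).
Proof.
move=> fd /is_derive1_caratheodory [g [Fg cg <-]].
have fx := is_lderive_cvg fd.
have gf : g (f y) @[y --> x^'-] --> g (f x) by exact: cvg_comp fx cg.
apply: cvg_trans (cvgM gf fd); apply: near_eq_cvg; near=> y => /=.
by rewrite Fg mulrA.
Unshelve. all: by end_near. Qed.

Lemma cvx_slope a b g u v w z : cvx a b g -> a <= u -> u < v -> v <= w -> w < z ->
  z <= b -> (g v - g u) / (v - u) <= (g z - g w) / (z - w).
Proof.
move=> cg.
have step u' v' w' : a <= u' -> u' < v' -> v' < w' -> w' <= b ->
    (g v' - g u') / (v' - u') <= (g w' - g v') / (w' - v').
  move=> au uv vw wb; have := cg u' v' w' au (ltW uv) (ltW vw) wb.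
  rewrite ler_pdivrMr ?subr_gt0// mulrAC ler_pdivlMr ?subr_gt0//; lra.
move=> au uv; rewrite le_eqVlt => /orP[/eqP <-|vw] wz zb; first exact: step.
apply: le_trans (step u v w _ _ _ _) (step v w z _ _ _ _) => //.
- exact/ltW/(lt_le_trans wz).
- exact/ltW/(le_lt_trans au).
Qed.

Lemma cvx_lip a b a' b' g : a < a' -> a' <= b' -> b' < b -> cvx a b g ->
  exists L, lip a' b' L g.
Proof.
move=> aa ab bb cg.
pose sl := (g a' - g a) / (a' - a); pose sr := (g b - g b') / (b - b').
exists (`|sl| + `|sr|) => u v au; rewrite le_eqVlt => /orP[/eqP <-|uv] vb.
  by rewrite !subrr normr0 mulr0.
have v0 : 0 < v - u by rewrite subr_gt0.
have h1 : sl <= (g v - g u) / (v - u) by apply: (cvx_slope cg) => //; lra.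
have h2 : (g v - g u) / (v - u) <= sr by apply: (cvx_slope cg) => //; lra.
rewrite -ler_pdivrMr// -[X in _ / X]gtr0_norm// -normf_div.
have := ler_norm sr; have := ler_norm (- sl); rewrite normrN.
have := normr_ge0 sl; have := normr_ge0 sr.
by rewrite ler_norml; lra.
Qed.

(** The slopes of the chords ending at x increase as y tends to x from the left and are bounded by
    the slope of the chord from x to b. *)
Lemma cvx_is_lderive a b g x : a < x < b -> cvx a b g ->
  exists d, is_lderive g x d.
Proof.
move=> /andP[ax xb] cg.
suff : cvg ((g y - g x) / (y - x) @[y --> x^'-]) by move=> /cvg_ex.
have sE y : (g y - g x) / (y - x) = (g x - g y) / (x - y).
  by rewrite -[RHS]mulrNN -invrN !opprB.
apply: nondecreasing_at_left_is_cvgr.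
- near=> y => u v; rewrite !in_itv/= => /andP[yu ux] /andP[yv vx] uv.
  have ay : a < y by near: y; exact: nbhs_left_gt.
  have [->//|nuv] := eqVneq u v.
  have ltuv : u < v by rewrite lt_neqAle nuv.
  have := cg u v x; have -> : a <= u by lra.
  rewrite uv (ltW vx) (ltW xb) => /(_ isT isT isT isT) h.
  rewrite !sE ler_pdivrMr ?subr_gt0// mulrAC ler_pdivlMr ?subr_gt0//; lra.
- near=> y; have ay : a < y by near: y; exact: nbhs_left_gt.
  exists ((g b - g x) / (b - x)) => s [u /=]; rewrite in_itv/= => /andP[yu ux] <-.
  by rewrite sE; apply: (cvx_slope cg) => //; lra.
Unshelve. all: by end_near. Qed.

Lemma dcon_is_lderive a b f x : a < x < b -> dcon a b f ->
  exists d, is_lderive f x d.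
Proof.
move=> axb [h [c1 c2 _]].
have [d1 h1] := cvx_is_lderive axb c1; have [d2 h2] := cvx_is_lderive axb c2.
exists (2^-1 * (d1 - d2)).
have := is_lderiveZ (k := 2^-1) (is_lderiveD h1 (is_lderiveN h2)).
apply: is_lderive_near; last by field.
by apply: nearW => y; field.
Qed.

Lemma dcon_continuous a b f x : a < x < b -> dcon a b f -> {for x, continuous f}.
Proof. by move=> axb [h [_ _ [L [lf _]]]]; exact: lip_continuous lf. Qed.

(* The minimum of f on [a, b] can only be attained at a. *)
Lemma lderive_gt0_lt a b f : a < b ->
  (forall x, a <= x <= b -> {for x, continuous f}) ->
  (forall x, a < x <= b -> exists2 d, 0 < d & is_lderive f x d) -> f a < f b.
Proof.
move=> ab cf df.
have [m mab mP] := EVT_min (ltW ab) (continuous_withinW cf).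
move: mab; rewrite in_itv/= => /andP[am mb].
have key x : a < x <= b -> exists y, a < y < x /\ f y < f x.
  move=> /[dup] axb /andP[ax xb]; have [d d0 fd] := df x axb.
  have H : \forall y \near x^'-, 0 < (f y - f x) / (y - x).
    by move/cvgrPdist_lt : fd => /(_ d d0); apply: filterS => y;
      rewrite ltr_norml; lra.
  have [y [ay [yx fy]]] : exists y, a < y /\ (y < x /\ 0 < (f y - f x) / (y - x)).
    apply: (@filter_ex _ (x^'-)); near=> y; split; last split.
    - by near: y; exact: nbhs_left_gt.
    - by near: y; exact: nbhs_left_lt.
    - by near: y.
  exists y; rewrite ay yx; split => //.
  have e : f y - f x = (f y - f x) / (y - x) * (y - x).
    by rewrite divfK// subr_eq0 lt_eqF.
  by rewrite -subr_lt0 e pmulr_rlt0// subr_lt0.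
have [am'|nam] := eqVneq a m.
  rewrite lt_neqAle am' mP ?in_itv/= ?lexx ?ltW// andbT; apply/eqP => fmb.
  have [y [/andP[ay yb]]] : exists y, a < y < b /\ f y < f b by apply: key; rewrite ab lexx.
  by rewrite -fmb ltNge mP// in_itv/= !ltW.
have [y [/andP[ay ym]]] : exists y, a < y < m /\ f y < f m.
  by apply: key; rewrite lt_neqAle nam am mb.
by rewrite ltNge mP// in_itv/= !ltW// (lt_le_trans ym).
Unshelve. all: by end_near. Qed.

End left_derivative.

(** * From decompositions on compact intervals to one on a half-line *)

Section local_to_global.
Context {R : realType}.
Implicit Types (f g h F : R -> R) (a b c d u v w x y z L : R).

Lemma convex_function_cvx (D : set R) f a b : (forall x, a <= x <= b -> D x) ->
  convex_function D f -> cvx a b f.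
Proof.
move=> abD cf; apply/cvxP => p q t pab qab t01.
have := cf (Itv01 (andP t01).1 (andP t01).2) p q.
by rewrite !inE => /(_ (abD _ pab) (abD _ qab)).
Qed.

Lemma cvx_convex_function (D : set R) f :
  (forall x y, D x -> D y -> x <= y -> cvx x y f) -> convex_function D f.
Proof.
move=> H t x y; rewrite !inE => Dx Dy.
change (f (t%:num * (x : R) + (1 - t%:num) * (y : R)) <=
  t%:num * f x + (1 - t%:num) * f y).
have t01 : 0 <= t%:num <= 1 by apply/andP; split; [exact: ge0|exact: le1].
have [xy|/ltW yx] := leP (x : R) (y : R).
  by have /cvxP := H x y Dx Dy xy; apply => //; rewrite lexx xy.
by have /cvxP := H y x Dy Dx yx; apply => //; rewrite lexx yx.
Qed.

Lemma cvx_reflect a b f : cvx a b f -> cvx (- b) (- a) (fun x => f (- x)).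
Proof.
move=> cf u v w au uv vw wb.
have := cf (- w) (- v) (- u).
rewrite lerNr wb !lerN2 uv vw lerNl au => /(_ isT isT isT isT); lra.
Qed.

Lemma control_reflect a b f h : control a b f h ->
  control (- b) (- a) (fun x => f (- x)) (fun x => h (- x)).
Proof.
have lr L g : lip a b L g -> lip (- b) (- a) L (fun x => g (- x)).
  move=> lg u v au uv vb; have := lg (- v) (- u).
  rewrite lerNr vb lerN2 uv lerNl au => /(_ isT isT isT).
  by rewrite distrC (_ : - u - - v = v - u)//; ring.
move=> [c1 c2 [L [l1 l2]]]; split; [exact: (cvx_reflect c1)|exact: (cvx_reflect c2)|].
by exists L; split; exact: lr.
Qed.

(* The kink of slope K at b absorbs any jump of the slopes of h + f and h - f. *)
Lemma control_extend_right a b c f h : a < b -> b < c -> control a b f h ->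
  dcon b c f ->
  exists h', control a c f h' /\ forall x, x <= b -> h' x = h x.
Proof.
move=> ab bc [c1 c2 [L [lf lh]]] [h1 [d1 d2 [M [mf mh]]]].
have L0 := lip_ge0 ab lf; have M0 := lip_ge0 bc mf.
(* The slopes of h + f and h - f left of b are at most 2 L, those of h1 + f and h1 - f right of b at
   least - 2 M. *)
pose K := 2 * L + 2 * M.
pose h' x := if x <= b then h x else h b + (h1 x - h1 b) + K * (x - b).
have h'l x : x <= b -> h' x = h x by move=> xb; rewrite /h' xb.
have h'r x : b <= x -> h' x = h b + (h1 x - h1 b) + K * (x - b).
  rewrite le_eqVlt => /orP[/eqP <-|bx]; first by rewrite h'l//; ring.
  by rewrite /h' leNgt bx.
exists h'; split; last exact: h'l.
have glue s : (s == 1) || (s == -1) ->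
    cvx a b (fun x => h x + s * f x) -> cvx b c (fun x => h1 x + s * f x) ->
    cvx a c (fun x => h' x + s * f x).
  move=> s1 e1 e2; apply: (@cvx_glue _ a b c).
  - by apply: cvx_ext e1 => x /andP[_ xb]; rewrite h'l.
  - apply: cvx_ext (cvxD e2 (@cvx_affine R b c K (h b - h1 b - K * b))) => x /andP[bx _].
    by rewrite h'r//; ring.
  - move=> u w /andP[au ub] /andP[bw wc].
    rewrite (h'l u)// (h'l b)// h'r//.
    have := lh u b au ub (lexx _); have := lf u b au ub (lexx _).
    have := mf b w (lexx _) bw wc; have := mh b w (lexx _) bw wc.
    rewrite !ler_norml => /andP[q1 q2] /andP[q3 q4] /andP[q5 q6] /andP[q7 q8].
    have bu0 : 0 <= b - u by rewrite subr_ge0.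
    have wb0 : 0 <= w - b by rewrite subr_ge0.
    have p1 : (h b + s * f b) - (h u + s * f u) <= 2 * L * (b - u).
      by case/orP: s1 => /eqP ->; lra.
    have p2 : - (2 * M * (w - b)) <= (h1 w + s * f w) - (h1 b + s * f b).
      by case/orP: s1 => /eqP ->; lra.
    have := ler_wpM2l wb0 p1; have := ler_wpM2l bu0 p2.
    rewrite /K; lra.
split.
- apply: cvx_ext (glue 1 _ _ _); rewrite ?eqxx//.
  + by move=> x _; rewrite mul1r.
  + by apply: cvx_ext c1 => x _; rewrite mul1r.
  + by apply: cvx_ext d1 => x _; rewrite mul1r.
- apply: cvx_ext (glue (-1) _ _ _); rewrite ?eqxx ?orbT//.
  + by move=> x _; rewrite mulN1r.
  + by apply: cvx_ext c2 => x _; rewrite mulN1r.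
  + by apply: cvx_ext d2 => x _; rewrite mulN1r.
- exists (L + M + K); split; apply: (@lip_glue _ a b c).
  + by apply: lip_le lf; rewrite /K; lra.
  + by apply: lip_le mf; rewrite /K; lra.
  + apply: (@lip_ext _ _ _ _ h).
      by move=> x /andP[_ xb]; rewrite h'l.
    by apply: lip_le lh; rewrite /K; lra.
  + apply: (@lip_ext _ _ _ _ (fun x => h b + (h1 x - h1 b) + K * (x - b))).
      by move=> x /andP[bx _]; rewrite h'r.
    move=> u v bu uv vc.
    have := mh u v bu uv vc; rewrite !ler_norml => /andP[q1 q2].
    have vu : 0 <= v - u by rewrite subr_ge0.
    have := mulr_ge0 L0 vu; have := mulr_ge0 M0 vu.
    by rewrite /K; lra.
Qed.

Lemma control_extend_left a b c f h : a < b -> b < c -> control b c f h ->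
  dcon a b f ->
  exists h', control a c f h' /\ forall x, b <= x -> h' x = h x.
Proof.
move=> ab bc /control_reflect ch [h1 /control_reflect ch1].
have [||h' [ch' h'E]] := control_extend_right _ _ ch (ex_intro _ _ ch1).
- by rewrite ltrN2.
- by rewrite ltrN2.
exists (fun x => h' (- x)); split.
  have := control_reflect ch'; rewrite !opprK => -[e1 e2 [L [l1 l2]]].
  split; last exists L; last split => //.
  - by apply: cvx_ext e1 => x _; rewrite opprK.
  - by apply: cvx_ext e2 => x _; rewrite opprK.
  - by apply: lip_ext l1 => x _; rewrite opprK.
by move=> x bx; rewrite h'E ?lerN2// opprK.
Qed.

(** The half-line is exhausted by the intervals [al k, be k]. Each control function extends the
    previous one without changing its values, so they define a single H with H + f and H - f convex,
    and f is half the difference of these. *)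
Lemma loc_dcon_diff_convex x0 f :
  (forall a b, x0 < a -> a < b -> dcon a b f) -> diff_convex `]x0, +oo[ f.
Proof.
move=> locf.
pose al k : R := x0 + k.+2%:R^-1; pose be k : R := x0 + k.+1%:R.
have al0 k : x0 < al k by rewrite ltrDl invr_gt0.
have als k : al k.+1 < al k by rewrite ltrD2l ltf_pV2 ?posrE// ltr_nat.
have bes k : be k < be k.+1 by rewrite ltrD2l ltr_nat.
have albe k : al k < be k.
  rewrite ltrD2l (@lt_le_trans _ _ 1)// ?ler1n// invf_lt1// (@ltr_nat _ 1)//.
have alm j k : (j <= k)%N -> al k <= al j.
  by move=> jk; rewrite lerD2l lef_pV2 ?posrE// ler_nat.
have bem j k : (j <= k)%N -> be j <= be k by move=> jk; rewrite lerD2l ler_nat.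
(* The validity of the given control function is a premise inside the existential, so that choice
   applies to all pairs. *)
have step (kh : nat * (R -> R)) : exists h', control (al kh.1) (be kh.1) f kh.2 ->
    control (al kh.1.+1) (be kh.1.+1) f h' /\ forall x, al kh.1 <= x <= be kh.1 -> h' x = kh.2 x.
  case: kh => k h /=.
  have [ch|nch] := pselect (control (al k) (be k) f h); last by exists h.
  have [h1 [ch1 h1E]] := control_extend_right (albe k) (bes k) ch
    (locf _ _ (lt_trans (al0 k) (albe k)) (bes k)).
  have [h2 [ch2 h2E]] := control_extend_left (als k) (lt_trans (albe k) (bes k)) ch1
    (locf _ _ (al0 k.+1) (als k)).
  by exists h2 => _; split => // x /andP[ax xb]; rewrite h2E// h1E.
have [st stP] := choice step.
have [h0 ch0] := locf (al 0) (be 0) (al0 0) (albe 0).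
pose hs := nat_rect (fun=> R -> R) h0 (fun k h => st (k, h)).
have hsc k : control (al k) (be k) f (hs k).
  by elim: k => [//|k IH]; have [] := stP (k, hs k) IH.
have hsE j k x : (j <= k)%N -> al j <= x <= be j -> hs k x = hs j x.
  move=> + /andP[jx xj]; elim: k => [|k IH]; first by rewrite leqn0 => /eqP ->.
  rewrite leq_eqVlt => /orP[/eqP <- //|]; rewrite ltnS => jk.
  rewrite -IH//; have [_] := stP (k, hs k) (hsc k); apply.
  by rewrite /= (le_trans _ jx) ?(le_trans xj) ?alm ?bem.
have kP x : exists k, x0 < x -> al k <= x <= be k.
  have [xx|xx] := ltP x0 x; last by exists 0.
  have y0 : 0 < x - x0 by rewrite subr_gt0.
  exists (Num.bound (x - x0) + Num.bound ((x - x0)^-1))%N => _.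
  have b1 := archi_boundP (ltW y0).
  have yV : 0 <= (x - x0)^-1 by rewrite invr_ge0 ltW.
  have b2 := archi_boundP yV.
  set k := (_ + _)%N.
  have k1 : x - x0 <= k.+1%:R.
    by apply/ltW/(lt_le_trans b1); rewrite ler_nat /k -addnS leq_addr.
  have k2 : (x - x0)^-1 <= k.+2%:R.
    by apply/ltW/(lt_le_trans b2); rewrite ler_nat /k -addn2 addnAC leq_addl.
  apply/andP; split; last by rewrite /be; lra.
  rewrite /al -lerBrDl -(invrK (x - x0)) lef_pV2// ?posrE ?invr_gt0//.
have [K KP] := choice kP.
pose H x := hs (K x) x.
(* The index picked for x is immaterial, since successive control functions agree on the smaller
   interval. *)
have HE k x : x0 < x -> al k <= x <= be k -> H x = hs k x.
  move=> xx kx; rewrite /H; have [kK|/ltnW Kk] := leqP k (K x).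
    exact: hsE.
  by apply/esym; apply: hsE => //; exact: KP.
have Hc p q : x0 < p -> p <= q ->
    cvx p q (fun x => H x + f x) /\ cvx p q (fun x => H x - f x).
  move=> xp pq; have xq : x0 < q by exact: lt_le_trans pq.
  pose k := maxn (K p) (K q).
  have kp : al k <= p.
    by have /andP[+ _] := KP _ xp; apply: le_trans; rewrite alm// leq_maxl.
  have qk : q <= be k.
    have /andP[_ qK] := KP _ xq; apply: le_trans qK _; rewrite bem// leq_maxr//.
  have HEx x : p <= x <= q -> hs k x = H x.
    by move=> /andP[px xq']; rewrite -HE//; lra.
  have [c1 c2 _] := hsc k.
  split.
  - by apply: cvx_ext (cvx_sub kp qk c1) => x /HEx ->.
  - by apply: cvx_ext (cvx_sub kp qk c2) => x /HEx ->.
exists (fun x => 2^-1 * (H x + f x)), (fun x => 2^-1 * (H x - f x)); split.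
- apply: cvx_convex_function => p q; rewrite /= !in_itv/= !andbT => xp _ pq.
  by apply: cvxZ; [rewrite invr_ge0|exact: (Hc p q xp pq).1].
- apply: cvx_convex_function => p q; rewrite /= !in_itv/= !andbT => xp _ pq.
  by apply: cvxZ; [rewrite invr_ge0|exact: (Hc p q xp pq).2].
- by move=> x _; field.
Qed.

(** A convex function may have unbounded slopes, or jump, at the endpoint x0; it is Lipschitz only
    on compact intervals strictly inside. The control function of g - h is g + h. *)
Lemma diff_convex_dcon (x0 : R) f a b : x0 < a -> a <= b ->
  diff_convex `[x0, +oo[ f -> dcon a b f.
Proof.
move=> xa ab [g [h [cg ch fE]]].
have D x : x0 <= x <= b + 1 -> `[x0, +oo[%classic x.
  by move=> /andP[? _]; rewrite /= in_itv/= andbT.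
have cg' := convex_function_cvx D cg; have ch' := convex_function_cvx D ch.
have bb : b < b + 1 by rewrite ltrDl.
have [L1 l1] := cvx_lip xa ab bb cg'; have [L2 l2] := cvx_lip xa ab bb ch'.
have cg2 := cvx_sub (ltW xa) (ltW bb) cg'; have ch2 := cvx_sub (ltW xa) (ltW bb) ch'.
have fE' x : a <= x <= b -> f x = g x - h x.
  by move=> /andP[ax xb]; apply: fE; rewrite /= in_itv/= andbT; lra.
exists (fun x => g x + h x); split.
- by apply: cvx_ext (cvxZ (ler0n _ 2) cg2) => x /fE' ->; ring.
- by apply: cvx_ext (cvxZ (ler0n _ 2) ch2) => x /fE' ->; ring.
- exists (`|L1| + `|L2|).
  have l1' := lip_le (ler_norm L1) l1; have l2' := lip_le (ler_norm L2) l2.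
  split; last exact: lipD.
  apply: lip_ext (lipD l1' (_ : lip a b `|L2| (fun x => - h x))) => [x /fE' //|].
  by move=> u v au uv vb; rewrite opprK addrC distrC l2'.
Qed.

End local_to_global.

(** * Integrals of left derivatives *)

Section integration.
Context {R : realType}.
Notation mu := (@lebesgue_measure R).
Implicit Types (f g h F v : R -> R) (a b c d u w x y z L : R).

Lemma continuous_itv_integrable a b f :
  (forall x, a <= x <= b -> {for x, continuous f}) ->
  mu.-integrable `[a, b] (EFin \o f).
Proof.
move=> cf; apply: continuous_compact_integrable; first exact: segment_compact.
exact: continuous_withinW.
Qed.

Lemma antiderivative f : (forall x, 0 < x -> {for x, continuous f}) ->
  exists F, forall x, 0 < x -> is_derive x 1 F (f x).
Proof.
move=> cf.
(* The base point is 1, since f need not be integrable near 0. *)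
pose F y := if 1 <= y then \int[mu]_(t in `[1, y]) f t
            else - \int[mu]_(t in `[y, 1]) f t.
exists F => x x0.
pose a := Num.min x 1 / 2.
have [a0 ax a1] : [/\ 0 < a, a < x & a < 1].
  by rewrite /a; have [?|?] := leP x 1; split; lra.
have If u w : a <= u -> mu.-integrable `[u, w] (EFin \o f).
  move=> au; apply: continuous_itv_integrable => z /andP[uz _]; apply: cf; lra.
have FE y : a < y -> F y = \int[mu]_(t in `[a, y]) f t - \int[mu]_(t in `[a, 1]) f t.
  move=> ay; rewrite /F; case: leP => y1.
    rewrite Rintegral_itvB ?bnd_simp ?If ?(ltW a1)//.
    rewrite Rintegral_itv_obnd_cbnd//; apply: integrableS (If a y (lexx _)) => //.
    by move=> z /=; rewrite !in_itv/=; lra.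
  apply/eqP; rewrite eqr_oppLR opprB; apply/eqP.
  rewrite Rintegral_itvB ?bnd_simp ?If// ?(ltW ay) ?(ltW y1)//.
  rewrite Rintegral_itv_obnd_cbnd//; apply: integrableS (If a 1 (lexx _)) => //.
  by move=> z /=; rewrite !in_itv/=; lra.
have xx1 : x < x + 1 by rewrite ltrDl.
have [dG dE] := @continuous_FTC1_closed R f a x (x + 1) xx1 (If a _ (lexx _)) ax (cf x x0).
apply: (@near_eq_is_derive _ _ _
  (fun y => \int[mu]_(t in `[a, y]) f t - \int[mu]_(t in `[a, 1]) f t)).
  by near=> y; rewrite FE//; near: y; exact: lt_nbhsr.
rewrite -[f x]subr0; apply: is_deriveB.
by apply: DeriveDef; [exact: dG|rewrite -derive1E; exact: dE].
Unshelve. all: by end_near. Qed.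

Lemma integral_is_derive f F a b : a < b ->
  (forall x, a <= x <= b -> {for x, continuous f}) ->
  (forall x, a <= x <= b -> is_derive x 1 F (f x)) ->
  (\int[mu]_(t in `[a, b]) (f t)%:E = (F b - F a)%:E)%E.
Proof.
move=> ab cf dF.
have cF x : a <= x <= b -> {for x, continuous F}.
  by move=> /dF[dfx _]; apply: differentiable_continuous; exact/derivable1_diffP.
rewrite (@continuous_FTC2 _ f F)//.
- exact: continuous_withinW.
- split.
  + by move=> x; rewrite in_itv/= => xab; have [] : is_derive x 1 F (f x) by apply: dF; lra.
  + by apply: cvg_at_right_filter; apply: cF; rewrite lexx ltW.
  + by apply: cvg_at_left_filter; apply: cF; rewrite lexx ltW.
- move=> x; rewrite in_itv/= => xab; rewrite derive1E.
  have ? : is_derive x 1 F (f x) by apply: dF; lra.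
  exact: derive_val.
Qed.

Lemma Rintegral_is_derive f F a b : a <= b ->
  (forall x, a <= x <= b -> {for x, continuous f}) ->
  (forall x, a <= x <= b -> is_derive x 1 F (f x)) ->
  \int[mu]_(t in `[a, b]) f t = F b - F a.
Proof.
rewrite le_eqVlt => /orP[/eqP <- _ _|ab cf dF].
  by rewrite set_itv1 Rintegral_set1 subrr.
by rewrite /Rintegral (integral_is_derive ab cf dF).
Qed.

(* Dominated convergence for the left difference quotients of f, whose integrals
   are left difference quotients of a primitive of f. *)
Lemma lderive_FTC f v a0 a b L : 0 < a0 -> a0 < a -> a < b ->
  (forall x, 0 < x -> {for x, continuous f}) -> lip a0 b L f ->
  (forall x, a <= x <= b -> is_lderive f x (v x)) ->
  measurable_fun `[a, b] v /\
  (\int[mu]_(t in `[a, b]) (v t)%:E = (f b - f a)%:E)%E.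
Proof.
move=> a00 a0a ab cf lf dv.
have [F dF] := antiderivative cf.
(* These steps tend to 0 and never exceed a - a0, so the shifted points stay in [a0, b], where f is
   Lipschitz. *)
pose h m : R := (a - a0) / m.+1%:R.
have h0 m : 0 < h m by rewrite divr_gt0// subr_gt0.
have ha m : h m <= a - a0.
  by rewrite ler_pdivrMr// ler_peMr ?ler1n// subr_ge0 ltW.
have hcvg y : (y - h m) @[m --> \oo] --> y.
  rewrite -[X in _ --> X]subr0; apply: cvgB; first exact: cvg_cst.
  rewrite -(mulr0 (a - a0)); apply: cvgM; first exact: cvg_cst.
  exact: cvg_harmonic.
have lseq g y d : is_lderive g y d ->
    ((g (y - h m) - g y) / ((y - h m) - y)) @[m --> \oo] --> d.
  move=> /cvg_at_leftP; apply; split => // m.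
  by rewrite ltrBlDr ltrDl.
pose q m y := (f (y - h m) - f y) / ((y - h m) - y).
have qE m y : q m y = (f y - f (y - h m)) * (h m)^-1.
  by rewrite /q (_ : y - h m - y = - h m) ?invrN ?mulrN -?mulNr ?opprB//; ring.
have cq m x : a <= x <= b -> {for x, continuous (q m)}.
  move=> /andP[ax xb].
  have -> : q m = (fun y => (f y - f (y - h m)) * (h m)^-1).
    by apply/funext => y; rewrite qE.
  apply: cvgM; last exact: cvg_cst.
  apply: cvgB; first by apply: cf; lra.
  apply: (@cvg_comp _ _ _ (fun y => y - h m) f).
    by apply: cvgB; [exact: cvg_id|exact: cvg_cst].
  by apply: cf; have := ha m; lra.
have mq m : measurable_fun `[a, b] (q m).
  apply/measurable_EFinP; apply: (@measurable_int _ _ _ mu).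
  exact: continuous_itv_integrable (cq m).
have qv x : `[a, b]%classic x -> q m x @[m --> \oo] --> v x.
  by rewrite /= in_itv/= => xab; apply: lseq; exact: dv.
split; first exact: measurable_fun_cvg qv.
have Iq m : (\int[mu]_(t in `[a, b]) (q m t)%:E =
    ((F b - F (b - h m)) / h m - (F a - F (a - h m)) / h m)%:E)%E.
  have dG x : a <= x <= b ->
      is_derive x 1 (fun y => (h m)^-1 * (F y - F (y - h m))) (q m x).
    move=> /andP[ax xb]; rewrite qE mulrC.
    have -> : (h m)^-1 * (f x - f (x - h m)) = (h m)^-1 *: (f x - f (x - h m)) by [].
    apply: is_deriveZ; apply: is_deriveB; first by apply: dF; lra.
    have -> : f (x - h m) = f (x - h m) * 1 by rewrite mulr1.
    apply: (@is_derive1_comp _ F (fun y => y - h m)).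
      by apply: dF; have := ha m; lra.
    rewrite -[1 in X in is_derive _ _ _ X]subr0; apply: is_deriveB.
  by rewrite (integral_is_derive ab (cq m) dG); congr (_ %:E); ring.
have c1 : (\int[mu]_(t in `[a, b]) (q m t)%:E)%E @[m --> \oo] -->
    (\int[mu]_(t in `[a, b]) (v t)%:E)%E.
  apply: (@dominated_cvg _ _ _ mu _ _ _ _ (cst L%:E)) => //.
  - by move=> m; apply/measurable_EFinP; exact: mq.
  - by move=> x xab; apply: cvg_EFin; [exact: nearW|exact: qv].
  - have := @continuous_itv_integrable a b (fun=> L).
    by apply => x _; exact: cvg_cst.
  - move=> m x; rewrite /= in_itv/= => /andP[ax xb]; rewrite lee_fin qE normrM.
    rewrite [X in _ * X]gtr0_norm ?invr_gt0// ler_pdivrMr//.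
    have := lf (x - h m) x; rewrite (_ : x - (x - h m) = h m); last by ring.
    by apply; have := ha m; have := h0 m; lra.
have c2 : (\int[mu]_(t in `[a, b]) (q m t)%:E)%E @[m --> \oo] --> (f b - f a)%:E%E.
  under eq_fun do rewrite Iq.
  apply: cvg_EFin; first exact: nearW.
  have e y m : (F y - F (y - h m)) / h m = (F (y - h m) - F y) / ((y - h m) - y).
    by rewrite (_ : y - h m - y = - h m) ?invrN ?mulrN -?mulNr ?opprB//; ring.
  under eq_fun do rewrite !e.
  by apply: cvgB; apply: lseq; apply: is_derive_lderive; apply: dF; lra.
exact: (cvg_unique _ c1 c2).
Qed.

(** Nonnegativity of v allows monotone convergence along [a, a + n], without integrability on the
    half-line being known beforehand. *)
Lemma lderive_FTCy f v a0 a l : 0 < a0 -> a0 < a ->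
  (forall x, 0 < x -> {for x, continuous f}) ->
  (forall b, a < b -> exists L, lip a0 b L f) ->
  (forall x, a <= x -> is_lderive f x (v x)) ->
  (forall x, a <= x -> 0 <= v x) ->
  f x @[x --> +oo] --> l ->
  \int[mu]_(t in `[a, +oo[) v t = l - f a.
Proof.
move=> a00 a0a cf lf dv v0 fl.
have IE n : measurable_fun `[a, a + n%:R] v /\
    (\int[mu]_(t in `[a, (a + n%:R)%R]) (v t)%:E = (f (a + n%:R) - f a)%:E)%E.
  case: n => [|n].
    by rewrite addr0 set_itv1 subrr integral_set1; split => //; exact: measurable_fun_set1.
  have an : a < a + n.+1%:R by rewrite ltrDl.
  have [L lfL] := lf _ an.
  by apply: (lderive_FTC a00 a0a an cf lfL) => x /andP[ax _]; exact: dv.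
have c1 : (\int[mu]_(t in `[a, (a + n%:R)%R]) (v t)%:E)%E @[n --> \oo] -->
    (\int[mu]_(t in `[a, +oo[) (v t)%:E)%E.
  rewrite itv_bndy_bigcup_BRight.
  apply: ge0_nondecreasing_set_cvg_integral => //.
  - move=> m n mn; apply/subsetPset => x /=; rewrite !in_itv/= => /andP[-> xa] /=.
    by apply: le_trans xa _; rewrite lerD2l ler_nat.
  - by move=> n; apply/measurable_EFinP; exact: (IE n).1.
  - by move=> n x; rewrite /= in_itv/= => /andP[ax _]; rewrite lee_fin v0.
have c2 : (\int[mu]_(t in `[a, (a + n%:R)%R]) (v t)%:E)%E @[n --> \oo] --> (l - f a)%:E%E.
  under eq_fun do rewrite (IE _).2.
  apply: cvg_EFin; first exact: nearW.
  apply: cvgB; last exact: cvg_cst.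
  apply/((cvg_pinftyP f l).1 fl)/cvgryPge => r.
  by near do rewrite -lerBlDl; exact: nbhs_infty_ger.
by rewrite /Rintegral (cvg_unique _ c1 c2).
Unshelve. all: by end_near. Qed.

End integration.

Section powers.
Context {R : realType}.
Implicit Types x y p q : R.

Lemma pos_powRD x p q : 0 < x -> x `^ (p + q) = x `^ p * x `^ q.
Proof. by move=> x0; rewrite powRD// (gt_eqF x0) implybT. Qed.

Lemma pos_powRVM x p : 0 < x -> x `^ (- p) * x `^ p = 1.
Proof. by move=> x0; rewrite -pos_powRD// addNr powRr0. Qed.

Lemma one_powR p : 1 `^ p = 1 :> R.
Proof. by rewrite powR1. Qed.

Lemma continuous_powR p x : 0 < x -> {for x, continuous (fun y => y `^ p)}.
Proof.
move=> x0; apply: differentiable_continuous; apply/derivable1_diffP.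
by have [] := is_derive1_powR p x0.
Qed.

Lemma is_derive_continuous (f : R -> R) x d : is_derive x 1 f d -> {for x, continuous f}.
Proof. by move=> [df _]; apply: differentiable_continuous; exact/derivable1_diffP. Qed.

Lemma lt_powR_pos x y p : 0 < p -> 0 < x -> x < y -> x `^ p < y `^ p.
Proof.
by move=> p0 x0 xy; rewrite gt0_ltr_powR// nnegrE ltW// (lt_trans x0).
Qed.

Lemma le_powR_pos x y p : 0 <= p -> 0 < x -> x <= y -> x `^ p <= y `^ p.
Proof.
by move=> p0 x0 xy; rewrite ge0_ler_powR// nnegrE ltW// (lt_le_trans x0).
Qed.

Lemma le_powR_neg x y p : p <= 0 -> 0 < x -> x <= y -> y `^ p <= x `^ p.
Proof.
move=> p0 x0 xy; have y0 : 0 < y by exact: lt_le_trans xy.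
suff H r : 0 <= r -> y `^ (- r) <= x `^ (- r) by rewrite -(opprK p); apply: H; lra.
by move=> r0; rewrite !powRN lef_pV2 ?posrE ?powR_gt0//; exact: le_powR_pos.
Qed.

End powers.

(** * Antiderivative of a negative power of the inverse of Phi *)

Section inverse_power_integral.
Context {R : realType}.
Notation mu := (@lebesgue_measure R).
Implicit Types x y z u v : R.
Variables (n : R) (P Pinv : R -> R).
Hypothesis n1 : 1 < n.
Hypothesis P0 : forall x, 0 < x -> 0 < P x.
Hypothesis Pinv0 : forall y, 0 < y -> 0 < Pinv y.
Hypothesis PK : forall y, 0 < y -> P (Pinv y) = y.
Hypothesis Pmono : forall x y, 0 < x -> x < y -> P x < P y.
Hypothesis Pdc : forall u v, 0 < u -> u < v -> dcon u v P.

Definition inv_pow (y : R) : R := Pinv y `^ (- n).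
Local Notation s := inv_pow.

Lemma P_le x y : 0 < x -> x <= y -> P x <= P y.
Proof. by move=> x0; rewrite le_eqVlt => /orP[/eqP <-//|xy]; exact/ltW/Pmono. Qed.

Lemma Pinv_lt x y : 0 < y -> 0 < x -> P x < y -> x < Pinv y.
Proof.
move=> y0 x0 xy; rewrite ltNge; apply/negP => yx.
by have := P_le (Pinv0 y0) yx; rewrite PK// leNgt xy.
Qed.

Lemma Pinv_gt x y : 0 < y -> 0 < x -> y < P x -> Pinv y < x.
Proof.
move=> y0 x0 xy; rewrite ltNge; apply/negP => yx.
by have := P_le x0 yx; rewrite PK// leNgt xy.
Qed.

Lemma Pinv_le y z : 0 < y -> y <= z -> Pinv y <= Pinv z.
Proof.
move=> y0 yz; rewrite leNgt; apply/negP => zy.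
have z0 : 0 < z by exact: lt_le_trans yz.
by have := Pmono (Pinv0 z0) zy; rewrite !PK// ltNge yz.
Qed.

Lemma PinvK x : 0 < x -> Pinv (P x) = x.
Proof.
move=> x0; apply/eqP; case: ltgtP => // h.
  by have := Pmono (Pinv0 (P0 x0)) h; rewrite PK ?ltxx// P0.
by have := Pmono x0 h; rewrite PK ?ltxx// P0.
Qed.

Lemma Pinv_continuous y : 0 < y -> {for y, continuous Pinv}.
Proof.
move=> y0; have x0 := Pinv0 y0.
apply/cvgrPdist_lt => /= e e0.
pose e' := Num.min e (Pinv y / 2).
have [e'0 e'e e'x] : [/\ 0 < e', e' <= e & e' < Pinv y].
  by rewrite /e'; have [?|?] := leP e (Pinv y / 2); split; lra.
have l1 : P (Pinv y - e') < y by rewrite -[X in _ < X]PK//; apply: Pmono; lra.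
have l2 : y < P (Pinv y + e') by rewrite -[X in X < _]PK//; apply: Pmono; lra.
near=> z.
have z0 : 0 < z by near: z; exact: lt_nbhsr.
have h1 : Pinv y - e' < Pinv z.
  by apply: Pinv_lt => //; [lra|near: z; exact: lt_nbhsr].
have h2 : Pinv z < Pinv y + e'.
  by apply: Pinv_gt => //; [lra|near: z; exact: lt_nbhsl].
by rewrite ltr_norml; lra.
Unshelve. all: by end_near. Qed.

Lemma inv_pow_gt0 y : 0 < y -> 0 < s y.
Proof. by move=> y0; rewrite powR_gt0// Pinv0. Qed.

Lemma inv_powP x : 0 < x -> s (P x) = x `^ (- n).
Proof. by move=> x0; rewrite /s PinvK. Qed.

Lemma inv_pow_le y z : 0 < y -> y <= z -> s z <= s y.
Proof.
move=> y0 yz; have n0 : - n <= 0 by have := n1; lra.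
by apply: (le_powR_neg n0); [exact: Pinv0|exact: Pinv_le].
Qed.

Lemma inv_pow_continuous y : 0 < y -> {for y, continuous s}.
Proof.
move=> y0; apply: (@continuous_comp _ _ _ Pinv (fun x => x `^ (- n)) y).
  exact: Pinv_continuous.
by apply: continuous_powR; exact: Pinv0.
Qed.

Variables (q K1 : R).
Hypotheses (q0 : 0 < q) (qn : q < n) (K10 : 0 < K1).
Hypothesis Pgrowth : forall x, 0 < x -> P x <= K1 * (1 + x `^ q).

(** T is sup S - S for an antiderivative S of s, which yields nonnegativity and the limit 0 without
    improper integrals. The growth of P makes S bounded. *)
Lemma inv_pow_tail : exists T : R -> R,
  [/\ forall y, 0 < y -> is_derive y 1 T (- s y),
      forall y, 0 < y -> 0 <= T y,
      T y @[y --> +oo] --> 0 &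
      exists K2, 0 < K2 /\ forall x, 0 < x -> x `^ n * T (P x) <= K2 * (1 + x `^ q)].
Proof.
have [S dS] := antiderivative inv_pow_continuous.
(* For x >= 1 the growth bound becomes P x <= C x^q. Read through the inverse it says s v <= C^e
   v^-e, integrable at infinity because e > 1. *)
pose C := 2 * K1; pose e := n / q.
have C0 : 0 < C by rewrite mulr_gt0.
have e1 : 1 < e by rewrite ltr_pdivlMr// mul1r.
have e1' : 0 < e - 1 by rewrite subr_gt0.
have PC x : 1 <= x -> P x <= C * x `^ q.
  move=> x1; have x0 : 0 < x by exact: lt_le_trans x1.
  have : 1 <= x `^ q by rewrite -(one_powR q); apply: le_powR_pos => //; exact: ltW.
  move=> h; apply: le_trans (Pgrowth x0) _.
  by rewrite /C -mulrA mulrCA ler_wpM2l ?(ltW K10)//; lra.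
have P10 := P0 (@ltr01 R).
have sC v : P 1 <= v -> s v <= C `^ e * v `^ (- e).
  move=> v1; have v0 : 0 < v by exact: lt_le_trans v1.
  have z1 : 1 <= Pinv v by rewrite -[X in X <= _]PinvK//; exact: Pinv_le.
  have z0 := Pinv0 v0.
  have := PC _ z1; rewrite PK// => /(le_powR_pos (ltW (lt_trans ltr01 e1)) v0).
  rewrite powRM ?powR_ge0 ?(ltW C0)// -powRrM /e mulrCA (divff (lt0r_neq0 q0)) mulr1 => h.
  rewrite /inv_pow !powRN ler_pdivlMr ?powR_gt0// mulrC ler_pdivrMr ?powR_gt0//.
have Smono u v : 0 < u -> u <= v -> S u <= S v.
  move=> u0; rewrite le_eqVlt => /orP[/eqP <-//|uv].
  have [m /andP[um mv] h] := MVT_pos u0 uv dS.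
  rewrite -subr_ge0 h mulr_ge0 ?subr_ge0 ?ltW// inv_pow_gt0//.
  exact: lt_trans um.
have Sup v0 v : P 1 <= v0 -> v0 <= v -> S v <= S v0 + C `^ e / (e - 1) * v0 `^ (1 - e).
  move=> h1 h2; have v00 : 0 < v0 by exact: lt_le_trans h1.
  have tail u : 0 < u -> 0 <= C `^ e / (e - 1) * u `^ (1 - e).
    by move=> u0; rewrite mulr_ge0 ?powR_ge0// divr_ge0 ?powR_ge0// ltW.
  move: h2; rewrite le_eqVlt => /orP[/eqP <-|h2]; first by rewrite lerDl tail.
  (* The added term is the integral of C^e v^-e over [u, +oo[, so the bound on s makes H
     nonincreasing beyond P 1. *)
  pose H u := S u + C `^ e / (e - 1) * u `^ (1 - e).
  have dH u : 0 < u -> is_derive u 1 H (s u - C `^ e * u `^ (- e)).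
    move=> u0.
    have -> : s u - C `^ e * u `^ (- e) =
        s u + (C `^ e / (e - 1)) *: ((1 - e) * u `^ (1 - e - 1)).
      rewrite (_ : 1 - e - 1 = - e); last by ring.
      by rewrite /GRing.scale/=; field; rewrite gt_eqF.
    apply: is_deriveD; first exact: dS.
    by apply: is_deriveZ; exact: is_derive1_powR.
  have [m /andP[um mv] h] := MVT_pos v00 h2 dH.
  have : H v <= H v0.
    rewrite -subr_le0 h mulr_le0_ge0 ?subr_ge0 ?(ltW h2)// subr_le0 sC//.
    exact/ltW/(le_lt_trans h1).
  by apply: le_trans; rewrite lerDl tail// (lt_trans v00).
pose A := [set S v | v in [set v | 0 < v]].
have A0 : A !=set0 by exists (S 1), 1 => /=.
have Aub : ubound A (S (P 1) + C `^ e / (e - 1) * (P 1) `^ (1 - e)).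
  move=> _ [v /= v0 <-].
  apply: le_trans (Sup (P 1) (Num.max v (P 1)) (lexx _) _); last by rewrite le_max lexx orbT.
  by apply: Smono => //; rewrite le_max lexx.
have hA : has_sup A by split => //; eexists; exact: Aub.
have SA v : 0 < v -> S v <= sup A.
  by move=> v0; apply: ub_le_sup; [exact: hA.2|exists v].
exists (fun y => sup A - S y).
have Tbound v0 : P 1 <= v0 -> sup A - S v0 <= C `^ e / (e - 1) * v0 `^ (1 - e).
  move=> h1; have v00 : 0 < v0 by exact: lt_le_trans h1.
  rewrite lerBlDl; apply: ge_sup => // _ [v /= v0' <-].
  apply: le_trans (Sup v0 (Num.max v v0) h1 _); last by rewrite le_max lexx orbT.
  by apply: Smono => //; rewrite le_max lexx.
have Sdiff x v : 0 < x -> P x <= v -> S v - S (P x) <= x `^ (- n) * v.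
  move=> x0; rewrite le_eqVlt => /orP[/eqP <-|xv].
    by rewrite subrr mulr_ge0 ?powR_ge0// ltW// P0.
  have [m /andP[um mv] ->] := MVT_pos (P0 x0) xv dS.
  have h1 : s m <= x `^ (- n) by rewrite -inv_powP//; apply: inv_pow_le (ltW um); exact: P0.
  have h2 : 0 <= s m by rewrite ltW// inv_pow_gt0// (lt_trans (P0 x0)).
  have h3 := P0 x0; nra.
split.
- move=> y y0; rewrite -sub0r; apply: is_deriveB; exact: dS.
- by move=> y y0; rewrite subr_ge0 SA.
- apply/cvgrPdist_lt => /= r r0.
  have [_ [v /= v0 <-] hv] := sup_adherent r0 hA.
  near=> y; have vy : v <= y by near: y; apply: nbhs_pinfty_ge; exact: num_real.
  have y0 : 0 < y by exact: lt_le_trans vy.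
  have := SA _ y0; have := Smono _ _ v0 vy.
  by rewrite sub0r normrN ltr_norml; lra.
- exists (C / (e - 1) + C + (sup A - S (P 1)) + P 1).
  have t0 : 0 <= sup A - S (P 1) by rewrite subr_ge0 SA.
  have Ce : 0 < C / (e - 1) by rewrite divr_gt0.
  split; first by lra.
  move=> x x0; have xq0 := powR_gt0 q x0.
  have xn : x `^ n * x `^ (- n) = 1 by rewrite mulrC pos_powRVM.
  have xn0 := powR_gt0 n x0.
  have [x1|/ltW x1] := leP 1 x.
    (* The tail is split at v0. On [P x, v0] s is at most x^-n, which contributes x^-n v0; beyond v0
       the power bound integrates to C / (e - 1) x^(q - n). *)
    set v0 := C * x `^ q.
    have Pv0 : P x <= v0 := PC x x1.
    have v01 : P 1 <= v0 by apply: le_trans Pv0; exact: P_le.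
    have b1 := Tbound _ v01; have b2 := Sdiff x v0 x0 Pv0.
    have b3 : x `^ n * (C `^ e / (e - 1) * v0 `^ (1 - e)) = C / (e - 1) * x `^ q.
      rewrite /v0 powRM ?powR_ge0 ?(ltW C0)// -powRrM.
      have -> : q * (1 - e) = q - n by rewrite /e; field; rewrite gt_eqF.
      rewrite !pos_powRD// powRr1 ?ltW// powRN.
      rewrite (_ : x `^ (- n) = (x `^ n)^-1) ?powRN//.
      by field; rewrite !gt_eqF// powR_gt0.
    have : x `^ n * (sup A - S (P x)) <= C / (e - 1) * x `^ q + v0.
      have := ler_wpM2l (ltW xn0) b1; have := ler_wpM2l (ltW xn0) b2.
      by rewrite b3 (mulrA (x `^ n)) xn mul1r; lra.
    move/le_trans; apply; rewrite /v0.
    have := mulr_ge0 t0 (ltW xq0); have := mulr_gt0 P10 xq0.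
    have := mulr_gt0 C0 xq0; lra.
  have Px1 : P x <= P 1 by exact: P_le.
  have b2 := Sdiff x (P 1) x0 Px1.
  have xnle1 : x `^ n <= 1 by rewrite -(one_powR n); apply: le_powR_pos => //; have := n1; lra.
  have : x `^ n * (sup A - S (P x)) <= (sup A - S (P 1)) + P 1.
    have b4 : x `^ n * (S (P 1) - S (P x)) <= P 1.
      by have := ler_wpM2l (ltW xn0) b2; rewrite (mulrA (x `^ n)) xn mul1r.
    have := ler_wpM2r t0 xnle1; lra.
  move/le_trans; apply.
  have := mulr_ge0 t0 (ltW xq0); have := mulr_gt0 P10 xq0.
  have := mulr_gt0 C0 xq0; have := mulr_gt0 Ce xq0; lra.
Unshelve. all: by end_near. Qed.

Variable T : R -> R.
Hypothesis dT : forall y, 0 < y -> is_derive y 1 T (- s y).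
Hypothesis T_cvg0 : T y @[y --> +oo] --> 0.

Lemma loc_cvx_tail : loc_cvx T.
Proof.
apply: (loc_cvx_derive dT) => y z y0 yz; rewrite lerN2; exact: inv_pow_le.
Qed.

Lemma P_continuous x : 0 < x -> {for x, continuous P}.
Proof.
move=> x0; apply: (@dcon_continuous _ (x / 2) (x + 1)); first lra.
by apply: Pdc; lra.
Qed.

Lemma P_lderive x : 0 < x -> exists2 d, 0 <= d & is_lderive P x d.
Proof.
move=> x0; have [||d Pd] := @dcon_is_lderive _ (x / 2) (x + 1) P x; first lra.
  by apply: Pdc; lra.
exists d => //; apply: (cvgr_to_ge Pd); near=> y.
have y0 : 0 < y by near: y; exact: nbhs_left_gt.
have yx : y < x by near: y; exact: nbhs_left_lt.
by rewrite -mulrNN -invrN !opprB divr_ge0// subr_ge0 ltW// Pmono.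
Unshelve. all: by end_near. Qed.

Lemma integral_tail x : 0 < x ->
  \int[mu]_(y in `[x, +oo[) (y `^ (- n) * left_derive P y) = T (P x).
Proof.
move=> x0.
(* Since s (P y) = y^-n, the integrand is the left derivative of - T o P. With this sign the
   function increases to 0 and its left derivative is nonnegative. *)
have -> : T (P x) = 0 - (- T (P x)) by rewrite opprK add0r.
apply: (@lderive_FTCy _ (fun y => - T (P y)) _ (x / 2)); [lra|lra| | | | |].
- move=> y y0; apply: cvgN.
  by apply: (@cvg_comp _ _ _ P T); [exact: P_continuous|exact: is_derive_continuous (dT (P0 y0))].
- move=> b xb.
  have d : dcon (x / 2) b P by apply: Pdc; lra.
  have Py y : x / 2 <= y <= b -> 0 < P y by move=> /andP[xy _]; apply: P0; lra.
  have xb' : x / 2 <= b by lra.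
  by have [h [_ _ [L [l _]]]] := dconN (dcon_loc_cvx d xb' Py loc_cvx_tail); exists L.
- move=> y xy; have y0 : 0 < y by exact: lt_le_trans xy.
  have [d d0 Pd] := P_lderive y0.
  rewrite (left_deriveE Pd) -inv_powP//.
  have := is_lderiveN (is_lderive_comp Pd (dT (P0 y0))).
  by rewrite mulNr opprK.
- move=> y xy; have y0 : 0 < y by exact: lt_le_trans xy.
  have [d d0 Pd] := P_lderive y0.
  by rewrite (left_deriveE Pd) mulr_ge0 ?powR_ge0.
- rewrite -oppr0; apply: cvgN; apply: (@cvg_comp _ _ _ P T) T_cvg0.
  apply/cvgryPgt => M; near=> y.
  have z0 : 0 < Pinv (Num.max M 1) by apply: Pinv0; rewrite lt_max ltr01 orbT.
  have zy : Pinv (Num.max M 1) < y by near: y; apply: nbhs_pinfty_gt; exact: num_real.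
  have := Pmono z0 zy; rewrite PK; last by rewrite lt_max ltr01 orbT.
  by apply: le_lt_trans; rewrite le_max lexx.
Unshelve. all: by end_near. Qed.

End inverse_power_integral.

(** * Two-sided derivatives and gluing *)

Section derivative_tools.
Context {R : realType}.
Implicit Types (f g F : R -> R) (x y d e c : R).

(* Unlike is_derive, not a class: unification does not trigger instance search. *)
Record has_deriv f x d : Prop := HasDeriv { has_derivP : is_derive x 1 f d }.

Lemma has_derivD f g x d e : has_deriv f x d -> has_deriv g x e ->
  has_deriv (fun y => f y + g y) x (d + e).
Proof. by move=> [df] [dg]; split; exact: is_deriveD. Qed.

Lemma has_derivB f g x d e : has_deriv f x d -> has_deriv g x e ->
  has_deriv (fun y => f y - g y) x (d - e).
Proof. by move=> [df] [dg]; split; exact: is_deriveB. Qed.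

Lemma has_derivM f g x d e : has_deriv f x d -> has_deriv g x e ->
  has_deriv (fun y => f y * g y) x (d * g x + f x * e).
Proof.
move=> [df] [dg]; split; have := is_deriveM df dg.
by rewrite /GRing.scale/= addrC (mulrC (g x)).
Qed.

Lemma has_derivZ f c x d : has_deriv f x d -> has_deriv (fun y => c * f y) x (c * d).
Proof. by move=> [df]; split; exact: is_deriveZ. Qed.

Lemma has_deriv_cst c x : has_deriv (fun=> c) x 0.
Proof. by split; exact: is_derive_cst. Qed.

Lemma has_deriv_id x : has_deriv (fun y => y) x 1.
Proof. by split; exact: is_derive_id. Qed.

Lemma has_deriv_comp f F x d e : has_deriv f x d -> has_deriv F (f x) e ->
  has_deriv (fun y => F (f y)) x (e * d).
Proof. by move=> [df] [dF]; split; exact: is_derive1_comp. Qed.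

Lemma has_deriv_eq f x d e : has_deriv f x d -> d = e -> has_deriv f x e.
Proof. by move=> + <-. Qed.

Lemma has_deriv_powR p x : 0 < x -> has_deriv (fun y => y `^ p) x (p * x `^ (p - 1)).
Proof. by move=> x0; split; exact: is_derive1_powR. Qed.

Lemma has_deriv_near f g x d : (\forall y \near x, f y = g y) ->
  has_deriv f x d -> has_deriv g x d.
Proof. by move=> fg [df]; split; exact: near_eq_is_derive fg df. Qed.

Lemma has_deriv_continuous f x d : has_deriv f x d -> {for x, continuous f}.
Proof. by move=> [df]; exact: is_derive_continuous df. Qed.

Lemma has_deriv_MVT F (F' : R -> R) x y : 0 < x -> x < y ->
  (forall z, 0 < z -> has_deriv F z (F' z)) ->
  exists2 m, x < m < y & F y - F x = F' m * (y - x).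
Proof. by move=> x0 xy dF; apply: (MVT_pos x0 xy) => z z0; exact/has_derivP/dF. Qed.

(** The Caratheodory slopes of f1 and f2 agree at x, so pasting them there gives a slope function
    for f that is continuous at x. *)
Lemma has_deriv_glue f f1 f2 x d : has_deriv f1 x d -> has_deriv f2 x d ->
  (\forall y \near x, y <= x -> f y = f1 y) ->
  (\forall y \near x, x <= y -> f y = f2 y) -> has_deriv f x d.
Proof.
move=> [d1] [d2] e1 e2.
have E12 : f1 x = f2 x.
  by rewrite -(nbhs_singleton e1) ?lexx// (nbhs_singleton e2) ?lexx.
apply: (@has_deriv_near (fun y => if y <= x then f1 y else f2 y)).
  near=> y; case: leP => yx; apply/esym; first by move: yx; near: y.
  by move: (ltW yx); near: y.
move: d1 d2 => /is_derive1_caratheodory[g1 [g1E c1 v1]].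
move=> /is_derive1_caratheodory[g2 [g2E c2 v2]].
split; apply/is_derive1_caratheodory; exists (fun y => if y <= x then g1 y else g2 y).
split; last by rewrite lexx.
- by move=> z; rewrite lexx; case: ifP => _; rewrite ?E12 ?g1E -?E12 ?g1E// E12 g2E.
- apply/cvgrPdist_lt => /= r r0; rewrite lexx v1.
  have h1 : \forall y \near x, `|d - g1 y| < r.
    by rewrite -v1; move/cvgrPdist_lt : c1; exact.
  have h2 : \forall y \near x, `|d - g2 y| < r.
    by rewrite -v2; move/cvgrPdist_lt : c2; exact.
  near=> y; case: ifP => _; near: y; [exact: h1|exact: h2].
Unshelve. all: by end_near. Qed.

Lemma continuous_glue f f1 f2 x : {for x, continuous f1} -> {for x, continuous f2} ->
  (\forall y \near x, y <= x -> f y = f1 y) ->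
  (\forall y \near x, x <= y -> f y = f2 y) -> {for x, continuous f}.
Proof.
move=> c1 c2 e1 e2.
have E1 : f x = f1 x by rewrite (nbhs_singleton e1).
have E2 : f x = f2 x by rewrite (nbhs_singleton e2).
apply/cvgrPdist_lt => /= r r0.
have h1 : \forall y \near x, `|f x - f1 y| < r by rewrite E1; move/cvgrPdist_lt : c1; exact.
have h2 : \forall y \near x, `|f x - f2 y| < r by rewrite E2; move/cvgrPdist_lt : c2; exact.
near=> y; have [yx|/ltW xy] := leP y x.
  have -> : f y = f1 y by move: yx; near: y.
  by near: y.
have -> : f y = f2 y by move: xy; near: y.
by near: y.
Unshelve. all: by end_near. Qed.

End derivative_tools.

Section continuity.
Context {R : realType} {X : topologicalType}.
Implicit Types (p q : X -> R) (t : X).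

Lemma continuousD_at p q t : {for t, continuous p} -> {for t, continuous q} ->
  {for t, continuous (fun y => p y + q y)}.
Proof. exact: cvgD. Qed.

Lemma continuousB_at p q t : {for t, continuous p} -> {for t, continuous q} ->
  {for t, continuous (fun y => p y - q y)}.
Proof. exact: cvgB. Qed.

Lemma continuousM_at p q t : {for t, continuous p} -> {for t, continuous q} ->
  {for t, continuous (fun y => p y * q y)}.
Proof. exact: cvgM. Qed.

Lemma continuous_cst_at (c : R) t : {for t, continuous (fun _ : X => c)}.
Proof. exact: cvg_cst. Qed.

Lemma continuous_comp_at p (F : R -> R) t : {for t, continuous p} ->
  {for p t, continuous F} -> {for t, continuous (fun y => F (p y))}.
Proof. exact: continuous_comp. Qed.

Lemma continuous_max_at p q t : {for t, continuous p} -> {for t, continuous q} ->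
  {for t, continuous (fun y => Num.max (p y) (q y))}.
Proof. exact: continuous_max. Qed.

End continuity.

Ltac nonzero := repeat match goal with
  H : is_true (?x != 0) |- context [?x == 0] => rewrite (negbTE H) end; done.

(** * The candidate solution in terms of Phi *)

Section model.
Context {R : realType}.
Implicit Types c x y z u v : R.
(* P stands for Phi; T (P x) is the integral over [x, +oo[ in the definition of A;
   c ^ a times an antiderivative of f is ((1 - a) k / a) (T c + c ^ a U c); and E (c / P z)
   is, up to a factor depending only on z, the difference B c z - B (P z) z. *)
Variables (a n k : R) (P Pinv T U E : R -> R).
Hypothesis params : [/\ 0 < a, a < 1, 1 < n & 0 < k].
Let params_n1 : 1 < n. Proof. by case: params. Qed.
Hypothesis P0 : forall x, 0 < x -> 0 < P x.
Hypothesis Pinv0 : forall y, 0 < y -> 0 < Pinv y.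
Hypothesis PK : forall y, 0 < y -> P (Pinv y) = y.
Hypothesis Pmono : forall x y, 0 < x -> x < y -> P x < P y.
Local Notation s := (inv_pow n Pinv).
Hypothesis dT : forall y, 0 < y -> has_deriv T y (- s y).
Hypothesis dU : forall y, 0 < y -> has_deriv U y (y `^ (- a) * s y).
Hypothesis dE : forall u, 0 < u -> has_deriv E u (- u `^ (- (n * (1 - a)))).
Hypothesis E1 : E 1 = 0.

(** This is c^a times A z plus the integral of f from P z to c. The term of A containing T (P z)
    cancels against the lower limit of that integral. *)
Definition coef_high c z : R := c `^ a *
  (- (k / (a * (n - 1))) * z `^ (- n) * P z `^ (1 - a)
   + (1 - a) * k / a * (c `^ (- a) * T c + U c - U (P z))).

(** This is B: the first line is its prescribed value P z^a A z at c = P z, and the term in E has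
    the prescribed derivative because G c z = z (c / P z)^(1 - a). *)
Definition coef_mid c z : R :=
  - (k / (a * (n - 1))) * z `^ (- n) * P z + (1 - a) * k / a * T (P z)
  + k / (n - 1) * z `^ (- n) * P z * E (c / P z).

Definition coef c z := if P z <= c then coef_high c z else coef_mid c z.

Definition dcoef_high c z : R := c `^ (a - 1) *
  (- (k / (n - 1)) * z `^ (- n) * P z `^ (1 - a) + (1 - a) * k * (U c - U (P z))).

Definition dcoef_mid c z : R :=
  - (k / (n - 1)) * z `^ (- n) * (c / P z) `^ (- (n * (1 - a))).

Definition dcoef c z := if P z <= c then dcoef_high c z else dcoef_mid c z.

(** P z^(1 - a) is a constant multiple of z phi z, so the second summand is c^a x phi z / (r - mu),
    written without phi. *)
Definition Wfun c x z : R := coef c z * x `^ n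
  + n * (k / (a * (n - 1))) * c `^ a * x * (P z `^ (1 - a) / z).

Definition Gam x z : R := P z * (x / z) `^ (1 - a)^-1.

(* The three cases in the definition of w: W is continued to c < Gamma affinely,
   with slope k. *)
Definition wmod c x z : R := let m := Num.max c (Gam x z) in
  Wfun m x z - k * (m - c).

(** The contributions of T cancel, and so do those of s coming from T and from U; this is what U is
    made for. *)
Lemma has_deriv_coef_high c z : 0 < c -> 0 < z ->
  has_deriv (coef_high^~ z) c (dcoef_high c z).
Proof.
move=> c0 z0; have [a0 a1 n1 k0] := params.
have dc p := has_deriv_powR p c0.
rewrite /coef_high; apply: has_deriv_eq.
  apply: has_derivM; first exact: dc.
  apply: has_derivD; first exact: has_deriv_cst.
  apply: has_derivZ; apply: has_derivB; last exact: has_deriv_cst.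
  apply: has_derivD; last exact: (dU c0).
  by apply: has_derivM; [exact: dc|exact: (dT c0)].
rewrite /dcoef_high.
have e1 : c `^ (a - 1) = c `^ a / c by rewrite pos_powRD// powR_inv1// ltW.
have e2 : c `^ (- a - 1) = (c `^ a)^-1 / c by rewrite pos_powRD// powR_inv1 ?ltW// powRN.
have e3 : c `^ (- a) = (c `^ a)^-1 by rewrite powRN.
have ca : c `^ a != 0 by rewrite gt_eqF// powR_gt0.
have n1' : n - 1 != 0 by rewrite gt_eqF// subr_gt0.
have a0' := lt0r_neq0 a0; have c0' := lt0r_neq0 c0.
rewrite e1 e2 e3; move: (U c) (U (P z)) (z `^ (- n)) (P z `^ (1 - a)) (T c) (s c) (c `^ a) ca.
move=> U1 U2 z1 P1 T1 s1 c1 c1nz.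
by field; nonzero.
Qed.

Lemma has_deriv_coef_mid c z : 0 < c -> 0 < z ->
  has_deriv (coef_mid^~ z) c (dcoef_mid c z).
Proof.
move=> c0 z0; have [a0 a1 n1 k0] := params; have Pz := P0 z0.
have cP : 0 < c / P z by rewrite divr_gt0.
rewrite /coef_mid; apply: has_deriv_eq.
  apply: has_derivD; first exact: has_deriv_cst.
  apply: has_derivZ; apply: (@has_deriv_comp _ (fun c => c / P z) E).
    by apply: has_derivM; [exact: has_deriv_id|exact: has_deriv_cst].
  exact: dE.
rewrite /dcoef_mid mulr0 addr0.
by field; rewrite !gt_eqF// subr_gt0.
Qed.

Lemma coef_glue z : 0 < z -> coef_high (P z) z = coef_mid (P z) z.
Proof.
move=> z0; have [a0 a1 n1 k0] := params; have Pz := P0 z0.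
rewrite /coef_high /coef_mid divff ?gt_eqF// E1.
have e3 : P z `^ (- a) = (P z `^ a)^-1 by rewrite powRN.
have e4 : P z `^ (1 - a) = P z / P z `^ a by rewrite pos_powRD// powRr1 ?ltW// powRN.
have ca : P z `^ a != 0 by rewrite gt_eqF// powR_gt0.
rewrite e3 e4; field; rewrite ca !gt_eqF// subr_gt0//.
Qed.

Lemma dcoef_glue z : 0 < z -> dcoef_high (P z) z = dcoef_mid (P z) z.
Proof.
move=> z0; have [a0 a1 n1 k0] := params; have Pz := P0 z0.
rewrite /dcoef_high /dcoef_mid divff ?gt_eqF// one_powR subrr mulr0 addr0 mulr1.
rewrite mulrC -(mulrA _ _ (P z `^ (a - 1))) -pos_powRD//.
by rewrite (_ : 1 - a + (a - 1) = 0) ?powRr0 ?mulr1//; ring.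
Qed.

Lemma has_deriv_coef c z : 0 < c -> 0 < z ->
  has_deriv (coef^~ z) c (dcoef c z).
Proof.
move=> c0 z0; have Pz := P0 z0; rewrite /dcoef; case: ltgtP => cP.
- apply: (@has_deriv_near _ (coef_high^~ z)); last exact: has_deriv_coef_high.
  by near=> y; rewrite /coef ifT// ltW//; near: y; exact: lt_nbhsr.
- apply: (@has_deriv_near _ (coef_mid^~ z)); last exact: has_deriv_coef_mid.
  by near=> y; rewrite /coef leNgt ifF//; apply/negbTE; rewrite negbK; near: y; exact: lt_nbhsl.
- rewrite -cP; apply: (@has_deriv_glue _ _ (coef_mid^~ z) (coef_high^~ z)).
  + by rewrite (dcoef_glue z0); exact: (has_deriv_coef_mid Pz z0).
  + exact: (has_deriv_coef_high Pz z0).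
  + near=> y; move=> yP; rewrite /coef; case: leP => // Py.
    have -> : y = P z by apply/le_anti; rewrite yP Py.
    by rewrite coef_glue.
  + by near=> y; move=> yP; rewrite /coef yP.
Unshelve. all: by end_near. Qed.

Lemma coef_continuous c z : 0 < c -> 0 < z -> {for c, continuous (coef^~ z)}.
Proof. by move=> c0 z0; exact: has_deriv_continuous (has_deriv_coef c0 z0). Qed.

Lemma dcoef_continuous c z : 0 < c -> 0 < z -> {for c, continuous (dcoef^~ z)}.
Proof.
move=> c0 z0; have Pz := P0 z0.
have cid : {for c, continuous (fun y : R => y)} by exact: cvg_id.
have ch : {for c, continuous (dcoef_high^~ z)}.
  apply: continuousM_at; first exact: continuous_powR.
  apply: continuousD_at; first exact: continuous_cst_at.
  apply: continuousM_at; first exact: continuous_cst_at.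
  apply: continuousB_at; last exact: continuous_cst_at.
  exact: has_deriv_continuous (dU c0).
have cm : {for c, continuous (dcoef_mid^~ z)}.
  apply: continuousM_at; first exact: continuous_cst_at.
  have cP : 0 < c / P z by rewrite divr_gt0.
  apply: (@continuous_comp_at _ _ (fun c => c / P z) (fun u => u `^ _)).
    by apply: continuousM_at; [exact: cid|exact: continuous_cst_at].
  exact: continuous_powR.
have [cP|cP|cP] := ltgtP c (P z).
- apply: (continuous_glue cm cm).
  + near=> y; move=> _; rewrite /dcoef leNgt ifF//.
    by apply/negbTE; rewrite negbK; near: y; exact: lt_nbhsl.
  + near=> y; move=> _; rewrite /dcoef leNgt ifF//.
    by apply/negbTE; rewrite negbK; near: y; exact: lt_nbhsl.
- apply: (continuous_glue ch ch).
  + by near=> y; move=> _; rewrite /dcoef ifT// ltW//; near: y; exact: lt_nbhsr.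
  + by near=> y; move=> _; rewrite /dcoef ifT// ltW//; near: y; exact: lt_nbhsr.
- apply: (continuous_glue cm ch).
  + near=> y; move=> yc; rewrite /dcoef; case: leP => // Py.
    have -> : y = P z by apply/le_anti; rewrite -{1}cP yc Py.
    by rewrite dcoef_glue.
  + by near=> y; move=> yc; rewrite /dcoef -cP yc.
Unshelve. all: by end_near. Qed.

Lemma Gam_gt0 x z : 0 < x -> 0 < z -> 0 < Gam x z.
Proof. by move=> x0 z0; rewrite mulr_gt0 ?P0// powR_gt0// divr_gt0. Qed.

Lemma Gam_diag z : 0 < z -> Gam z z = P z.
Proof. by move=> z0; rewrite /Gam divff ?gt_eqF// one_powR mulr1. Qed.

Lemma Gam_lt x y z : 0 < x -> x < y -> 0 < z -> Gam x z < Gam y z.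
Proof.
move=> x0 xy z0; have [a0 a1 n1 k0] := params.
rewrite /Gam ltr_pM2l ?P0//; apply: lt_powR_pos.
- by rewrite invr_gt0 subr_gt0.
- by rewrite divr_gt0.
- by rewrite ltr_pM2r// invr_gt0.
Qed.

Lemma Gam_le x y z : 0 < x -> x <= y -> 0 < z -> Gam x z <= Gam y z.
Proof.
move=> x0; rewrite le_eqVlt => /orP[/eqP <-//|xy z0]; exact/ltW/Gam_lt.
Qed.

Lemma Gam_leP x z : 0 < x -> x <= z -> Gam x z <= P z.
Proof.
by move=> x0 xz; have z0 := lt_le_trans x0 xz; rewrite -(Gam_diag z0) Gam_le.
Qed.

Lemma Gam_ltP x z : 0 < x -> x < z -> Gam x z < P z.
Proof.
by move=> x0 xz; have z0 := lt_trans x0 xz; rewrite -[ltRHS](Gam_diag z0) Gam_lt.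
Qed.

Lemma has_deriv_Gam x z : 0 < x -> 0 < z ->
  has_deriv (Gam^~ z) x (Gam x z * (1 - a)^-1 / x).
Proof.
move=> x0 z0; have [a0 a1 n1 k0] := params; have xz : 0 < x / z by rewrite divr_gt0.
rewrite /Gam; apply: has_deriv_eq.
  apply: has_derivZ; apply: (@has_deriv_comp _ (fun x => x / z) (fun u => u `^ _)).
    by apply: has_derivM; [exact: has_deriv_id|exact: has_deriv_cst].
  exact: has_deriv_powR.
have h1 : 1 - a != 0 by rewrite gt_eqF// subr_gt0.
have xnz := lt0r_neq0 x0; have znz := lt0r_neq0 z0.
rewrite (pos_powRD ((1 - a)^-1) (- 1) xz) powR_inv1 ?ltW//.
by field; nonzero.
Qed.

Lemma Gam_ratio x z : 0 < z -> Gam x z / P z = (x / z) `^ (1 - a)^-1.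
Proof. by move=> z0; rewrite /Gam mulrAC divff ?mul1r// gt_eqF// P0. Qed.

Lemma Gam_powR x z p : 0 < x -> 0 < z ->
  Gam x z `^ p = P z `^ p * (x / z) `^ ((1 - a)^-1 * p).
Proof.
by move=> x0 z0; rewrite /Gam powRM ?powR_ge0 ?(ltW (P0 z0))// -powRrM.
Qed.

(** The defining equation of the free boundary in algebraic form; the evaluations of the c^a term on
    the boundary go through it. *)
Lemma Gam_marginal x z : 0 < x -> 0 < z ->
  Gam x z `^ (a - 1) * (P z `^ (1 - a) / z) = x^-1.
Proof.
move=> x0 z0; have [a0 a1 n1 k0] := params; have xz : 0 < x / z by rewrite divr_gt0.
have h1 : 1 - a != 0 by rewrite gt_eqF// subr_gt0.
rewrite Gam_powR// (_ : (1 - a)^-1 * (a - 1) = -1); last by field; nonzero.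
rewrite powR_inv1 ?ltW//.
have : P z `^ (a - 1) * P z `^ (1 - a) = 1.
  by rewrite -pos_powRD ?P0// (_ : a - 1 + (1 - a) = 0) ?powRr0//; ring.
move: (P z `^ (a - 1)) (P z `^ (1 - a)) => u v uv.
have xnz := lt0r_neq0 x0; have znz := lt0r_neq0 z0.
rewrite -[RHS]mul1r -uv; by field; nonzero.
Qed.

Lemma dcoef_Gam x z : 0 < x -> x < z -> dcoef (Gam x z) z = - (k / (n - 1)) * x `^ (- n).
Proof.
move=> x0 xz; have z0 := lt_trans x0 xz; have [a0 a1 n1 k0] := params.
have xz0 : 0 < x / z by rewrite divr_gt0.
have h1 : 1 - a != 0 by rewrite gt_eqF// subr_gt0.
rewrite /dcoef leNgt Gam_ltP//= /dcoef_mid Gam_ratio// -powRrM.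
rewrite (_ : (1 - a)^-1 * _ = - n); last by field; nonzero.
rewrite -mulrA -powRM ?(ltW z0) ?(ltW xz0)//.
by rewrite mulrCA divff ?mulr1// gt_eqF.
Qed.

(** * Derivatives of W and smooth fit across the free boundary *)

Definition dW_c c x z : R := dcoef c z * x `^ n
  + n * (k / (a * (n - 1))) * (a * c `^ (a - 1)) * x * (P z `^ (1 - a) / z).

Definition dW_x c x z : R := n * coef c z * x `^ (n - 1)
  + n * (k / (a * (n - 1))) * c `^ a * (P z `^ (1 - a) / z).

Definition dW_xx c x z : R := n * (n - 1) * coef c z * x `^ (n - 2).

(** On the boundary the two terms of W contribute - k / (n - 1) and n k / (n - 1). *)
Lemma dW_c_Gam x z : 0 < x -> x < z -> dW_c (Gam x z) x z = k.
Proof.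
move=> x0 xz; have z0 := lt_trans x0 xz; have [a0 a1 n1 k0] := params.
have e : dcoef (Gam x z) z * x `^ n = - (k / (n - 1)).
  by rewrite dcoef_Gam// -mulrA pos_powRVM// mulr1.
rewrite /dW_c e; have := Gam_marginal x0 z0.
move: (Gam x z `^ (a - 1)) (P z `^ (1 - a)) => u v uv.
have n1' : n - 1 != 0 by rewrite gt_eqF// subr_gt0.
have anz := lt0r_neq0 a0; have xnz := lt0r_neq0 x0.
have -> : n * (k / (a * (n - 1))) * (a * u) * x * (v / z) =
    n * (k / (n - 1)) * x * (u * (v / z)) by field; rewrite gt_eqF//; nonzero.
by rewrite uv; field; nonzero.
Qed.

Lemma has_deriv_W_c c x z : 0 < c -> 0 < z ->
  has_deriv (fun c => Wfun c x z) c (dW_c c x z).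
Proof.
move=> c0 z0; rewrite /Wfun; apply: has_deriv_eq.
  apply: has_derivD.
    by apply: has_derivM; [exact: has_deriv_coef|exact: has_deriv_cst].
  apply: has_derivM; last exact: has_deriv_cst.
  apply: has_derivM; last exact: has_deriv_cst.
  by apply: has_derivZ; exact: has_deriv_powR.
by rewrite /dW_c; ring.
Qed.

Lemma has_deriv_W_x c x z : 0 < x ->
  has_deriv (fun x => Wfun c x z) x (dW_x c x z).
Proof.
move=> x0; rewrite /Wfun; apply: has_deriv_eq.
  apply: has_derivD.
    by apply: has_derivZ; exact: has_deriv_powR.
  apply: has_derivM; last exact: has_deriv_cst.
  by apply: has_derivZ; exact: has_deriv_id.
by rewrite /dW_x; ring.
Qed.

Lemma has_deriv_W_xx c x z : 0 < x ->
  has_deriv (fun x => dW_x c x z) x (dW_xx c x z).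
Proof.
move=> x0; rewrite /dW_x; apply: has_deriv_eq.
  apply: has_derivD; last exact: has_deriv_cst.
  by apply: has_derivZ; exact: has_deriv_powR.
by rewrite /dW_xx (_ : n - 1 - 1 = n - 2); ring.
Qed.

(* Gamma is where the c-derivative of W equals k, so only the explicit dependence on
   x of W contributes to the x-derivatives of w on either side of the free boundary. *)
Lemma has_deriv_W_x_Gam x z : 0 < x -> x < z ->
  has_deriv (fun x => Wfun (Gam x z) x z - k * Gam x z) x (dW_x (Gam x z) x z).
Proof.
move=> x0 xz; have z0 := lt_trans x0 xz; have G0 := Gam_gt0 x0 z0.
have dG := has_deriv_Gam x0 z0.
have dWG := dW_c_Gam x0 xz; rewrite /Wfun.
apply: has_deriv_eq.
  apply: has_derivB; last by apply: has_derivZ; exact: dG.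
  apply: has_derivD.
    apply: has_derivM; last exact: has_deriv_powR.
    apply: (@has_deriv_comp _ (Gam^~ z) (coef^~ z)); first exact: dG.
    exact: has_deriv_coef.
  apply: has_derivM; last exact: has_deriv_cst.
  apply: has_derivM; last exact: has_deriv_id.
  apply: has_derivZ; apply: (@has_deriv_comp _ (Gam^~ z) (fun u => u `^ a)); first exact: dG.
  exact: has_deriv_powR.
have e : (dW_c (Gam x z) x z - k) * (Gam x z * (1 - a)^-1 / x) = 0.
  by rewrite dWG subrr mul0r.
by rewrite -[RHS]addr0 -[X in _ = _ + X]e /dW_c /dW_x /=; ring.
Qed.

(** The mixed derivative of W vanishes on the free boundary: its two terms are - n k / ((n - 1) x)
    and n k / ((n - 1) x). Hence moving along Gamma adds nothing to the second x-derivative. *)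
Lemma has_deriv_W_xx_Gam x z : 0 < x -> x < z ->
  has_deriv (fun x => dW_x (Gam x z) x z) x (dW_xx (Gam x z) x z).
Proof.
move=> x0 xz; have z0 := lt_trans x0 xz; have G0 := Gam_gt0 x0 z0.
have [a0 a1 n1 k0] := params.
have dG := has_deriv_Gam x0 z0; rewrite /dW_x.
apply: has_deriv_eq.
  apply: has_derivD.
    apply: has_derivM; last exact: has_deriv_powR.
    apply: has_derivZ; apply: (@has_deriv_comp _ (Gam^~ z) (coef^~ z)); first exact: dG.
    exact: has_deriv_coef.
  apply: has_derivM; last exact: has_deriv_cst.
  apply: has_derivZ; apply: (@has_deriv_comp _ (Gam^~ z) (fun u => u `^ a)); first exact: dG.
  exact: has_deriv_powR.
rewrite dcoef_Gam// /dW_xx (_ : n - 1 - 1 = n - 2); last by ring.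
have h : x `^ (- n) * x `^ (n - 1) = x^-1.
  by rewrite -pos_powRD// (_ : - n + (n - 1) = -1) ?powR_inv1 ?ltW//; ring.
move: h (Gam_marginal x0 z0) => /=.
move: (Gam x z `^ a) (Gam x z `^ (a - 1)) (P z `^ (1 - a)) (x `^ (- n)) (x `^ (n - 1)).
move: (Gam x z) (x `^ (n - 2)) (coef _ _) => g t cf ga u v p q pq uv.
have n1' : n - 1 != 0 by rewrite gt_eqF// subr_gt0.
have a1' : 1 - a != 0 by rewrite gt_eqF// subr_gt0.
have anz := lt0r_neq0 a0; have xnz := lt0r_neq0 x0; have znz := lt0r_neq0 z0.
transitivity (n * k / (n - 1) * (g * (1 - a)^-1 / x) * (u * (v / z) - p * q)
  + n * (n - 1) * cf * t); first by field; nonzero.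
by rewrite uv pq subrr mulr0 add0r.
Qed.

(** Applied with g the identity in c and g = Gamma in x. At a point where g x = c, the monotonicity
    of g puts the two regimes on opposite sides of x. *)
Lemma has_deriv_switch (g f f1 f2 : R -> R) c x d : {for x, continuous g} ->
  (\forall y \near x, y <= x -> g y <= g x) ->
  (\forall y \near x, x <= y -> g x <= g y) ->
  (\forall y \near x, g y <= c -> f y = f1 y) ->
  (\forall y \near x, c <= g y -> f y = f2 y) ->
  (g x <= c -> has_deriv f1 x d) -> (c <= g x -> has_deriv f2 x d) ->
  has_deriv f x d.
Proof.
move=> cg gl gr e1 e2 d1 d2; have [gc|cg'|gc] := ltgtP (g x) c.
- apply: (@has_deriv_near _ f1); last exact/d1/ltW.
  near=> y; apply/esym; have : g y <= c.
    by apply/ltW; near: y; have /cg := lt_nbhsl gc.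
  by near: y.
- apply: (@has_deriv_near _ f2); last exact/d2/ltW.
  near=> y; apply/esym; have : c <= g y.
    by apply/ltW; near: y; have /cg := lt_nbhsr cg'.
  by near: y.
- apply: (@has_deriv_glue _ _ f1 f2); [by apply: d1; rewrite gc|by apply: d2; rewrite gc| |].
  + near=> y; move=> yx; have : g y <= c by rewrite -gc; move: yx; near: y.
    by near: y.
  + near=> y; move=> yx; have : c <= g y by rewrite -gc; move: yx; near: y.
    by near: y.
Unshelve. all: by end_near. Qed.

Lemma has_deriv_wmod_c c x z : 0 < c -> 0 < x -> x < z ->
  has_deriv (fun c => wmod c x z) c (dW_c (Num.max c (Gam x z)) x z).
Proof.
move=> c0 x0 xz; have z0 := lt_trans x0 xz; have G0 := Gam_gt0 x0 z0.
apply: (@has_deriv_switch id _ (fun c => Wfun (Gam x z) x z - k * (Gam x z - c))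
  (fun c => Wfun c x z) (Gam x z)).
- exact: cvg_id.
- by near=> y.
- by near=> y.
- by near=> y; move=> yG; rewrite /wmod max_r.
- by near=> y; move=> Gy; rewrite /wmod max_l// subrr mulr0 subr0.
- move=> /= cG; rewrite max_r// dW_c_Gam//.
  apply: has_deriv_eq.
    apply: has_derivB; first exact: has_deriv_cst.
    by apply: has_derivZ; apply: has_derivB; [exact: has_deriv_cst|exact: has_deriv_id].
  by ring.
- by move=> /= Gc; rewrite max_l//; exact: has_deriv_W_c.
Unshelve. all: by end_near. Qed.

Lemma has_deriv_wmod_x c x z : 0 < x -> x < z ->
  has_deriv (fun x => wmod c x z) x (dW_x (Num.max c (Gam x z)) x z).
Proof.
move=> x0 xz; have z0 := lt_trans x0 xz.
apply: (@has_deriv_switch (Gam^~ z) _ (fun x => Wfun c x z)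
  (fun x => Wfun (Gam x z) x z - k * (Gam x z - c)) c).
- exact: has_deriv_continuous (has_deriv_Gam x0 z0).
- by near=> y; move=> yx; apply: Gam_le => //; near: y; exact: lt_nbhsr.
- by near=> y; move=> yx; exact: Gam_le.
- by near=> y; move=> Gy; rewrite /wmod max_l// subrr mulr0 subr0.
- by near=> y; move=> yG; rewrite /wmod max_r.
- by move=> Gc; rewrite max_l//; exact: has_deriv_W_x.
- move=> cG; rewrite max_r//.
  have h := has_derivD (has_deriv_W_x_Gam x0 xz) (has_deriv_cst (k * c) x).
  rewrite addr0 in h; apply: has_deriv_near h; near=> y => /=; ring.
Unshelve. all: by end_near. Qed.

Lemma has_deriv_wmod_xx c x z : 0 < x -> x < z ->
  has_deriv (fun x => dW_x (Num.max c (Gam x z)) x z) x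
    (dW_xx (Num.max c (Gam x z)) x z).
Proof.
move=> x0 xz; have z0 := lt_trans x0 xz.
apply: (@has_deriv_switch (Gam^~ z) _ (fun x => dW_x c x z)
  (fun x => dW_x (Gam x z) x z) c).
- exact: has_deriv_continuous (has_deriv_Gam x0 z0).
- by near=> y; move=> yx; apply: Gam_le => //; near: y; exact: lt_nbhsr.
- by near=> y; move=> yx; exact: Gam_le.
- by near=> y; move=> Gy; rewrite max_l.
- by near=> y; move=> yG; rewrite max_r.
- by move=> Gc; rewrite max_l//; exact: has_deriv_W_xx.
- by move=> cG; rewrite max_r//; exact: has_deriv_W_xx_Gam.
Unshelve. all: by end_near. Qed.

Lemma has_deriv_derive1 (f : R -> R) x d : has_deriv f x d ->
  derivable f x 1 /\ derive1 f x = d.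
Proof. by move=> [[df <-]]; split => //; rewrite derive1E. Qed.

Lemma C12_wmod z : 0 < z ->
  C12_on [set q | 0 < q.1 /\ 0 < q.2 < z] (fun c x => wmod c x z).
Proof.
move=> z0 c x [/= c0 /andP[x0 xz]].
have px c' x' : 0 < x' -> x' < z -> partial_x (fun c x => wmod c x z) c' x' =
    dW_x (Num.max c' (Gam x' z)) x' z.
  by move=> x'0 x'z; have [_ ] := has_deriv_derive1 (has_deriv_wmod_x c' x'0 x'z).
have dpx c' x' : 0 < x' -> x' < z -> has_deriv (partial_x (fun c x => wmod c x z) c') x'
    (dW_xx (Num.max c' (Gam x' z)) x' z).
  move=> x'0 x'z; apply: has_deriv_near (has_deriv_wmod_xx c' x'0 x'z).
  by near=> y; rewrite px//; near: y; [exact: lt_nbhsr|exact: lt_nbhsl].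
have D : \forall q \near (c, x), 0 < q.1 /\ 0 < q.2 < z.
  have n1 : \forall q \near (c, x), 0 < q.1 by have /(@cvg_fst R R) := lt_nbhsr c0; exact.
  have n2 : \forall q \near (c, x), 0 < q.2 by have /(@cvg_snd R R) := lt_nbhsr x0; exact.
  have n3 : \forall q \near (c, x), q.2 < z by have /(@cvg_snd R R) := lt_nbhsl xz; exact.
  near=> q; split; first by near: q.
  by apply/andP; split; near: q.
have cfst : {for (c, x), continuous (fun q : R * R => q.1)} by exact: cvg_fst.
have csnd : {for (c, x), continuous (fun q : R * R => q.2)} by exact: cvg_snd.
have cG : {for (c, x), continuous (fun q : R * R => Gam q.2 z)}.
  apply: (@continuous_comp_at _ _ (fun q : R * R => q.2) (Gam^~ z)) => //=.
  exact: has_deriv_continuous (has_deriv_Gam x0 z0).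
have cm : {for (c, x), continuous (fun q : R * R => Num.max q.1 (Gam q.2 z))}.
  exact: continuous_max_at.
have m0 : 0 < Num.max c (Gam x z) by rewrite lt_max c0.
have cc : {for (c, x), continuous (fun q : R * R => coef (Num.max q.1 (Gam q.2 z)) z)}.
  by apply: (@continuous_comp_at _ _ _ (coef^~ z) _ cm) => /=; exact: coef_continuous.
have cd : {for (c, x), continuous (fun q : R * R => dcoef (Num.max q.1 (Gam q.2 z)) z)}.
  by apply: (@continuous_comp_at _ _ _ (dcoef^~ z) _ cm) => /=; exact: dcoef_continuous.
have cp p : {for (c, x), continuous (fun q : R * R => (Num.max q.1 (Gam q.2 z)) `^ p)}.
  by apply: (@continuous_comp_at _ _ _ (fun u => u `^ p) _ cm) => /=; exact: continuous_powR.
have cx p : {for (c, x), continuous (fun q : R * R => q.2 `^ p)}.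
  by apply: (@continuous_comp_at _ _ (fun q : R * R => q.2) (fun u => u `^ p)) => //=;
    exact: continuous_powR.
have nearC (F G : R * R -> R) : (\forall q \near (c, x), F q = G q) ->
    {for (c, x), continuous F} -> {for (c, x), continuous G}.
  move=> FG cF; rewrite /prop_for /continuous_at -(nbhs_singleton FG).
  by apply: cvg_trans cF; apply: near_eq_cvg.
have cst (v : R) := @continuous_cst_at R (R * R)%type v (c, x).
split; split.
- by have [] := has_deriv_derive1 (has_deriv_wmod_c c0 x0 xz).
- by have [] := has_deriv_derive1 (has_deriv_wmod_x c x0 xz).
- by have [] := has_deriv_derive1 (dpx c x x0 xz).
- rewrite /wmod /Wfun; apply: continuousB_at.
    apply: continuousD_at; first exact: continuousM_at.
    apply: continuousM_at => //; apply: continuousM_at => //.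
    exact: continuousM_at.
  by apply: continuousM_at => //; exact: continuousB_at.
- apply: (nearC (fun q : R * R => dW_c (Num.max q.1 (Gam q.2 z)) q.2 z)).
    near=> q; have [q1 /andP[q2 q3]] : 0 < q.1 /\ 0 < q.2 < z by near: q.
    by apply/esym; have [_] := has_deriv_derive1 (has_deriv_wmod_c q1 q2 q3).
  rewrite /dW_c; apply: continuousD_at; first exact: continuousM_at.
  apply: continuousM_at => //; apply: continuousM_at => //.
  by apply: continuousM_at => //; exact: continuousM_at.
- apply: (nearC (fun q : R * R => dW_x (Num.max q.1 (Gam q.2 z)) q.2 z)).
    near=> q; have [q1 /andP[q2 q3]] : 0 < q.1 /\ 0 < q.2 < z by near: q.
    by rewrite px.
  rewrite /dW_x; apply: continuousD_at.
    by apply: continuousM_at => //; exact: continuousM_at.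
  by apply: continuousM_at => //; exact: continuousM_at.
- apply: (nearC (fun q : R * R => dW_xx (Num.max q.1 (Gam q.2 z)) q.2 z)).
    near=> q; have [q1 /andP[q2 q3]] : 0 < q.1 /\ 0 < q.2 < z by near: q.
    by apply/esym; have [_] := has_deriv_derive1 (dpx q.1 q.2 q2 q3).
  by rewrite /dW_xx; apply: continuousM_at => //; exact: continuousM_at.
Unshelve. all: by end_near. Qed.

(** * The variational inequality *)

(** On ]0, 1] the function n t - t^n increases up to n - 1, its value at 1. It governs W_c above the
    free boundary. *)
Lemma bernoulli_powR t : 0 < t -> t <= 1 -> n * t - t `^ n <= n - 1.
Proof.
have [a0 a1 n1 k0] := params.
move=> t0; rewrite le_eqVlt => /orP[/eqP ->|t1]; first by rewrite one_powR mulr1.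
have d (y : R) (y0 : 0 < y) := is_derive1_powR n y0.
have [m /andP[tm m1] h] := MVT_pos t0 t1 d.
have m0 : 0 < m by exact: lt_trans tm.
have m1' : m `^ (n - 1) <= 1.
  by rewrite -[leRHS](one_powR (n - 1)); apply: le_powR_pos => //; lra.
have : 0 <= (1 - t) * n * (1 - m `^ (n - 1)) by rewrite !mulr_ge0 ?subr_ge0//; lra.
by move: h; rewrite one_powR; lra.
Qed.

Lemma powR_concave x y : 0 < x -> x <= y -> a * y `^ (a - 1) * (y - x) <= y `^ a - x `^ a.
Proof.
have [a0 a1 n1 k0] := params.
move=> x0; rewrite le_eqVlt => /orP[/eqP ->|xy]; first by rewrite !subrr mulr0.
have d (v : R) (v0 : 0 < v) := is_derive1_powR a v0.
have [m /andP[xm my] ->] := MVT_pos x0 xy d.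
have a10 : a - 1 <= 0 by lra.
have h := le_powR_neg a10 (lt_trans x0 xm) (ltW my).
by apply: ler_wpM2r; [rewrite subr_ge0 ltW|apply: ler_wpM2l h; exact: ltW].
Qed.

(** Beyond P z the factor s in U' is at most s (P z) = z^-n, and y^-a integrates to y^(1 - a) / (1 -
    a). *)
Lemma U_increment c z : 0 < z -> P z <= c ->
  (1 - a) * (U c - U (P z)) <= z `^ (- n) * (c `^ (1 - a) - P z `^ (1 - a)).
Proof.
have [a0 a1 n1 k0] := params; move=> z0 Pc; have Pz := P0 z0.
move: Pc; rewrite le_eqVlt => /orP[/eqP <-|Pc]; first by rewrite !subrr !mulr0.
pose F y : R := (1 - a) * U y - z `^ (- n) * y `^ (1 - a).
have dF y : 0 < y -> is_derive y 1 F
   ((1 - a) * (y `^ (- a) * s y) - z `^ (- n) * ((1 - a) * y `^ (1 - a - 1))).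
  move=> y0; apply: has_derivP; apply: has_derivB; apply: has_derivZ.
    exact: dU.
  exact: has_deriv_powR.
have [m /andP[Pm mc] h] := MVT_pos Pz Pc dF.
have m0 : 0 < m by exact: lt_trans Pm.
have sm : s m <= z `^ (- n).
  rewrite -(inv_powP n P0 Pinv0 PK Pmono z0).
  by apply: (inv_pow_le params_n1 Pinv0 PK Pmono) => //; exact: ltW.
suff : F c - F (P z) <= 0 by rewrite /F; lra.
rewrite h mulr_le0_ge0 ?subr_ge0 ?(ltW Pc)//.
rewrite (_ : 1 - a - 1 = - a); last by ring.
have : 0 <= (1 - a) * m `^ (- a) * (z `^ (- n) - s m).
  by rewrite !mulr_ge0 ?powR_ge0 ?subr_ge0// ltW.
lra.
Qed.

Lemma dW_c_le c x z : 0 < c -> 0 < x -> x < z -> Gam x z <= c -> dW_c c x z <= k.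
Proof.
have [a0 a1 n1 k0] := params; move=> c0 x0 xz Gc.
have z0 := lt_trans x0 xz; have Pz := P0 z0.
have xz0 : 0 < x / z by rewrite divr_gt0.
have xz1 : x / z <= 1 by rewrite ler_pdivrMr// mul1r ltW.
have n1' : n - 1 != 0 by rewrite gt_eqF// subr_gt0.
have a1' : 1 - a != 0 by rewrite gt_eqF// subr_gt0.
have anz := lt0r_neq0 a0; have xnz := lt0r_neq0 x0; have znz := lt0r_neq0 z0.
have n10 : 0 < n - 1 by rewrite subr_gt0.
have xn p : (x / z) `^ p = x `^ p * z `^ (- p).
  by rewrite powRM ?invr_ge0 ?(ltW x0) ?(ltW z0)// -powR_inv1 ?(ltW z0)// -powRrM mulN1r.
rewrite /dW_c /dcoef; have [Pc|Pc] := leP (P z) c.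
- rewrite /dcoef_high.
  have UP := U_increment z0 Pc.
  have b := bernoulli_powR xz0 xz1.
  have w1 : (x / z) `^ n <= 1.
    by rewrite -[leRHS](one_powR n); apply: le_powR_pos => //; lra.
  have w0 := powR_gt0 n xz0.
  have cc : c `^ (a - 1) * c `^ (1 - a) = 1.
    by rewrite -pos_powRD// (_ : a - 1 + (1 - a) = 0) ?powRr0//; ring.
  have c1 := powR_gt0 (a - 1) c0; have p1 := powR_gt0 (1 - a) Pz.
  have p2 : P z `^ (1 - a) <= c `^ (1 - a) by apply: le_powR_pos => //; lra.
  move: UP b w1 w0; rewrite xn.
  have xn0 := powR_gt0 n x0.
  move: xn0 p1 p2 cc c1; move: (x `^ n) (z `^ (- n)) (P z `^ (1 - a)) (c `^ (1 - a)) (c `^ (a - 1)).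
  move=> X Z p C D X0 p0 pC CD D0 UP b w1 w0.
  (* With t = x / z, X Z is t^n. The first summand in the bracket is at most p by the Bernoulli
     inequality, the second at most t^n (C - p) <= C - p, and D C = 1. *)
  have -> : D * (- (k / (n - 1)) * Z * p + (1 - a) * k * (U c - U (P z))) * X
      + n * (k / (a * (n - 1))) * (a * D) * x * (p / z)
    = D * k * (p * ((n * (x / z) - X * Z) / (n - 1)) + X * ((1 - a) * (U c - U (P z)))).
    by field; nonzero.
  have kE : D * k * C = k by rewrite mulrAC CD mul1r.
  rewrite -[leRHS]kE ler_pM2l ?mulr_gt0//.
  have q1 : (n * (x / z) - X * Z) / (n - 1) <= 1 by rewrite ler_pdivrMr// mul1r.
  have q2 := ler_wpM2l (ltW p0) q1.
  have q3 := ler_wpM2l (ltW X0) UP.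
  have q4 : X * Z * (C - p) <= C - p by rewrite ler_piMl// subr_ge0.
  lra.
- rewrite /dcoef_mid.
  have cP : 0 < c / P z by rewrite divr_gt0.
  set u := (c / P z) `^ (1 - a).
  have u0 : 0 < u by rewrite powR_gt0.
  have xu : x / z <= u.
    have h : (x / z) `^ (1 - a)^-1 <= c / P z by rewrite ler_pdivlMr// mulrC.
    have := le_powR_pos (_ : 0 <= 1 - a) (powR_gt0 _ xz0) h.
    rewrite -powRrM mulVf// powRr1 ?(ltW xz0)//; apply; lra.
  pose t := x / z / u.
  have t0 : 0 < t by rewrite divr_gt0.
  have t1 : t <= 1 by rewrite ler_pdivrMr// mul1r.
  have b := bernoulli_powR t0 t1.
  have tn : t `^ n = z `^ (- n) * (c / P z) `^ (- (n * (1 - a))) * x `^ n.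
    rewrite /t powRM ?(ltW xz0) ?invr_ge0 ?(ltW u0)// xn.
    rewrite (_ : u^-1 `^ n = (c / P z) `^ (- (n * (1 - a)))); first by ring.
    by rewrite -(powR_inv1 (ltW u0)) /u -!powRrM; congr (_ `^ _); ring.
  have uE : c `^ (a - 1) * P z `^ (1 - a) = u^-1.
    rewrite /u powRM ?(ltW c0) ?invr_ge0 ?(ltW Pz)//.
    rewrite -[in RHS](powR_inv1 (ltW Pz)) -powRrM mulN1r.
    by rewrite -[a - 1]opprB !powRN invfM invrK.
  have -> : - (k / (n - 1)) * z `^ (- n) * (c / P z) `^ (- (n * (1 - a))) * x `^ n
     + n * (k / (a * (n - 1))) * (a * c `^ (a - 1)) * x * (P z `^ (1 - a) / z)
     = k * ((n * t - t `^ n) / (n - 1)).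
    rewrite tn /t -uE; move: (c `^ (a - 1)) (P z `^ (1 - a)) => D p.
    by field; nonzero.
  by rewrite ger_pMr// ler_pdivrMr// mul1r.
Qed.

Lemma HJB_wmod (sigma mu r ph : R) c x z : 0 < sigma -> mu < r ->
  2^-1 * sigma ^+ 2 * n ^+ 2 + (mu - 2^-1 * sigma ^+ 2) * n - r = 0 ->
  ph = (r - mu) * n * (k / (a * (n - 1))) * (P z `^ (1 - a) / z) ->
  0 < c -> 0 < x < z ->
  Num.max (generator sigma mu r (fun c x => wmod c x z) c x + c `^ a * x * ph)
    (partial_c (fun c x => wmod c x z) c x - k) = 0.
Proof.
have [a0 a1 n1 k0] := params; move=> s0 mur root phE c0 /andP[x0 xz].
have z0 := lt_trans x0 xz; have G0 := Gam_gt0 x0 z0.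
have n10 : 0 < n - 1 by rewrite subr_gt0.
have n1' : n - 1 != 0 by rewrite gt_eqF.
have anz := lt0r_neq0 a0; have xnz := lt0r_neq0 x0; have znz := lt0r_neq0 z0.
set m := Num.max c (Gam x z).
have cm : c <= m by rewrite /m le_max lexx.
have m0 : 0 < m by exact: lt_le_trans cm.
have pc : partial_c (fun c x => wmod c x z) c x = dW_c m x z.
  by have [_] := has_deriv_derive1 (has_deriv_wmod_c c0 x0 xz).
have px y : 0 < y -> y < z -> partial_x (fun c x => wmod c x z) c y =
    dW_x (Num.max c (Gam y z)) y z.
  by move=> y0 yz; have [_] := has_deriv_derive1 (has_deriv_wmod_x c y0 yz).
have pxx : partial_xx (fun c x => wmod c x z) c x = dW_xx m x z.
  have h : has_deriv (partial_x (fun c x => wmod c x z) c) x (dW_xx m x z).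
    apply: has_deriv_near (has_deriv_wmod_xx c x0 xz).
    by near=> y; rewrite px//; near: y; [exact: lt_nbhsr|exact: lt_nbhsl].
  by have [_] := has_deriv_derive1 h.
rewrite /generator pxx px// pc -/m.
have xn1 : x * x `^ (n - 1) = x `^ n.
  by rewrite mulr_powRB1 ?(ltW x0)//; lra.
have xn2 : x ^+ 2 * x `^ (n - 2) = x `^ n.
  rewrite expr2 -mulrA (_ : x * x `^ (n - 2) = x `^ (n - 1)) ?xn1//.
  by rewrite -[X in X * _](powRr1 (ltW x0)) -pos_powRD//; congr (_ `^ _); ring.
(* The root equation annihilates the x^n term, and the generator turns the linear term of W into -
   m^a x phi; what remains comes from replacing c by m. *)
have LE : 2^-1 * sigma ^+ 2 * x ^+ 2 * dW_xx m x z + mu * x * dW_x m x z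
    - r * wmod c x z + c `^ a * x * ph
  = r * k * (m - c) - (m `^ a - c `^ a) * x * ph.
  rewrite /wmod -/m /Wfun /dW_xx /dW_x phE.
  have -> : r = 2^-1 * sigma ^+ 2 * n ^+ 2 + (mu - 2^-1 * sigma ^+ 2) * n by lra.
  move: (coef m z) (x `^ (n - 1)) (x `^ (n - 2)) xn1 xn2 => b u v xn1 xn2.
  rewrite -xn2.
  have -> : mu * x * (n * b * u + n * (k / (a * (n - 1))) * m `^ a * (P z `^ (1 - a) / z))
    = mu * n * b * (x ^+ 2 * v)
      + mu * x * (n * (k / (a * (n - 1))) * m `^ a * (P z `^ (1 - a) / z)).
    by rewrite xn2 -xn1; ring.
  by ring.
rewrite LE; have [Gc|cG] := leP (Gam x z) c.
  have -> : m = c by rewrite /m max_l.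
  rewrite !subrr mulr0 !mul0r subr0 max_l// subr_le0.
  exact: dW_c_le.
have mG : m = Gam x z by rewrite /m max_r// ltW.
have -> : dW_c m x z = k by rewrite mG dW_c_Gam.
rewrite subrr max_r// subr_le0.
have ph0 : 0 < ph.
  by rewrite phE !mulr_gt0 ?invr_gt0 ?powR_gt0 ?P0 ?mulr_gt0 ?subr_gt0//; lra.
(* Concavity of c^a is used with the tangent at the larger point m = Gamma, where the marginal value
   is known. *)
have h1 := powR_concave c0 cm.
have h2 := ler_wpM2r (ltW (mulr_gt0 x0 ph0)) h1.
rewrite -(mulrA _ x ph); apply: le_trans h2.
have -> : a * m `^ (a - 1) * (m - c) * (x * ph) =
    a * (m - c) * x * ((r - mu) * n * (k / (a * (n - 1)))) *
    (Gam x z `^ (a - 1) * (P z `^ (1 - a) / z)) by rewrite mG phE; ring.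
rewrite Gam_marginal//.
have -> : a * (m - c) * x * ((r - mu) * n * (k / (a * (n - 1)))) / x =
   k * (m - c) * ((r - mu) * n / (n - 1)) by field; nonzero.
rewrite (mulrC r) mulrAC ler_wpM2l//.
  by rewrite mulr_ge0 ?subr_ge0 ?(ltW k0).
rewrite ler_pdivlMr//.
(* What remains is r (n - 1) <= (r - mu) n, that is mu n <= r; the root equation gives r - mu n =
   sigma^2 n (n - 1) / 2. *)
have s2 : 0 < sigma ^+ 2 by rewrite exprn_gt0.
have : 0 <= 2^-1 * sigma ^+ 2 * (n * (n - 1)).
  by rewrite !mulr_ge0 ?invr_ge0// ltW//; lra.
have rE : r = 2^-1 * sigma ^+ 2 * n ^+ 2 + (mu - 2^-1 * sigma ^+ 2) * n by lra.
by move: rE; rewrite expr2; lra.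
Unshelve. all: by end_near. Qed.

(** * The boundary condition and regularity in the running maximum *)

Hypothesis Pdc : forall u v, 0 < u -> u < v -> dcon u v P.

Lemma has_deriv_inv x : 0 < x -> has_deriv (fun y => y^-1) x (- (x^-1 * x^-1)).
Proof.
move=> x0; apply: (@has_deriv_near _ (fun y => y `^ (- 1))).
  near=> y; rewrite powR_inv1// ltW//; near: y; exact: lt_nbhsr.
apply: has_deriv_eq; first exact: has_deriv_powR.
by rewrite (_ : -1 - 1 = -1 + -1)// pos_powRD// powR_inv1 ?(ltW x0)// mulN1r.
Unshelve. all: by end_near. Qed.

Lemma has_deriv_lderive f x d : has_deriv f x d -> is_lderive f x d.
Proof. by move=> [df]; exact: is_derive_lderive. Qed.

Lemma is_lderive_eq f x d d' : is_lderive f x d -> d = d' -> is_lderive f x d'.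
Proof. by move=> + <-. Qed.

(** Since P y <= P z <= c for y <= z, w stays in the first regime left of z. D x is its left
    z-derivative at z; it is continuous in x, and every term of D z carries the factor z^n z^-n -
    1. *)
Lemma boundary_high c z : 0 < c -> 0 < z -> P z <= c ->
  exists2 D : R -> R, D y @[y --> z^'-] --> 0 &
    forall x, 0 < x -> x < z -> is_lderive (wmod c x) z (D x).
Proof.
move=> c0 z0 Pc; have [a0 a1 n1 k0] := params; have Pz := P0 z0.
have [e e0 Pe] := P_lderive Pmono Pdc z0.
have n1' : n - 1 != 0 by rewrite gt_eqF// subr_gt0.
have anz := lt0r_neq0 a0; have znz := lt0r_neq0 z0.
pose dp : R := (1 - a) * P z `^ (- a) * e.
have dP1 : is_lderive (fun y => P y `^ (1 - a)) z dp.
  apply: is_lderive_eq.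
    by apply: (@is_lderive_comp _ P (fun u => u `^ (1 - a)));
      [exact: Pe|exact/has_derivP/has_deriv_powR].
  by rewrite /dp; congr (_ * _ `^ _ * _); ring.
have dz p : is_lderive (fun y => y `^ p) z (p * z `^ (p - 1)).
  by apply: has_deriv_lderive; exact: has_deriv_powR.
have dUP : is_lderive (fun y => U (P y)) z (P z `^ (- a) * z `^ (- n) * e).
  have h := is_lderive_comp Pe (has_derivP (dU Pz)).
  by rewrite (inv_powP n P0 Pinv0 PK Pmono z0) in h.
pose D x : R := c `^ a * (- (k / (a * (n - 1))) *
     (- n * z `^ (- n - 1) * P z `^ (1 - a) + z `^ (- n) * dp)
     - (1 - a) * k / a * (P z `^ (- a) * z `^ (- n) * e)) * x `^ n
  + n * (k / (a * (n - 1))) * c `^ a * x * (dp / z - P z `^ (1 - a) * (z^-1 * z^-1)).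
exists D.
  have Dz : D z = 0.
    rewrite /D /dp.
    have h1 : z `^ n * z `^ (- n) = 1 by rewrite mulrC pos_powRVM.
    have h2 : z `^ (- n - 1) = z `^ (- n) / z.
      by rewrite pos_powRD// powR_inv1 ?(ltW z0).
    rewrite h2; move: (z `^ n) (z `^ (- n)) (P z `^ (1 - a)) (P z `^ (- a)) (c `^ a) h1.
    move=> X Z p q C h1.
    transitivity ((X * Z - 1) * C * (n * (k / (a * (n - 1))) * p / z -
      k / (a * (n - 1)) * (1 - a) * q * e - (1 - a) * k / a * (q * e))).
      by field; nonzero.
    by rewrite h1 subrr !mul0r.
  rewrite -Dz; apply: cvg_at_left_filter.
  change {for z, continuous D}; rewrite /D; apply: continuousD_at.
    by apply: continuousM_at; [exact: continuous_cst_at|exact: continuous_powR].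
  apply: continuousM_at; last exact: continuous_cst_at.
  by apply: continuousM_at; [exact: continuous_cst_at|exact: cvg_id].
move=> x x0 xz.
pose F y := c `^ a * ((- (k / (a * (n - 1))) * (y `^ (- n) * P y `^ (1 - a))
   + (1 - a) * k / a * (c `^ (- a) * T c + U c - U (P y)))) * x `^ n
  + n * (k / (a * (n - 1))) * c `^ a * x * (P y `^ (1 - a) / y).
have FE y : x <= y -> y <= z -> F y = wmod c x y.
  move=> xy yz; have y0 : 0 < y by exact: lt_le_trans xy.
  have Pyc : P y <= c by apply: le_trans Pc; exact: (P_le Pmono).
  rewrite /wmod max_l; last by apply: le_trans Pyc; exact: Gam_leP.
  by rewrite subrr mulr0 subr0 /Wfun /coef Pyc /coef_high /F; ring.
apply: (@is_lderive_near _ F).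
- near=> y; apply: FE; [|by near: y; exact: nbhs_left_le].
  by near: y; exact: nbhs_left_ge.
- by apply: FE => //; exact: ltW.
apply: is_lderive_eq.
  apply: is_lderiveD.
    apply: is_lderiveM; last exact: is_lderive_cst.
    apply: is_lderiveZ; apply: is_lderiveD; apply: is_lderiveZ.
      by apply: is_lderiveM; [exact: dz|exact: dP1].
    by apply: is_lderiveD; [exact: is_lderive_cst|apply: is_lderiveN; exact: dUP].
  apply: is_lderiveZ; apply: is_lderiveM; first exact: dP1.
  exact: has_deriv_lderive (has_deriv_inv z0).
by rewrite /D; ring.
Unshelve. all: by end_near. Qed.

(** Gamma tends to P z > c as x increases to z, so for x near z the point lies strictly below the
    free boundary, and by continuity it stays there for y near z. Only the third branch of w is thus
    differentiated. *)
Lemma boundary_low c z : 0 < c -> 0 < z -> c < P z ->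
  exists2 D : R -> R, D y @[y --> z^'-] --> 0 &
    \forall x \near z^'-, is_lderive (wmod c x) z (D x).
Proof.
move=> c0 z0 cP; have [a0 a1 n1 k0] := params; have Pz := P0 z0.
have [e e0 Pe] := P_lderive Pmono Pdc z0.
have n1' : n - 1 != 0 by rewrite gt_eqF// subr_gt0.
have a1' : 1 - a != 0 by rewrite gt_eqF// subr_gt0.
have anz := lt0r_neq0 a0; have znz := lt0r_neq0 z0.
have dTP : is_lderive (fun y => T (P y)) z (- z `^ (- n) * e).
  have h := is_lderive_comp Pe (has_derivP (dT Pz)).
  by rewrite (inv_powP n P0 Pinv0 PK Pmono z0) in h.
have dzn : is_lderive (fun y => y `^ (- n)) z (- n * z `^ (- n - 1)).
  by apply: has_deriv_lderive; exact: has_deriv_powR.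
pose tau x : R := (x / z) `^ (1 - a)^-1.
have dtau x : 0 < x ->
    has_deriv (fun y => (x / y) `^ (1 - a)^-1) z ((- ((1 - a)^-1 / z)) * tau x).
  move=> x0; have xz0 : 0 < x / z by rewrite divr_gt0.
  apply: has_deriv_eq.
    apply: (@has_deriv_comp _ (fun y => x / y) (fun u => u `^ _)).
      by apply: has_derivZ; exact: has_deriv_inv.
    exact: has_deriv_powR.
  rewrite /tau (pos_powRD _ _ xz0) powR_inv1 ?(ltW xz0)//.
  by have xnz := lt0r_neq0 x0; field; nonzero.
pose D x : R := ((- (k / (a * (n - 1))) *
      (- n * z `^ (- n - 1) * P z + z `^ (- n) * e)
    + (1 - a) * k / a * (- z `^ (- n) * e)
    + k / (n - 1) * ((- n * z `^ (- n - 1) * P z + z `^ (- n) * e) * E (tau x)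
       + z `^ (- n) * P z * ((-1 * (tau x) `^ (- (n * (1 - a)))) *
          ((- ((1 - a)^-1 / z)) * tau x)))) * x `^ n
  + (n * (k / (a * (n - 1))) - k) *
     (e * tau x + P z * ((- ((1 - a)^-1 / z)) * tau x))).
exists D.
  have tz : tau z = 1 by rewrite /tau divff// one_powR.
  have Dz : D z = 0.
    rewrite /D tz E1 one_powR.
    have h1 : z `^ n * z `^ (- n) = 1 by rewrite mulrC pos_powRVM.
    have h2 : z `^ (- n - 1) = z `^ (- n) / z.
      by rewrite pos_powRD// powR_inv1 ?(ltW z0).
    rewrite h2; move: (z `^ n) (z `^ (- n)) (P z) h1 => X Z p h1.
    transitivity ((X * Z - 1) * (- (k / (a * (n - 1))) * (- n / z * p + e)
       - (1 - a) * k / a * e + k / (n - 1) * (p * ((1 - a)^-1 / z)))).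
      by field; nonzero.
    by rewrite h1 subrr !mul0r.
  rewrite -Dz; apply: cvg_at_left_filter.
  change {for z, continuous D}.
  have ctau : {for z, continuous tau}.
    rewrite /tau; apply: (@continuous_comp_at _ _ (fun x => x / z) (fun u => u `^ _)).
      by apply: continuousM_at; [exact: cvg_id|exact: continuous_cst_at].
    by apply: continuous_powR; rewrite divr_gt0.
  have ct1 : {for z, continuous (fun x => E (tau x))}.
    apply: (@continuous_comp_at _ _ _ E _ ctau).
    by rewrite tz; apply: has_deriv_continuous (dE ltr01).
  have ct2 : {for z, continuous (fun x => (tau x) `^ (- (n * (1 - a))))}.
    apply: (@continuous_comp_at _ _ _ (fun u => u `^ _) _ ctau).
    by rewrite tz; apply: continuous_powR.
  have ct3 : {for z, continuous (fun x => (- ((1 - a)^-1 / z)) * tau x)}.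
    by apply: continuousM_at => //; exact: continuous_cst_at.
  have cst (v : R) := @continuous_cst_at R R v z.
  rewrite /D; apply: continuousD_at.
    apply: continuousM_at; last exact: continuous_powR.
    apply: continuousD_at; first exact: cst.
    apply: continuousM_at; first exact: cst.
    apply: continuousD_at; first by apply: continuousM_at.
    apply: continuousM_at; first exact: cst.
    apply: continuousM_at => //; apply: continuousM_at => //.
  apply: continuousM_at; first exact: cst.
  by apply: continuousD_at; apply: continuousM_at.
have cGz : \forall x \near z^'-, c < Gam x z.
  have h : Gam x z @[x --> z^'-] --> P z.
    apply: cvg_at_left_filter; rewrite -(Gam_diag z0).
    exact: has_deriv_continuous (has_deriv_Gam z0 z0).
  exact: (cvgr_gt (P z) h).
near=> x.
have x0 : 0 < x by near: x; exact: nbhs_left_gt.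
have xz : x < z by near: x; exact: nbhs_left_lt.
have cG : c < Gam x z by near: x.
pose F y := (- (k / (a * (n - 1))) * (y `^ (- n) * P y) + (1 - a) * k / a * T (P y)
   + k / (n - 1) * (y `^ (- n) * P y * E ((x / y) `^ (1 - a)^-1))) * x `^ n
  + (n * (k / (a * (n - 1))) - k) * (P y * (x / y) `^ (1 - a)^-1) + k * c.
have FE y : x < y -> c < Gam x y -> F y = wmod c x y.
  move=> xy cGy; have y0 : 0 < y by exact: lt_trans xy.
  rewrite /wmod max_r; last exact: ltW.
  rewrite /Wfun /coef leNgt Gam_ltP//= /coef_mid Gam_ratio//.
  have G0 := Gam_gt0 x0 y0.
  (* By [Gam_marginal] the term in Gamma^a becomes n k / (a (n - 1)) times Gamma and merges with - k
     Gamma. *)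
  have -> : Gam x y `^ a = Gam x y * Gam x y `^ (a - 1).
    by rewrite mulr_powRB1 ?(ltW G0).
  have -> : n * (k / (a * (n - 1))) * (Gam x y * Gam x y `^ (a - 1)) * x *
     (P y `^ (1 - a) / y) = n * (k / (a * (n - 1))) * Gam x y * (x *
     (Gam x y `^ (a - 1) * (P y `^ (1 - a) / y))) by ring.
  by rewrite Gam_marginal// divff ?gt_eqF// /F -/(Gam x y); ring.
apply: (@is_lderive_near _ F).
- have h : Gam x y @[y --> z^'-] --> Gam x z.
    by have := is_lderive_cvg (is_lderiveM Pe (has_deriv_lderive (dtau x x0))).
  have h' := cvgr_gt (Gam x z) h c cG.
  near=> y; apply: FE; near: y; [exact: nbhs_left_gt|exact: h'].
- exact: FE.
have h := dtau x x0.
apply: is_lderive_eq.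
  apply: is_lderiveD; last exact: is_lderive_cst.
  apply: is_lderiveD.
    apply: is_lderiveM; last exact: is_lderive_cst.
    apply: is_lderiveD.
      apply: is_lderiveD; apply: is_lderiveZ; last exact: dTP.
      by apply: is_lderiveM; [exact: dzn|exact: Pe].
    apply: is_lderiveZ; apply: is_lderiveM.
      by apply: is_lderiveM; [exact: dzn|exact: Pe].
    apply: has_deriv_lderive; apply: (@has_deriv_comp _ (fun y => (x / y) `^ _) E).
      exact: h.
    by apply: dE; rewrite powR_gt0// divr_gt0.
  apply: is_lderiveZ; apply: is_lderiveM; first exact: Pe.
  exact: has_deriv_lderive h.
by rewrite /D /tau; ring.
Unshelve. all: by end_near. Qed.

Lemma boundary_wmod c z : 0 < c -> 0 < z ->
  exists2 D : R -> R, D y @[y --> z^'-] --> 0 &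
    \forall x \near z^'-, is_lderive (wmod c x) z (D x).
Proof.
move=> c0 z0; have [Pc|cP] := leP (P z) c; last exact: boundary_low.
have [D D0 Dx] := boundary_high c0 z0 Pc; exists D => //.
near=> x; apply: Dx; near: x; [exact: nbhs_left_gt|exact: nbhs_left_lt].
Unshelve. all: by end_near. Qed.

(** Case distinctions in z do not preserve differences of convex functions, so the branches are
    merged by maxima and minima. If P z <= c then y1 = c and y2 = 1, which kills the E term;
    otherwise y1 = P z, and the E term is what separates [coef_mid] at m from the common value at P
    z. *)
Lemma dcon_wmod c x u v : 0 < c -> 0 < x -> x < u -> u < v -> dcon u v (wmod c x).
Proof.
move=> c0 x0 xu uv; have [a0 a1 n1 k0] := params.
have u0 : 0 < u by exact: lt_trans xu.
have uv' := ltW uv.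
have z0 z : u <= z <= v -> 0 < z by move=> /andP[uz _]; exact: lt_le_trans uz.
have xz z : u <= z <= v -> x < z by move=> /andP[uz _]; exact: lt_le_trans uz.
have Pz0 z : u <= z <= v -> 0 < P z by move=> /z0; exact: P0.
have dP := Pdc u0 uv.
have dz p : dcon u v (fun z => z `^ p) by apply: dcon_powR => //; exact: dcon_id.
have dPp p : dcon u v (fun z => P z `^ p) by exact: dcon_powR.
have dinv : dcon u v (fun z => z^-1).
  by apply: dcon_ext (dz (- 1)) => z /z0 h; rewrite powR_inv1 ?ltW.
have dPinv : dcon u v (fun z => (P z)^-1).
  by apply: dcon_ext (dPp (- 1)) => z /Pz0 h; rewrite powR_inv1 ?ltW.
have dcst := dcon_cst u v.
have dG : dcon u v (Gam x).
  apply: dconM => //; apply: dcon_powR => //; first by apply: dconM.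
  by move=> z /z0 h; rewrite divr_gt0.
pose m z := Num.max c (Gam x z).
have dm : dcon u v m by apply: dcon_max.
have m0 z : u <= z <= v -> 0 < m z by move=> _; rewrite lt_max c0.
pose y1 z := Num.max c (P z).
have dy1 : dcon u v y1 by apply: dcon_max.
have y10 z : u <= z <= v -> 0 < y1 z by move=> _; rewrite lt_max c0.
pose y2 z := Num.min (m z) (P z) / P z.
have dy2 : dcon u v y2 by apply: dconM => //; apply: dcon_min.
have y20 z : u <= z <= v -> 0 < y2 z.
  by move=> h; rewrite divr_gt0 ?Pz0// lt_min m0//= Pz0.
have lT : loc_cvx T.
  by apply: (loc_cvx_tail params_n1 Pinv0 PK Pmono) => y y_gt0; exact/has_derivP/dT.
have lU : loc_cvx (fun y => - U y).
  apply: (@loc_cvx_derive _ _ (fun y => - (y `^ (- a) * s y))).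
    by move=> y y_gt0; apply: is_deriveN; exact/has_derivP/dU.
  move=> y w y_gt0 yw; rewrite lerN2.
  have w0 := lt_le_trans y_gt0 yw.
  apply: ler_pM; rewrite ?powR_ge0//.
    by apply: le_powR_neg => //; lra.
  exact: (inv_pow_le params_n1 Pinv0 PK Pmono).
have lE : loc_cvx E.
  apply: (@loc_cvx_derive _ _ (fun y => - y `^ (- (n * (1 - a))))).
    by move=> y y_gt0; exact/has_derivP/dE.
  move=> y w y_gt0 yw; rewrite lerN2; apply: le_powR_neg => //.
  by rewrite oppr_le0 mulr_ge0//; lra.
have dT1 : dcon u v (fun z => T (y1 z)) by exact: dcon_loc_cvx.
have dU1 : dcon u v (fun z => U (y1 z)).
  by apply: dcon_ext (dconN (dcon_loc_cvx dy1 uv' y10 lU)) => z _; rewrite opprK.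
have dUP : dcon u v (fun z => U (P z)).
  by apply: dcon_ext (dconN (dcon_loc_cvx dP uv' Pz0 lU)) => z _; rewrite opprK.
have dE2 : dcon u v (fun z => E (y2 z)) by exact: dcon_loc_cvx.
have dy1p p : dcon u v (fun z => y1 z `^ p) by exact: dcon_powR.
have dmp p : dcon u v (fun z => m z `^ p) by exact: dcon_powR.
apply: (@dcon_ext _ _ _ (fun z => (y1 z `^ a *
   ((- (k / (a * (n - 1)))) * (z `^ (- n) * P z `^ (1 - a))
   + (1 - a) * k / a * (y1 z `^ (- a) * T (y1 z) + U (y1 z) - U (P z)))
   + k / (n - 1) * (z `^ (- n) * P z * E (y2 z))) * x `^ n
   + n * (k / (a * (n - 1))) * (m z `^ a * x * (P z `^ (1 - a) * z^-1))
   - k * (m z - c))).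
  move=> z uzv; have zz := z0 z uzv; have Pz := Pz0 z uzv; have x_z := xz z uzv.
  have GP : Gam x z < P z by exact: Gam_ltP.
  rewrite /wmod -/(m z) /Wfun.
  have -> : coef (m z) z = coef_high (y1 z) z + k / (n - 1) * (z `^ (- n) * P z * E (y2 z)).
    rewrite /coef /y2 /y1 /m; have [Pc|cP] := leP (P z) c.
      rewrite max_l; last exact/ltW/(lt_le_trans GP).
      by rewrite Pc min_r// divff ?gt_eqF// E1; ring.
    have mP : Num.max c (Gam x z) < P z by rewrite gt_max cP GP.
    rewrite leNgt mP/= min_l ?(ltW mP)// coef_glue// /coef_mid.
    by rewrite divff ?gt_eqF// E1; ring.
  by rewrite /coef_high; ring.
apply: dconB; last by apply: dconZ; apply: dconB.
apply: dconD.
  apply: dconM => //; apply: dconD.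
    apply: dconM => //; apply: dconD; apply: dconZ; first exact: dconM.
    by apply: dconB => //; apply: dconD => //; exact: dconM.
  by apply: dconZ; apply: dconM => //; exact: dconM.
by apply: dconZ; apply: dconM; [exact: dconM|exact: dconM].
Qed.

(** * Positivity and growth of w *)

Hypothesis T_ge0 : forall y, 0 < y -> 0 <= T y.

Lemma U_le y z : 0 < y -> y <= z -> U y <= U z.
Proof.
move=> y0; rewrite le_eqVlt => /orP[/eqP ->//|yz].
have [m /andP[ym mz] h] := has_deriv_MVT y0 yz dU.
rewrite -subr_ge0 h mulr_ge0 ?subr_ge0 ?(ltW yz)// mulr_ge0 ?powR_ge0//.
Qed.

(** In the derivative the terms in s cancel, leaving - a u^(- a - 1) T u. *)
Lemma tail_decr y z : 0 < y -> y <= z ->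
  z `^ (- a) * T z + U z <= y `^ (- a) * T y + U y.
Proof.
have [a0 a1 n1 k0] := params.
move=> y0; rewrite le_eqVlt => /orP[/eqP ->//|yz].
have d u : 0 < u -> is_derive u 1 (fun u => u `^ (- a) * T u + U u)
    (- a * u `^ (- a - 1) * T u).
  move=> u0; apply: has_derivP; apply: has_deriv_eq.
    apply: has_derivD; last exact: (dU u0).
    by apply: has_derivM; [exact: has_deriv_powR|exact: dT].
  by rewrite /=; ring.
have [m /andP[ym mz] h] := MVT_pos y0 yz d.
have m0 : 0 < m by exact: lt_trans ym.
rewrite -subr_le0 h mulr_le0_ge0 ?subr_ge0 ?(ltW yz)//.
by rewrite mulr_le0_ge0 ?T_ge0// mulr_le0_ge0 ?powR_ge0// oppr_le0 ltW.
Qed.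

Lemma E_ge0 u : 0 < u -> u <= 1 -> 0 <= E u.
Proof.
move=> u0; rewrite le_eqVlt => /orP[/eqP ->|u1]; first by rewrite E1.
have [m /andP[um m1]] := has_deriv_MVT u0 u1 dE.
rewrite E1 sub0r => /eqP; rewrite eqr_oppLR => /eqP ->.
by rewrite -mulNr opprK mulr_ge0 ?powR_ge0// subr_ge0 ltW.
Qed.

Lemma E_le u : 0 < u -> u <= 1 -> u `^ (n * (1 - a)) * E u <= 1.
Proof.
have [a0 a1 n1 k0] := params.
have nu0 : 0 <= n * (1 - a) by rewrite mulr_ge0//; lra.
move=> u0; rewrite le_eqVlt => /orP[/eqP ->|u1]; first by rewrite E1 mulr0.
have [m /andP[um m1]] := has_deriv_MVT u0 u1 dE.
rewrite E1 sub0r => /eqP; rewrite eqr_oppLR => /eqP ->.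
have m0 : 0 < m by exact: lt_trans um.
have h : m `^ (- (n * (1 - a))) <= u `^ (- (n * (1 - a))).
  by apply: le_powR_neg => //; [lra|exact: ltW].
have e : u `^ (n * (1 - a)) * u `^ (- (n * (1 - a))) = 1 by rewrite mulrC pos_powRVM.
have := ler_wpM2l (powR_ge0 u (n * (1 - a))) h; rewrite e => h1.
have h2 : 0 <= u `^ (n * (1 - a)) * m `^ (- (n * (1 - a))) by rewrite mulr_ge0 ?powR_ge0.
by rewrite -mulNr opprK mulrA mulr_ile1// ?subr_ge0; lra.
Qed.

(** Moving the E term to the left gives a function with zero derivative and value 1 at 1. If n (1 -
    a) = 1 then E is minus the logarithm and the identity reads 1 = 1. *)
Lemma E_powR u : 0 < u -> u `^ (1 - n * (1 - a)) = 1 - (1 - n * (1 - a)) * E u.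
Proof.
move=> u0; set nu := n * (1 - a).
have d v : 0 < v -> is_derive v 1 (fun v => v `^ (1 - nu) + (1 - nu) * E v) 0.
  move=> v0; apply: has_derivP; apply: has_deriv_eq.
    apply: has_derivD; first exact: has_deriv_powR.
    by apply: has_derivZ; exact: dE.
  by rewrite (_ : 1 - nu - 1 = - nu); ring.
have F1 : 1 `^ (1 - nu) + (1 - nu) * E 1 = 1 by rewrite E1 one_powR mulr0 addr0.
suff : u `^ (1 - nu) + (1 - nu) * E u = 1 by lra.
have [u1|u1|->//] := ltgtP u 1.
  by have [m _] := MVT_pos u0 u1 d; rewrite mul0r F1; lra.
by have [m _] := MVT_pos ltr01 u1 d; rewrite mul0r F1; lra.
Qed.

(* With nu = n (1 - a) and n >= nu + a, the right-hand side below dominates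
   (nu + a - 1) (1 + nu E u). *)
Lemma E_pos u : 0 < u -> u <= 1 ->
  0 < -1 + a * E u + (n * (1 - a) + a) * u `^ (1 - n * (1 - a)).
Proof.
have [a0 a1 n1 k0] := params; move=> u0 u1.
rewrite E_powR//; set nu := n * (1 - a).
have nu1 : 0 < nu + a - 1.
  have : 0 < (n - 1) * (1 - a) by rewrite mulr_gt0 ?subr_gt0.
  by rewrite /nu; lra.
have nu0 : 0 <= nu by rewrite mulr_ge0//; lra.
have -> : -1 + a * E u + (nu + a) * (1 - (1 - nu) * E u) = (nu + a - 1) * (1 + nu * E u).
  by ring.
by rewrite mulr_gt0// ltr_wpDr// mulr_ge0// E_ge0.
Qed.

(** * Bounds on W between Gamma and Phi, in the ratios x / z and m / P z *)

Section mid.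
Variables (x z m : R).
Hypotheses (x0 : 0 < x) (z0 : 0 < z) (xz : x <= z) (Gm : Gam x z <= m) (mP : m <= P z).

Let Pz : 0 < P z. Proof. exact: P0. Qed.
Let m0 : 0 < m. Proof. by apply: lt_le_trans Gm; exact: Gam_gt0. Qed.
Let u0 : 0 < m / P z. Proof. by rewrite divr_gt0. Qed.
Let u1 : m / P z <= 1. Proof. by rewrite ler_pdivrMr// mul1r. Qed.
Let t0 : 0 < x / z. Proof. by rewrite divr_gt0. Qed.

Lemma Gam_ratio_le : x / z <= (m / P z) `^ (1 - a).
Proof.
have [a0 a1 n1 k0] := params.
have a10 : 0 <= 1 - a by lra.
have a1' : 1 - a != 0 by rewrite gt_eqF// subr_gt0.
have h : (x / z) `^ (1 - a)^-1 <= m / P z by rewrite ler_pdivlMr// mulrC.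
have := le_powR_pos a10 (powR_gt0 _ t0) h.
by rewrite -powRrM mulVf// powRr1 ?(ltW t0).
Qed.

Lemma Wfun_midE : Wfun m x z = k / (a * (n - 1)) * P z *
     ((x / z) `^ n * (-1 + a * E (m / P z)) + n * (x / z) * (m / P z) `^ a)
   + (1 - a) * k / a * T (P z) * x `^ n.
Proof.
have [a0 a1 n1 k0] := params.
have n1' : n - 1 != 0 by rewrite gt_eqF// subr_gt0.
have anz := lt0r_neq0 a0; have znz := lt0r_neq0 z0.
have cE : coef m z = coef_mid m z.
  rewrite /coef; case: leP => // Pm.
  by rewrite (_ : m = P z) ?coef_glue//; apply/le_anti; rewrite mP Pm.
rewrite /Wfun cE /coef_mid.
have -> : (x / z) `^ n = x `^ n * z `^ (- n).
  by rewrite powRM ?invr_ge0 ?(ltW x0) ?(ltW z0)// -powR_inv1 ?(ltW z0)// -powRrM mulN1r.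
have -> : (m / P z) `^ a = m `^ a * P z `^ (1 - a) / P z.
  rewrite powRM ?invr_ge0 ?(ltW m0) ?(ltW Pz)// -[in LHS]powR_inv1 ?(ltW Pz)// -powRrM.
  rewrite mulN1r -mulrA; congr (_ * _).
  rewrite pos_powRD// powRr1 ?(ltW Pz)// mulrAC divff ?mul1r// gt_eqF//.
have Pnz := lt0r_neq0 Pz.
move: (P z `^ (1 - a)) (m `^ a) (x `^ n) (z `^ (- n)) (E (m / P z)) (T (P z)) => p q X Z e t.
by field; nonzero.
Qed.

Lemma Wfun_mid_gt0 : 0 < Wfun m x z.
Proof.
have [a0 a1 n1 k0] := params.
rewrite Wfun_midE; have Tx : 0 <= (1 - a) * k / a * T (P z) * x `^ n.
  by rewrite !mulr_ge0 ?invr_ge0 ?powR_ge0 ?T_ge0//; lra.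
rewrite ltr_wpDr//; rewrite mulr_gt0//.
  by rewrite mulr_gt0// divr_gt0// mulr_gt0// subr_gt0.
have Ep := E_pos u0 u1; have tu := Gam_ratio_le.
move: (m / P z) u0 u1 tu Ep => u u_gt0 u_le1 tu Ep; set t := x / z in tu *.
have t_gt0 : 0 < t by exact: t0.
have ua : 0 < u `^ a by rewrite powR_gt0.
have tn := powR_gt0 n t_gt0.
have [h|h] := leP 0 (-1 + a * E u).
  have h1 := mulr_ge0 (ltW tn) h; have nn0 : 0 < n by lra.
  by have := mulr_gt0 (mulr_gt0 nn0 t_gt0) ua; lra.
have n10 : 0 <= n - 1 by lra.
(* The bracket is negative, so t^n needs an upper bound: t <= u^(1 - a), which expresses that m is
   above Gamma, is raised to the power n - 1. Then [E_pos] applies, as n >= n (1 - a) + a. *)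
have h1 : t `^ n <= t * u `^ (n * (1 - a) + a - 1).
  rewrite (_ : t `^ n = t * t `^ (n - 1)); last by rewrite mulr_powRB1 ?(ltW t_gt0)//; lra.
  rewrite ler_wpM2l ?(ltW t_gt0)//.
  have := le_powR_pos n10 t_gt0 tu; rewrite -powRrM.
  by congr (_ <= _ `^ _); ring.
have h2 : u `^ a = u `^ (n * (1 - a) + a - 1) * u `^ (1 - n * (1 - a)).
  by rewrite -pos_powRD//; congr (_ `^ _); ring.
have w0 := powR_gt0 (n * (1 - a) + a - 1) u_gt0.
have v0 := powR_gt0 (1 - n * (1 - a)) u_gt0.
rewrite h2; move: h1 w0 v0 Ep.
move: (u `^ (n * (1 - a) + a - 1)) (u `^ (1 - n * (1 - a))) => w v h1 w0 v0 Ep.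
apply: (@lt_le_trans _ _ (t * w * (-1 + a * E u + n * v))).
  apply: mulr_gt0; first exact: mulr_gt0.
  apply: lt_le_trans Ep _.
  rewrite lerD2l ler_wpM2r ?(ltW v0)//.
  have : 0 <= a * (n - 1) by rewrite mulr_ge0// ltW.
  by lra.
have := ler_wnM2r (ltW h) h1; lra.
Qed.

(** E may blow up as m / P z tends to 0, but it is multiplied by (x / z)^n, which is at most (m / P
    z)^(n (1 - a)) above Gamma; [E_le] bounds the product. *)
Lemma Wfun_mid_le : Wfun m x z <= (k / (n - 1) + n * (k / (a * (n - 1)))) * P z
  + (1 - a) * k / a * (z `^ n * T (P z)).
Proof.
have [a0 a1 n1 k0] := params.
have n1' : n - 1 != 0 by rewrite gt_eqF// subr_gt0.
have anz := lt0r_neq0 a0.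
rewrite Wfun_midE; apply: lerD; last first.
  rewrite -mulrA ler_wpM2l//; first by rewrite !mulr_ge0 ?invr_ge0//; lra.
  by rewrite mulrC ler_wpM2r ?T_ge0//; apply: le_powR_pos => //; lra.
have -> : (k / (n - 1) + n * (k / (a * (n - 1)))) * P z =
    k / (a * (n - 1)) * P z * (a + n) by field; nonzero.
rewrite ler_wpM2l//.
  by rewrite mulr_ge0 ?divr_ge0 ?(ltW Pz) ?(ltW k0)// mulr_ge0//; lra.
have tu := Gam_ratio_le; have t1 : x / z <= 1 by rewrite ler_pdivrMr// mul1r.
have e0 := E_ge0 u0 u1; have e1 := E_le u0 u1.
have tn : (x / z) `^ n <= (m / P z) `^ (n * (1 - a)).
  have n0 : 0 <= n by lra.
  by have := le_powR_pos n0 t0 tu; rewrite -powRrM (mulrC n).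
have w0 := powR_ge0 (x / z) n.
have ua1 : (m / P z) `^ a <= 1.
  by rewrite -[leRHS](one_powR a); apply: le_powR_pos => //; exact: ltW.
have ua0 := powR_ge0 (m / P z) a.
have h1 : (x / z) `^ n * E (m / P z) <= 1.
  by apply: le_trans e1; rewrite ler_wpM2r.
have h2 : (x / z) * (m / P z) `^ a <= 1 by rewrite mulr_ile1// ltW.
have h3 := ler_wpM2l (ltW a0) h1.
have n0 : 0 <= n by lra.
have h4 := ler_wpM2l n0 h2.
lra.
Qed.

End mid.

(** This is the value of the affine branch extrapolated to c = 0. There x / z = u^(1 - a) for u =
    Gamma / P z, and subtracting k Gamma lowers the coefficient n to n (1 - a) + a, whence the
    constant in [E_pos]. *)
Lemma Wfun_Gam_gt0 x z : 0 < x -> x <= z -> 0 < Wfun (Gam x z) x z - k * Gam x z.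
Proof.
have [a0 a1 n1 k0] := params; move=> x0 xz.
have z0 : 0 < z by exact: lt_le_trans xz.
have Pz := P0 z0; have GP := Gam_leP x0 xz; have G0 := Gam_gt0 x0 z0.
have n1' : n - 1 != 0 by rewrite gt_eqF// subr_gt0.
have a1' : 1 - a != 0 by rewrite gt_eqF// subr_gt0.
have anz := lt0r_neq0 a0.
have t0 : 0 < x / z by rewrite divr_gt0.
have u0 : 0 < Gam x z / P z by rewrite divr_gt0.
have u1 : Gam x z / P z <= 1 by rewrite ler_pdivrMr// mul1r.
rewrite (Wfun_midE x0 z0 (lexx _) GP).
have Tx : 0 <= (1 - a) * k / a * T (P z) * x `^ n.
  by rewrite !mulr_ge0 ?invr_ge0 ?powR_ge0 ?T_ge0//; lra.
have Ep := E_pos u0 u1.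
have GE : Gam x z = P z * (Gam x z / P z) by rewrite mulrC divfK// gt_eqF.
have tE : x / z = (Gam x z / P z) `^ (1 - a).
  by rewrite Gam_ratio// -powRrM mulVf// powRr1// ltW.
rewrite {3}GE tE; move: (Gam x z / P z) u0 Ep => u u0 Ep.
have -> : (u `^ (1 - a)) `^ n = u `^ (n * (1 - a)) by rewrite -powRrM mulrC.
have e1 : u `^ (1 - a) * u `^ a = u.
  by rewrite -pos_powRD// (_ : 1 - a + a = 1) ?powRr1 ?ltW//; ring.
have e2 : u `^ (n * (1 - a)) * u `^ (1 - n * (1 - a)) = u.
  by rewrite -pos_powRD// (_ : n * (1 - a) + (1 - n * (1 - a)) = 1) ?powRr1 ?ltW//; ring.
have w0 := powR_gt0 (n * (1 - a)) u0.
suff : 0 < k / (a * (n - 1)) * P z * (u `^ (n * (1 - a)) * (-1 + a * E u) +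
   n * u `^ (1 - a) * u `^ a) - k * (P z * u) by lra.
rewrite -(mulrA n) e1.
have -> : k / (a * (n - 1)) * P z * (u `^ (n * (1 - a)) * (-1 + a * E u) + n * u)
    - k * (P z * u) = k / (a * (n - 1)) * P z * (u `^ (n * (1 - a)) *
   (-1 + a * E u) + (n * (1 - a) + a) * u) by field; nonzero.
rewrite -[X in _ + _ * X]e2 mulrCA -mulrDr mulr_gt0//.
  by rewrite mulr_gt0// divr_gt0// mulr_gt0// subr_gt0.
by rewrite mulr_gt0.
Qed.

Lemma Wfun_high_gt0 c x z : 0 < c -> 0 < x -> x <= z -> P z <= c -> 0 < Wfun c x z.
Proof.
have [a0 a1 n1 k0] := params; move=> c0 x0 xz Pc.
have z0 : 0 < z by exact: lt_le_trans xz.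
have Pz := P0 z0; have t0 : 0 < x / z by rewrite divr_gt0.
have t1 : x / z <= 1 by rewrite ler_pdivrMr// mul1r.
have ca := powR_gt0 a c0; have xn := powR_gt0 n x0.
rewrite /Wfun /coef Pc /coef_high.
have h1 : 0 <= (1 - a) * k / a * (c `^ (- a) * T c + U c - U (P z)).
  apply: mulr_ge0; first by rewrite !mulr_ge0 ?invr_ge0//; lra.
  have h := U_le Pz Pc.
  have : 0 <= c `^ (- a) * T c by rewrite mulr_ge0 ?powR_ge0 ?T_ge0.
  by lra.
have h2 := mulr_ge0 (mulr_ge0 (ltW ca) h1) (ltW xn).
suff : 0 < c `^ a * (- (k / (a * (n - 1))) * z `^ (- n) * P z `^ (1 - a)) * x `^ n
   + n * (k / (a * (n - 1))) * c `^ a * x * (P z `^ (1 - a) / z) by lra.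
have tE : (x / z) `^ n = x `^ n * z `^ (- n).
  by rewrite powRM ?invr_ge0 ?(ltW x0) ?(ltW z0)// -powR_inv1 ?(ltW z0)// -powRrM mulN1r.
have -> : c `^ a * (- (k / (a * (n - 1))) * z `^ (- n) * P z `^ (1 - a)) * x `^ n
   + n * (k / (a * (n - 1))) * c `^ a * x * (P z `^ (1 - a) / z)
   = c `^ a * (k / (a * (n - 1))) * P z `^ (1 - a) * (n * (x / z) - (x / z) `^ n).
  by rewrite tE; ring.
rewrite mulr_gt0//; first by rewrite !mulr_gt0 ?powR_gt0// invr_gt0 mulr_gt0// subr_gt0.
have n10 : 0 <= n - 1 by lra.
have : (x / z) `^ (n - 1) <= 1.
  by rewrite -[leRHS](one_powR (n - 1)); apply: le_powR_pos.
have -> : (x / z) `^ n = x / z * (x / z) `^ (n - 1).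
  by rewrite mulr_powRB1 ?(ltW t0)//; lra.
move=> /(ler_wpM2l (ltW t0)) h3.
have : 0 < (n - 1) * (x / z) by rewrite mulr_gt0// subr_gt0.
by lra.
Qed.

Lemma Wfun_high_le c x z : 0 < c -> 0 < x -> x <= z -> P z <= c ->
  Wfun c x z <= (n * (k / (a * (n - 1))) * P z + (1 - a) * k / a * (z `^ n * T (P z)))
    * (c / P z) `^ a.
Proof.
have [a0 a1 n1 k0] := params; move=> c0 x0 xz Pc.
have z0 : 0 < z by exact: lt_le_trans xz.
have Pz := P0 z0; have t1 : x / z <= 1 by rewrite ler_pdivrMr// mul1r.
have ca := powR_gt0 a c0; have xn := powR_gt0 n x0.
have C0 : 0 < k / (a * (n - 1)) by rewrite divr_gt0// mulr_gt0// subr_gt0.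
have K0 : 0 <= (1 - a) * k / a by rewrite !mulr_ge0 ?invr_ge0//; lra.
have cPE : (c / P z) `^ a = c `^ a * P z `^ (- a).
  by rewrite powRM ?invr_ge0 ?(ltW c0) ?(ltW Pz)// -powR_inv1 ?(ltW Pz)// -powRrM mulN1r.
rewrite /Wfun /coef Pc /coef_high cPE [leRHS]mulrDl [leLHS]addrC.
apply: lerD.
  have -> : P z `^ (1 - a) = P z * P z `^ (- a) by rewrite pos_powRD// powRr1 ?ltW.
  have p0 := powR_ge0 (P z) (- a).
  have -> : n * (k / (a * (n - 1))) * c `^ a * x * (P z * P z `^ (- a) / z) =
     n * (k / (a * (n - 1))) * P z * (c `^ a * P z `^ (- a)) * (x / z) by ring.
  rewrite ger_pMr//.
  have nn0 : 0 < n by lra.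
  by rewrite (mulr_gt0 (mulr_gt0 (mulr_gt0 nn0 C0) Pz))// mulr_gt0// powR_gt0.
have h1 := tail_decr Pz Pc.
have h2 : 0 <= k / (a * (n - 1)) * z `^ (- n) * P z `^ (1 - a).
  by apply: mulr_ge0; [apply: mulr_ge0; [exact: ltW|]|]; exact: powR_ge0.
(* The negative term is dropped, and [tail_decr] replaces the values at c by those at P z. *)
have h3 : - (k / (a * (n - 1))) * z `^ (- n) * P z `^ (1 - a) +
   (1 - a) * k / a * (c `^ (- a) * T c + U c - U (P z)) <=
   (1 - a) * k / a * (P z `^ (- a) * T (P z)).
  have h : c `^ (- a) * T c + U c - U (P z) <= P z `^ (- a) * T (P z) by lra.
  by have := ler_wpM2l K0 h; lra.
have h4 := ler_wpM2l (ltW ca) h3.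
have h5 := ler_wpM2r (ltW xn) h4.
apply: le_trans h5 _.
have -> : (1 - a) * k / a * (z `^ n * T (P z)) * (c `^ a * P z `^ (- a)) =
   c `^ a * ((1 - a) * k / a * (P z `^ (- a) * T (P z))) * z `^ n by ring.
rewrite ler_wpM2l//; last by apply: le_powR_pos => //; lra.
by rewrite !mulr_ge0 ?powR_ge0 ?T_ge0 ?invr_ge0//; lra.
Qed.

Variables (q K1 K2 : R).
Hypotheses (K10 : 0 < K1) (K20 : 0 < K2).
Hypothesis Pgrowth : forall x, 0 < x -> P x <= K1 * (1 + x `^ q).
Hypothesis Tgrowth : forall x, 0 < x -> x `^ n * T (P x) <= K2 * (1 + x `^ q).

Lemma wmod_bounds : exists K, 0 < K /\ forall c x z, 0 < c -> 0 < x -> x <= z ->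
  0 < wmod c x z <= K * ((1 + z `^ q) + (1 + z `^ q) * (c / P z) `^ a).
Proof.
have [a0 a1 n1 k0] := params.
have C0 : 0 < k / (a * (n - 1)) by rewrite divr_gt0// mulr_gt0// subr_gt0.
have C1 : 0 < k / (n - 1) by rewrite divr_gt0// subr_gt0.
have C2 : 0 < (1 - a) * k / a by rewrite !mulr_gt0 ?invr_gt0//; lra.
pose K := (k / (n - 1) + n * (k / (a * (n - 1)))) * K1 + (1 - a) * k / a * K2.
have nn0 : 0 < n by lra.
have K0 : 0 < K.
  apply: addr_gt0; last exact: mulr_gt0.
  by apply: mulr_gt0 => //; apply: addr_gt0 => //; exact: mulr_gt0.
exists K; split => // c x z c0 x0 xz.
have z0 : 0 < z by exact: lt_le_trans xz.
have Pz := P0 z0; have GP := Gam_leP x0 xz; have G0 := Gam_gt0 x0 z0.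
have zq := powR_ge0 z q; have cPa := powR_ge0 (c / P z) a.
have g1 := Pgrowth z0; have g2 := Tgrowth z0.
have K1q : 0 < K1 * (1 + z `^ q) by rewrite mulr_gt0//; lra.
have Kq : 0 <= K * (1 + z `^ q) by rewrite mulr_ge0 ?(ltW K0)//; lra.
have B1 : (k / (n - 1) + n * (k / (a * (n - 1)))) * P z
    + (1 - a) * k / a * (z `^ n * T (P z)) <= K * (1 + z `^ q).
  have nC : 0 <= k / (n - 1) + n * (k / (a * (n - 1))).
    by have := mulr_gt0 nn0 C0; lra.
  have := ler_wpM2l nC g1; have := ler_wpM2l (ltW C2) g2.
  by rewrite /K; lra.
have [Pc|cP] := leP (P z) c.
  have -> : wmod c x z = Wfun c x z.
    by rewrite /wmod max_l ?subrr ?mulr0 ?subr0// (le_trans GP).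
  rewrite Wfun_high_gt0//=; apply: le_trans (Wfun_high_le c0 x0 xz Pc) _.
  have B2 : n * (k / (a * (n - 1))) * P z + (1 - a) * k / a * (z `^ n * T (P z))
      <= K * (1 + z `^ q).
    by have := mulr_gt0 C1 Pz; lra.
  by have := ler_wpM2r cPa B2; lra.
have UB m : Gam x z <= m -> m <= P z ->
    Wfun m x z <= K * ((1 + z `^ q) + (1 + z `^ q) * (c / P z) `^ a).
  move=> Gm mP; apply: le_trans (Wfun_mid_le x0 z0 xz Gm mP) _.
  by have := mulr_ge0 Kq cPa; lra.
have [Gc|cG] := leP (Gam x z) c.
  have -> : wmod c x z = Wfun c x z by rewrite /wmod max_l// subrr mulr0 subr0.
  by rewrite Wfun_mid_gt0 ?UB//; exact: ltW.
have wE : wmod c x z = Wfun (Gam x z) x z - k * (Gam x z - c).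
  by rewrite /wmod max_r// ltW.
(* Below Gamma, w is the sum of W - k Gamma, which is positive, and k c; it is at most W at Gamma
   because k (Gamma - c) >= 0. *)
have h1 := Wfun_Gam_gt0 x0 xz; have h2 := UB _ (lexx _) GP.
have h3 := mulr_gt0 k0 c0.
have h4 : 0 <= k * (Gam x z - c) by rewrite mulr_ge0 ?subr_ge0 ?ltW.
by rewrite wE; apply/andP; split; lra.
Qed.
End model.

(** * The function Phi *)

Section increasing_product.
Context {R : realType}.
Implicit Types x y z u v : R.
Variable phi : R -> R.
Hypothesis phi_dc : diff_convex `[0, +oo[ phi.
Hypothesis phi_incr : forall x, 0 < x -> 0 < left_derive (fun x => x * phi x) x.
Local Notation psi := (fun x => x * phi x).

Lemma dcon_mul_id u v : 0 < u -> u <= v -> dcon u v psi.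
Proof.
by move=> u0 uv; apply: dconM; [exact: dcon_id|exact: (@diff_convex_dcon R 0)].
Qed.

Lemma mul_id_lt x y : 0 < x -> x < y -> psi x < psi y.
Proof.
move=> x0 xy.
have d z : x <= z -> dcon (z / 2) (z + 1) psi.
  by move=> xz; apply: dcon_mul_id; lra.
have I z : x <= z -> z / 2 < z < z + 1 by move=> xz; lra.
apply: (@lderive_gt0_lt R x y psi xy) => z /andP[xz _].
  exact: dcon_continuous (I _ xz) (d _ xz).
have [e ze] := dcon_is_lderive (I _ (ltW xz)) (d _ (ltW xz)).
exists e => //; rewrite -(left_deriveE ze); apply: phi_incr.
exact: lt_trans xz.
Qed.

(** A convex function on [0, +oo[ may jump at 0, so boundedness replaces continuity. The chord from
    0 to 1 bounds it above, the line through its values at 1 and 2 bounds it below. *)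
Lemma convex_bounded_near0 (D : set R) (g : R -> R) :
  (forall x, 0 <= x -> D x) -> convex_function D g ->
  exists2 M : R, 0 < M & forall x, 0 < x -> x <= 1 -> `|g x| <= M.
Proof.
move=> D0 cg; have cv : cvx 0 2 g.
  by apply: convex_function_cvx cg => x /andP[x0 _]; exact: D0.
exists (`|g 0| + 2 * `|g 1| + `|g 2| + 1); first by rewrite ltr_wpDl// !addr_ge0// mulr_ge0.
move=> x x0 x1.
have := ler_norm (g 0); have := ler_norm (g 1); have := ler_norm (g 2).
have := ler_norm (- g 0); have := ler_norm (- g 1); have := ler_norm (- g 2).
rewrite !normrN => h2 h1 h0 p2 p1 p0.
have := cv 0 x 1 (lexx _) (ltW x0) x1 (ler1n _ 2).
have := cv x 1 2 (ltW x0) x1 (ler1n _ 2) (lexx _).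
move: (normr_ge0 (g 0)) (normr_ge0 (g 1)) (normr_ge0 (g 2)) h0 h1 h2 p0 p1 p2.
set a0 := `|g 0|; set a1 := `|g 1|; set a2 := `|g 2|.
move=> A0 A1 A2 h0 h1 h2 p0 p1 p2 l u; rewrite ler_norml; apply/andP; split; nra.
Qed.

Lemma diff_convex_bounded_near0 :
  exists2 M : R, 0 < M & forall x, 0 < x -> x <= 1 -> `|phi x| <= M.
Proof.
have [g [h [cg ch e]]] := phi_dc.
have D0 x : 0 <= x -> `[0, +oo[%classic x by move=> x0; rewrite /= in_itv/= x0.
have [M M0 gM] := convex_bounded_near0 D0 cg.
have [N N0 hN] := convex_bounded_near0 D0 ch.
exists (M + N); first exact: addr_gt0.
move=> x x0 x1; rewrite e; last by rewrite /= in_itv/= (ltW x0).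
by rewrite (le_trans (ler_normB _ _))// lerD ?gM ?hN.
Qed.

Lemma mul_id_small v : 0 < v -> exists2 x, 0 < x & forall y, 0 < y -> y <= x -> `|psi y| <= v.
Proof.
move=> v0; have [M M0 phiM] := diff_convex_bounded_near0.
exists (Num.min 1 (v / M)); first by rewrite lt_min ltr01 divr_gt0.
move=> y y0; rewrite le_min => /andP[y1]; rewrite ler_pdivlMr// => yM.
by rewrite normrM (gtr0_norm y0) (le_trans _ yM)// ler_pM2l// phiM.
Qed.

(** x phi x tends to 0 at 0, phi being bounded there, and increases strictly. *)
Lemma mul_id_gt0 x : 0 < x -> 0 < psi x.
Proof.
move=> x0; have h0 : 0 < x / 2 by lra.
suff h : 0 <= psi (x / 2) by apply: le_lt_trans h (mul_id_lt h0 _); lra.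
rewrite leNgt; apply/negP => n0.
have [|t t0 ht] := @mul_id_small (- psi (x / 2) / 2); first by rewrite /=; lra.
pose y := Num.min t (x / 2 / 2).
have y0 : 0 < y by rewrite lt_min t0/=; lra.
have yt : y <= t by rewrite ge_min lexx.
have yx : y < x / 2 by rewrite gt_min; apply/orP; right; lra.
have := mul_id_lt y0 yx; have := ht _ y0 yt.
rewrite /= ler_norml => /andP[h1 _] h2; rewrite /= in n0; lra.
Qed.

Hypothesis phi_infty : (x * phi x) @[x --> +oo] --> +oo.

Lemma mul_id_surj v : 0 < v -> exists2 x, 0 < x & psi x = v.
Proof.
move=> v0; have [t t0 ht] := mul_id_small v0.
have [s st] : exists s, t < s /\ v < psi s.
  have near1 : \forall s \near +oo, v < psi s by move/cvgryPgt : phi_infty; exact.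
  have near2 : \forall s \near +oo, t < s by exact: nbhs_pinfty_gt (num_real t).
  by have [s [? ?]] := @filter_ex _ _ _ _ (filterI near2 near1); exists s.
have [|||x] := @IVT _ psi t s v; first exact/ltW/(proj1 st).
- apply: continuous_in_subspaceT => x; rewrite inE/= in_itv/= => /andP[tx _].
  apply: (@dcon_continuous _ (t / 2) (x + 1)); first lra.
  apply: dcon_mul_id; lra.
- have := ht _ t0 (lexx _); rewrite ler_norml => /andP[_ h].
  by rewrite ge_min h/= le_max (ltW (proj2 st)) orbT.
- by rewrite in_itv/= => /andP[tx _] <-; exists x => //; exact: lt_le_trans tx.
Qed.

End increasing_product.

Section C12_extensionality.
Context {R : realType}.
Implicit Types (D : set (R * R)) (u v : R -> R -> R) (c x : R).

Lemma nbhs_slice1 D c x : nbhs (c, x) D -> \forall t \near c, D (t, x).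
Proof.
move=> [[A B] [/= nA nB] AB]; apply: filterS nA => t At; apply: (AB (t, x)).
by split=> //; exact: nbhs_singleton nB.
Qed.

Lemma nbhs_slice2 D c x : nbhs (c, x) D -> \forall t \near x, D (c, t).
Proof.
move=> [[A B] [/= nA nB] AB]; apply: filterS nB => t Bt; apply: (AB (c, t)).
by split=> //; exact: nbhs_singleton nA.
Qed.

Lemma derivable_near_eq (f g : R -> R) x : (\forall y \near x, f y = g y) ->
  derivable f x 1 -> derivable g x 1 /\ derive1 g x = derive1 f x.
Proof.
move=> fg /derivableP df; apply: has_deriv_derive1.
by apply: has_deriv_near fg _; split; rewrite derive1E.
Qed.

(** The two functions need to agree only on the open set D, which suffices because derivatives and
    continuity are local; outside the domain of w nothing is known about its values. *)
Lemma C12_on_ext D u v : (forall q, D q -> nbhs q D) ->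
  (forall c x, D (c, x) -> u c x = v c x) -> C12_on D u ->
  C12_on D v /\ forall c x, D (c, x) -> [/\ partial_c v c x = partial_c u c x,
    partial_x v c x = partial_x u c x & partial_xx v c x = partial_xx u c x].
Proof.
move=> Do uv Cu.
have e1 c x : D (c, x) -> derivable (v^~ x) c 1 /\ partial_c v c x = partial_c u c x.
  move=> Dcx; have [[d1 _ _] _] := Cu _ _ Dcx; apply: derivable_near_eq d1.
  by apply: filterS (nbhs_slice1 (Do _ Dcx)) => t; exact: uv.
have e2 c x : D (c, x) -> derivable (v c) x 1 /\ partial_x v c x = partial_x u c x.
  move=> Dcx; have [[_ d2 _] _] := Cu _ _ Dcx; apply: derivable_near_eq d2.
  by apply: filterS (nbhs_slice2 (Do _ Dcx)) => t; exact: uv.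
have e3 c x : D (c, x) ->
    derivable (partial_x v c) x 1 /\ partial_xx v c x = partial_xx u c x.
  move=> Dcx; have [[_ _ d3] _] := Cu _ _ Dcx; apply: derivable_near_eq d3.
  by apply: filterS (nbhs_slice2 (Do _ Dcx)) => t /e2[_ ->].
split; last by move=> c x Dcx; split; [apply: (e1 _ _ Dcx).2|apply: (e2 _ _ Dcx).2|
  apply: (e3 _ _ Dcx).2].
have C (F G : R -> R -> R) c x : D (c, x) -> (forall c x, D (c, x) -> F c x = G c x) ->
    {for (c, x), continuous (fun q : R * R => F q.1 q.2)} ->
    {for (c, x), continuous (fun q : R * R => G q.1 q.2)}.
  move=> Dcx FG cF; have e : \forall q \near (c, x), F q.1 q.2 = G q.1 q.2.
    by apply: filterS (Do _ Dcx) => -[t y]; exact: FG.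
  rewrite /prop_for /continuous_at -(nbhs_singleton e).
  by apply: cvg_trans cF; exact: near_eq_cvg.
move=> c x Dcx; have [_ [c1 c2 c3 c4]] := Cu _ _ Dcx.
split; split.
- exact: (e1 _ _ Dcx).1.
- exact: (e2 _ _ Dcx).1.
- exact: (e3 _ _ Dcx).1.
- exact: (@C u v c x Dcx uv c1).
- apply: (@C (partial_c u) (partial_c v) c x Dcx _ c2) => t y Dty.
  exact/esym/(e1 _ _ Dty).2.
- apply: (@C (partial_x u) (partial_x v) c x Dcx _ c3) => t y Dty.
  exact/esym/(e2 _ _ Dty).2.
- apply: (@C (partial_xx u) (partial_xx v) c x Dcx _ c4) => t y Dty.
  exact/esym/(e3 _ _ Dty).2.
Qed.

End C12_extensionality.

Lemma powR_div {R : realType} (x y p : R) : 0 < x -> 0 < y ->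
  (x / y) `^ p = x `^ p / y `^ p.
Proof.
move=> x0 y0; rewrite powRM ?invr_ge0 ?ltW//; congr (_ * _).
by rewrite -powR_inv1 ?ltW// -powRrM mulN1r powRN.
Qed.

Lemma power_growth {R : realType} (P : R -> R) (a D s q xt : R) : 0 <= a ->
  (forall z, 0 < z -> 0 < P z) -> (forall x y, 0 < x -> x < y -> P x < P y) ->
  1 < xt -> 0 < D -> s <= q -> 1 + s * a <= q ->
  (forall z, xt < z -> P z <= D * z `^ s) ->
  exists K : R, [/\ 0 < K, forall z, 0 < z -> P z <= K * (1 + z `^ q)
  & forall z, 0 < z -> z * P z `^ a <= K * (1 + z `^ q)].
Proof.
move=> a0 P0 Pmono xt1 D0 b2 b3 large; have xt0 : 0 < xt := lt_trans ltr01 xt1.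
have S (z t : R) : xt < z -> t <= q -> z `^ t <= 1 + z `^ q.
  move=> xz tq; rewrite (le_trans (ler_powR _ tq)) ?lerDr//.
  exact/ltW/(lt_trans xt1).
pose K := D + D `^ a + P xt + xt * P xt `^ a.
have P1 : 0 <= D `^ a := powR_ge0 _ _.
have P2 := P0 _ xt0.
have P3 : 0 <= xt * P xt `^ a by rewrite mulr_ge0 ?powR_ge0// ltW.
have small (z t : R) : 0 <= t -> t <= K -> t <= K * (1 + z `^ q).
  by move=> t0 tK; rewrite (le_trans tK)// ler_peMr ?lerDl ?powR_ge0// (le_trans t0).
have PS (z : R) : 0 < z -> z <= xt -> P z <= P xt.
  by move=> z0; rewrite le_eqVlt => /predU1P[->//|/(Pmono _ _ z0)/ltW].
exists K; split.
- by rewrite /K; lra.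
- move=> z z0; have [zx|xz] := leP z xt.
    apply: small; first exact/ltW/P0.
    by have := PS _ z0 zx; rewrite /K; lra.
  rewrite (le_trans (large _ xz))//; apply: (ler_pM (ltW D0) (powR_ge0 _ _) _ (S _ _ xz b2)).
  by rewrite /K; lra.
- move=> z z0; have Pz := P0 _ z0; have [zx|xz] := leP z xt.
    apply: small; first by rewrite mulr_ge0 ?powR_ge0// ltW.
    suff : z * P z `^ a <= xt * P xt `^ a by rewrite /K; lra.
    apply: (ler_pM (ltW z0) (powR_ge0 _ _) zx).
    exact: (le_powR_pos a0 Pz (PS _ z0 zx)).
  apply: (@le_trans _ _ (D `^ a * z `^ (1 + s * a))).
    rewrite pos_powRD// powRr1 ?(ltW z0)// mulrCA ler_pM2l// powRrM.
    rewrite -powRM ?powR_ge0 ?(ltW D0)//.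
    exact: (le_powR_pos a0 Pz (large _ xz)).
  apply: (ler_pM P1 (powR_ge0 _ _) _ (S _ _ xz b3)).
  by rewrite /K; lra.
Qed.

(** * Identification of Phi, A, f, B and w with the model *)

Section boundary_function.
Context {R : realType}.
Implicit Types x y z u v : R.
Variables (mu r n k a : R) (phi : R -> R).
Hypothesis params : [/\ 0 < a, a < 1, 1 < n & 0 < k].
Hypothesis mu_lt_r : mu < r.
Hypothesis phi_dc : diff_convex `[0, +oo[ phi.
Hypothesis phi_incr : forall x, 0 < x -> 0 < left_derive (fun x => x * phi x) x.
Hypothesis phi_infty : (x * phi x) @[x --> +oo] --> +oo.
Local Notation C0 := (a * (n - 1) / ((r - mu) * n * k)).
Local Notation Phi := (Phi_fun mu r n k a phi).
Local Notation Pinv := (Phi_inv mu r n k a phi).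

Lemma Phi_cst_gt0 : 0 < C0.
Proof.
have [a0 a1 n1 k0] := params; have n0 : 0 < n by lra.
by rewrite divr_gt0// mulr_gt0// ?subr_gt0// mulr_gt0// subr_gt0.
Qed.
Let C00 := Phi_cst_gt0.

Lemma Phi_funE z : 0 < z -> Phi z = (C0 * (z * phi z)) `^ (1 - a)^-1.
Proof.
move=> z0; have zp : 0 <= z * phi z by apply/ltW/mul_id_gt0.
by rewrite /Phi_fun /Gamma_fun [RHS]powRM// ltW.
Qed.

Lemma Phi_fun_gt0 z : 0 < z -> 0 < Phi z.
Proof. by move=> z0; rewrite Phi_funE// powR_gt0// mulr_gt0//; exact: mul_id_gt0. Qed.

Lemma Phi_fun_pow z : 0 < z -> Phi z `^ (1 - a) = C0 * (z * phi z).
Proof.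
have [a0 a1 n1 k0] := params => z0.
rewrite Phi_funE// -powRrM mulVf ?powRr1//; last lra.
by apply/ltW/mulr_gt0 => //; exact: mul_id_gt0.
Qed.

Lemma Phi_fun_lt x y : 0 < x -> x < y -> Phi x < Phi y.
Proof.
have [a0 a1 n1 k0] := params.
move=> x0 xy; have y0 := lt_trans x0 xy; rewrite !Phi_funE//.
have px := mul_id_gt0 phi_dc phi_incr x0; have py := mul_id_gt0 phi_dc phi_incr y0.
apply: lt_powR_pos; [by rewrite invr_gt0; lra|exact: mulr_gt0|].
by rewrite ltr_pM2l//; exact: mul_id_lt.
Qed.

Lemma dcon_Phi_fun u v : 0 < u -> u < v -> dcon u v Phi.
Proof.
move=> u0 uv.
apply: (@dcon_ext _ _ _ (fun z => (C0 * (z * phi z)) `^ (1 - a)^-1)).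
  by move=> x /andP[ux _]; rewrite Phi_funE//; exact: lt_le_trans ux.
apply: dcon_powR (ltW uv) _; first by apply: dconZ; exact: dcon_mul_id (ltW uv).
move=> x /andP[ux _]; apply: mulr_gt0 => //; apply: mul_id_gt0 => //.
exact: lt_le_trans ux.
Qed.

Lemma Phi_fun_surj y : 0 < y -> exists2 x, 0 < x & Phi x = y.
Proof.
have [a0 a1 n1 k0] := params; move=> y0.
have [x x0 /= e] := mul_id_surj phi_dc phi_infty
  (divr_gt0 (powR_gt0 (1 - a) y0) C00).
exists x => //; rewrite Phi_funE// e (mulrC C0) divfK ?gt_eqF//.
by rewrite -powRrM mulfV ?powRr1 ?(ltW y0)//; lra.
Qed.

Let surj : set_surj `]0, +oo[ `]0, +oo[ Phi.
Proof.
move=> y; rewrite /= in_itv/= andbT => /Phi_fun_surj[x x0 <-]; exists x => //.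
by rewrite /= in_itv/= x0.
Qed.

Lemma Phi_invK y : 0 < y -> Phi (Pinv y) = y.
Proof. by move=> y0; rewrite /Phi_inv pinvK// inE; apply: surj; rewrite /= in_itv/= y0. Qed.

Lemma Phi_inv_gt0 y : 0 < y -> 0 < Pinv y.
Proof.
move=> y0.
have := @surjpinv_image_sub _ _ (fun=> 0) _ _ _ surj (Pinv y).
rewrite /= in_itv/= andbT; apply; exists y => //.
by rewrite /= in_itv/= y0.
Qed.

(** The margin delta is positive by hypothesis, and eps is such that eps / (1 - a) = delta / 2. Then
    Phi grows with exponent p + n - 1 - delta / 2 and z Phi^a with exponent n - delta + a delta / 2;
    both are at most q = n - delta / 2, as p <= 1 and a < 1. *)
Lemma Phi_fun_growth p : 0 <= p <= 1 -> p * a / (1 - a) < n - 1 ->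
  (forall eps : R, 0 < eps -> exists Kt xt : R, 1 < xt /\
     forall x, xt < x -> x * phi x <= Kt * x `^ (p + eps)) ->
  exists q K : R, [/\ 0 < q, q < n, 0 < K,
    forall z, 0 < z -> Phi z <= K * (1 + z `^ q)
  & forall z, 0 < z -> z * Phi z `^ a <= K * (1 + z `^ q)].
Proof.
have [a0 a1 n1 k0] := params; have b0 : 0 < 1 - a by lra.
move=> /andP[p0 p1] pn growth; set delta := n - 1 - p * a / (1 - a).
have d0 : 0 < delta by rewrite /delta; lra.
have e0 : 0 < delta * (1 - a) / 2 by rewrite divr_gt0// mulr_gt0.
have [Kt [xt [xt1 Kxt]]] := growth _ e0.
set eps := delta * (1 - a) / 2 in e0 Kxt *.
have epsE : eps / (1 - a) = delta / 2 by rewrite /eps; field; lra.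
have pE : p / (1 - a) = p + p * a / (1 - a) by field; lra.
have g1 : (p + eps) / (1 - a) = p + n - 1 - delta / 2.
  by rewrite mulrDl epsE pE /delta; lra.
have xt0 : 0 < xt by lra.
pose q := n - delta / 2.
have b2 : (p + eps) / (1 - a) <= q.
  by rewrite g1 /q; lra.
have b3 : 1 + (p + eps) / (1 - a) * a <= q.
  suff -> : (p + eps) / (1 - a) * a = n - 1 - delta + delta / 2 * a.
    by rewrite /q; nra.
  by rewrite mulrDl epsE mulrDl /delta; lra.
have q0 : 0 < q by apply: lt_le_trans b2; rewrite divr_gt0//; lra.
(* The given constant has no prescribed sign, while a positive one is needed under the power. *)
pose M := `|Kt| + 1; have M0 : 0 < M by rewrite /M; have := normr_ge0 Kt; lra.
pose D := (C0 * M) `^ (1 - a)^-1.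
have D0 : 0 < D by apply/powR_gt0/mulr_gt0.
have large z : xt < z -> Phi z <= D * z `^ ((p + eps) / (1 - a)).
  move=> xz; have z0 := lt_trans xt0 xz.
  rewrite Phi_funE// powRrM /D -powRM ?powR_ge0//; last exact/ltW/mulr_gt0.
  apply: le_powR_pos; first by rewrite invr_ge0 ltW.
    by apply: mulr_gt0 => //; exact: mul_id_gt0.
  rewrite -[leRHS]mulrA ler_pM2l// (le_trans (Kxt _ xz))// ler_wpM2r ?powR_ge0//.
  by rewrite /M (le_trans (ler_norm _))// lerDl.
have [K [K0 K1 K2]] := power_growth (ltW a0) Phi_fun_gt0 Phi_fun_lt xt1 D0 b2 b3 large.
by exists q, K; split => //; rewrite /q; lra.
Qed.

Let nz : [/\ a != 0, n != 0, n - 1 != 0, k != 0 & r - mu != 0].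
Proof.
have [a0 a1 n1 k0] := params.
by split; apply: lt0r_neq0; have := mu_lt_r; lra.
Qed.

Lemma phi_PhiE z : 0 < z ->
  phi z = (r - mu) * n * (k / (a * (n - 1))) * (Phi z `^ (1 - a) / z).
Proof.
have [a0 a1 n1 k0] := params; move=> z0; rewrite Phi_fun_pow//.
have [h1 h2 h3 h4 h5] := nz; have h6 := lt0r_neq0 z0.
by field; nonzero.
Qed.

Lemma Gamma_funE x z : 0 < x -> 0 < z ->
  Gamma_fun mu r n k a phi x z = Gam a Phi x z.
Proof.
move=> x0 z0; have zp : 0 < z * phi z by exact: mul_id_gt0.
have p0 : 0 < phi z by move: zp; rewrite pmulr_rgt0.
have q0 : 0 <= C0 * (z * phi z) by apply/ltW/mulr_gt0.
have q1 : 0 <= x * phi z by apply/ltW/mulr_gt0.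
rewrite /Gam Phi_funE// /Gamma_fun -powRM ?(ltW C00)//.
rewrite -powRM ?divr_ge0 ?(ltW x0) ?(ltW z0)//; congr (_ `^ _).
by rewrite -[RHS]mulrA; congr (_ * _); have h := lt0r_neq0 z0; field.
Qed.

Variables T U E : R -> R.
Local Notation inv := (inv_pow n Pinv).
Hypothesis dT : forall y, 0 < y -> has_deriv T y (- inv y).
Hypothesis T_cvg0 : T y @[y --> +oo] --> 0.
Hypothesis dU : forall y, 0 < y -> has_deriv U y (y `^ (- a) * inv y).
Hypothesis dE : forall u, 0 < u -> has_deriv E u (- u `^ (- (n * (1 - a)))).
Hypothesis E1 : E 1 = 0.

Lemma A_funE z : 0 < z -> A_fun mu r n k a phi z =
  - (k / (a * (n - 1))) * z `^ (- n) * Phi z `^ (1 - a)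
  + (1 - a) * k / a * Phi z `^ (- a) * T (Phi z).
Proof.
have [a0 a1 n1 k0] := params; move=> z0; rewrite /A_fun.
rewrite (integral_tail n1 Phi_fun_gt0 Phi_inv_gt0 Phi_invK Phi_fun_lt dcon_Phi_fun _ T_cvg0)//.
by move=> y /dT/has_derivP.
Qed.

(** The first summand of f cancels the corresponding term of A, so the inverse of Phi survives only
    through T. *)
Lemma f_funE y : 0 < y ->
  f_fun mu r n k a phi y = - ((1 - a) * k) * y `^ (- a - 1) * T y.
Proof.
have [a0 a1 n1 k0] := params; move=> y0.
have [h1 h2 h3 h4 h5] := nz; have h6 := lt0r_neq0 y0.
rewrite /f_fun A_funE ?Phi_inv_gt0// Phi_invK//.
rewrite (_ : 1 - a = - a + 1); last by rewrite addrC.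
rewrite !pos_powRD// powRr1 ?(ltW y0)// powR_inv1 ?(ltW y0)//.
by field; nonzero.
Qed.

Let H y := (1 - a) * k / a * (y `^ (- a) * T y + U y).

Let dH y : 0 < y -> is_derive y 1 H (f_fun mu r n k a phi y).
Proof.
have [a0 a1 n1 k0] := params; move=> y0; apply: has_derivP.
apply: has_deriv_eq.
  apply: has_derivZ; apply: has_derivD; last exact: dU.
  by apply: has_derivM (dT y0); exact: has_deriv_powR.
have h1 : a != 0 by exact: lt0r_neq0.
by rewrite f_funE//=; field.
Qed.

Lemma f_fun_continuous y : 0 < y -> {for y, continuous (f_fun mu r n k a phi)}.
Proof.
move=> y0.
have ey : \forall t \near y,
    - ((1 - a) * k) * t `^ (- a - 1) * T t = f_fun mu r n k a phi t.
  by near=> t; rewrite f_funE//; near: t; exact: lt_nbhsr.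
rewrite /prop_for/continuous_at -(nbhs_singleton ey).
apply: cvg_trans; first exact: near_eq_cvg ey.
apply: (@continuousM_at _ _ (fun t => - ((1 - a) * k) * t `^ (- a - 1)) T).
  apply: (@continuousM_at _ _ (fun=> - ((1 - a) * k)) (fun t => t `^ (- a - 1))).
    exact: continuous_cst_at.
  exact: continuous_powR.
exact: has_deriv_continuous (dT y0).
Unshelve. all: by end_near. Qed.

Lemma w_highE c x z : 0 < z -> Phi z <= c -> w_high mu r n k a phi c x z =
  coef_high a n k Phi T U c z * x `^ n
  + n * (k / (a * (n - 1))) * c `^ a * x * (Phi z `^ (1 - a) / z).
Proof.
have [a0 a1 n1 k0] := params; move=> z0 Pc; have P0 := Phi_fun_gt0 z0.
have c0 := lt_le_trans P0 Pc.
have I : \int[lebesgue_measure]_(y in `[Phi z, c]) f_fun mu r n k a phi y = H c - H (Phi z).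
  apply: (@Rintegral_is_derive _ (f_fun mu r n k a phi) H _ _ Pc) => y /andP[Py _].
    exact/f_fun_continuous/(lt_le_trans P0 Py).
  exact/dH/(lt_le_trans P0 Py).
rewrite /w_high I.
rewrite A_funE// /H /coef_high (phi_PhiE z0).
set p1 := Phi z `^ (1 - a); set pa := Phi z `^ (- a).
have [h1 h2 h3 h4 h5] := nz; have h6 := lt0r_neq0 z0.
by field; nonzero.
Qed.

Lemma G_funE c z : 0 < c -> 0 < z ->
  G_fun mu r n k a phi c z = (c / Phi z) `^ (1 - a) * z.
Proof.
have [a0 a1 n1 k0] := params; move=> c0 z0; have P0 := Phi_fun_gt0 z0.
have zp : 0 < z * phi z by exact: mul_id_gt0.
have p0 : 0 < phi z by move: zp; rewrite pmulr_rgt0.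
rewrite /G_fun (powR_div _ c0 P0).
rewrite Phi_fun_pow//.
have [h1 h2 h3 h4 h5] := nz; have h6 := lt0r_neq0 z0; have h7 := lt0r_neq0 p0.
by field; nonzero.
Qed.

Variable B : R -> R -> R.
Hypothesis B_sol : is_B_fun mu r n k a phi B.

(** B is known only through its differential equation in c and its value at Phi z; the difference
    from the explicit function has zero derivative and vanishes at Phi z. *)
Lemma B_funE c z : 0 < c -> 0 < z -> B c z = coef_mid a n k Phi T E c z.
Proof.
have [a0 a1 n1 k0] := params; move=> c0 z0; have P0 := Phi_fun_gt0 z0.
have [dB BP] := B_sol z0.
pose D t := B t z - coef_mid a n k Phi T E t z.
have dD t : 0 < t -> has_deriv D t 0.
  move=> t0; apply: has_deriv_eq.
    apply: has_derivB (HasDeriv (dB _ t0)) _.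
    exact: (has_deriv_coef_mid T params Phi_fun_gt0 dE).
  rewrite G_funE// powRM ?powR_ge0 ?(ltW z0)// -powRrM /dcoef_mid.
  by rewrite mulrN (mulrC (1 - a)); ring.
have DP : D (Phi z) = 0.
  rewrite /D BP -(coef_glue T U params Phi_fun_gt0 E1 z0) A_funE// /coef_high.
  ring.
have DE : D c = D (Phi z).
  have [cP|Pc|->//] := ltgtP c (Phi z).
    have [t _ /eqP] := has_deriv_MVT c0 cP dD.
    by rewrite mul0r subr_eq0 => /eqP.
  have [t _ /eqP] := has_deriv_MVT P0 Pc dD.
  by rewrite mul0r subr_eq0 => /eqP.
by apply/eqP; rewrite -subr_eq0 -/(D c) DE DP.
Qed.

Lemma w_midE c x z : 0 < c -> 0 < z -> w_mid mu r n a phi B c x z =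
  coef_mid a n k Phi T E c z * x `^ n
  + n * (k / (a * (n - 1))) * c `^ a * x * (Phi z `^ (1 - a) / z).
Proof.
have [a0 a1 n1 k0] := params; move=> c0 z0.
rewrite /w_mid B_funE// [in LHS]phi_PhiE//.
have [h1 h2 h3 h4 h5] := nz; have h6 := lt0r_neq0 z0.
by congr (_ + _); field; nonzero.
Qed.

Lemma w_funE c x z : 0 < c -> 0 < x -> x <= z ->
  w_fun mu r n k a phi B c x z = wmod a n k Phi T U E c x z.
Proof.
move=> c0 x0 xz; have z0 := lt_le_trans x0 xz; have P0 := Phi_fun_gt0 z0.
have G0 := Gam_gt0 a Phi_fun_gt0 x0 z0.
have GP := Gam_leP params Phi_fun_gt0 x0 xz.
have h t : 0 < t -> Phi z <= t -> w_high mu r n k a phi t x z = Wfun a n k Phi T U E t x z.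
  by move=> t0 Pt; rewrite w_highE// /Wfun /coef Pt.
have m t : 0 < t -> t < Phi z -> w_mid mu r n a phi B t x z = Wfun a n k Phi T U E t x z.
  by move=> t0; rewrite ltNge => /negbTE Pt; rewrite w_midE// /Wfun /coef Pt.
rewrite /w_fun /wmod Gamma_funE//; have [Pc|cP] := leP (Phi z) c.
  by rewrite max_l ?(le_trans GP)// subrr mulr0 subr0 h.
have [Gc|cG] := leP (Gam a Phi x z) c.
  by rewrite subrr mulr0 subr0 m.
by have [PG|PG] := leP (Phi z) (Gam a Phi x z); [rewrite h|rewrite m].
Qed.

Section solution.
Variable sigma : R.
Hypothesis sigma_gt0 : 0 < sigma.
Hypothesis n_root :
  2^-1 * sigma ^+ 2 * n ^+ 2 + (mu - 2^-1 * sigma ^+ 2) * n - r = 0.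

Lemma HJB_solution_w_fun : HJB_solution sigma mu r k a phi (w_fun mu r n k a phi B).
Proof.
have [a0 a1 n1 k0] := params.
have Do z : forall q : R * R, [set q | 0 < q.1 /\ 0 < q.2 < z] q ->
    nbhs q [set q | 0 < q.1 /\ 0 < q.2 < z].
  move=> [c x] [/= c0 /andP[x0 xz]].
  have n1' : \forall q \near (c, x), 0 < q.1 by have /(@cvg_fst R R) := lt_nbhsr c0; exact.
  have n2 : \forall q \near (c, x), 0 < q.2 by have /(@cvg_snd R R) := lt_nbhsr x0; exact.
  have n3 : \forall q \near (c, x), q.2 < z by have /(@cvg_snd R R) := lt_nbhsl xz; exact.
  near=> q; split; first by near: q.
  by apply/andP; split; near: q.
have wE z c x : [set q : R * R | 0 < q.1 /\ 0 < q.2 < z] (c, x) ->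
    wmod a n k Phi T U E c x z = w_fun mu r n k a phi B c x z.
  by move=> [/= c0 /andP[x0 /ltW xz]]; rewrite w_funE.
have h z (z0 : 0 < z) := C12_on_ext (u := fun c x => wmod a n k Phi T U E c x z)
  (v := fun c x => w_fun mu r n k a phi B c x z) (Do z) (wE z)
  (C12_wmod params Phi_fun_gt0 dT dU dE E1 z0).
split.
- by move=> z z0; exact: (h z z0).1.
- move=> c x z c0 /andP[x0 xz]; have z0 := lt_trans x0 xz.
  have [|ec ex exx] := (h z z0).2 c x; first by split=> //=; rewrite x0.
  have xz' : 0 < x < z by rewrite x0.
  rewrite /generator ec ex exx -(wE z c x (conj c0 xz')).
  exact: (HJB_wmod params Phi_fun_gt0 Phi_inv_gt0 Phi_invK Phi_fun_lt dT dU dE E1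
    sigma_gt0 mu_lt_r n_root (phi_PhiE z0) c0 xz').
- move=> c x c0 x0; apply: loc_dcon_diff_convex => u v xu uv.
  apply: (@dcon_ext _ _ _ (wmod a n k Phi T U E c x)).
    by move=> z /andP[uz _]; rewrite w_funE// ltW// (lt_le_trans xu).
  exact: (dcon_wmod params Phi_fun_gt0 Phi_inv_gt0 Phi_invK Phi_fun_lt dT dU dE E1
    dcon_Phi_fun c0 x0 xu uv).
- move=> c z c0 z0.
  have [D D0 dw] := boundary_wmod params Phi_fun_gt0 Phi_inv_gt0 Phi_invK Phi_fun_lt
    dT dU dE E1 dcon_Phi_fun c0 z0.
  apply: cvg_trans D0; apply: near_eq_cvg.
  have x0 : \forall x \near z^'-, 0 < x by exact: nbhs_left_gt.
  have xz : \forall x \near z^'-, x < z by exact: nbhs_left_lt.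
  near=> x; have x0' : 0 < x by near: x.
  have xz' : x < z by near: x.
  apply/esym/left_deriveE; apply: (@is_lderive_near _ (wmod a n k Phi T U E c x)).
  + have xy : \forall y \near z^'-, x < y by exact: nbhs_left_gt.
    by near=> y; rewrite w_funE// ltW//; near: y.
  + by rewrite w_funE// ltW.
  + by near: x.
Unshelve. all: by end_near. Qed.

End solution.
End boundary_function.

Lemma growth_exponent01 {d : measure_display} {I : measurableType d} {R : realType}
    (iota : set I -> \bar R) (alpha : I -> R) (gamma : R) :
  iota set0 = 0%E -> (forall i, alpha i < 1) -> 0 < gamma ->
  0 <= growth_exponent iota alpha gamma <= 1.
Proof.
move=> iota0 alpha1 gamma0; rewrite /growth_exponent; set ab := alpha_bar _ _.
(* 1 belongs to the set because [alpha] < 1 everywhere, so the infimum is a genuine one and lies in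
   [0, 1]. *)
have S1 : [set a : R | 0 < a <= 1 /\ iota [set i | a < alpha i] = 0%E] 1.
  split; first by rewrite ltr01 lexx.
  rewrite (_ : [set i | _] = set0)//; apply/seteqP; split => // i /=.
  by rewrite ltNge (ltW (alpha1 i)).
have lb : lbound [set a : R | 0 < a <= 1 /\ iota [set i | a < alpha i] = 0%E] 0.
  by move=> x [/andP[/ltW]].
have ab0 : 0 <= ab by apply: lb_le_inf lb; exists 1.
have ab1 : ab <= 1 by apply: ge_inf S1; exists 0.
have g0 : 0 <= ab * gamma by rewrite mulr_ge0 ?(ltW gamma0).
have den : 0 < 1 - ab + ab * gamma.
  move: ab0; rewrite le_eqVlt => /predU1P[<-|ab0]; first by rewrite mul0r subr0 addr0.
  by have := mulr_gt0 ab0 gamma0; lra.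
by rewrite divr_ge0 ?(ltW den) ?subr_ge0//= ler_pdivrMr// mul1r lerDl.
Qed.

(** With s = sigma^2 / 2 the root equation factors as r = n (s (n - 1) + mu), so the bracket is
    positive, and r - mu = (n - 1) (s (n - 1) + mu + s). *)
Lemma root_gt1 {R : realType} (sigma mu r n : R) : 0 < r -> 1 < n ->
  2^-1 * sigma ^+ 2 * n ^+ 2 + (mu - 2^-1 * sigma ^+ 2) * n - r = 0 -> mu < r.
Proof.
move=> r0 n1; set s := 2^-1 * sigma ^+ 2 => e.
have s0 : 0 <= s by rewrite mulr_ge0 ?sqr_ge0.
have h : 0 < s * (n - 1) + mu.
  rewrite -(pmulr_rgt0 _ (lt_trans ltr01 n1)) (_ : n * _ = r)//.
  by apply/eqP; rewrite -subr_eq0 -e; apply/eqP; ring.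
rewrite -subr_gt0 (_ : r - mu = (n - 1) * (s * (n - 1) + mu + s)).
  by rewrite mulr_gt0 ?subr_gt0//; lra.
by apply/eqP; rewrite -subr_eq0 -oppr_eq0 -e; apply/eqP; ring.
Qed.

Theorem lemma8p1 (R : realType) (d : measure_display) (I : measurableType d)
    (iota : {sigma_finite_measure set I -> \bar R})
    (iota_nonatomic : nonatomic iota)
    (iota_gt0 : (0 < iota [set: I])%E)
    (iota_point : forall i : I, measurable [set i] /\ iota [set i] = 0%E)
    (beta gamma mu sigma : R)
    (beta_gt0 : 0 < beta) (gamma01 : 0 < gamma < 1) (sigma_gt0 : 0 < sigma)
    (c_ alpha lambda k r : I -> R)
    (c_gt0 : forall i, 0 < c_ i) (alpha_gt0 : forall i, 0 < alpha i)
    (lambda_gt0 : forall i, 0 < lambda i) (k_gt0 : forall i, 0 < k i)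
    (r_gt0 : forall i, 0 < r i)
    (c_meas : measurable_fun [set: I] c_)
    (alpha_meas : measurable_fun [set: I] alpha)
    (lambda_meas : measurable_fun [set: I] lambda)
    (k_meas : measurable_fun [set: I] k)
    (r_meas : measurable_fun [set: I] r)
    (m n : I -> R)
    (mn_sign : forall i, m i < 0 < n i)
    (m_root : forall i, 2^-1 * sigma ^+ 2 * m i ^+ 2
                        + (mu - 2^-1 * sigma ^+ 2) * m i - r i = 0)
    (n_root : forall i, 2^-1 * sigma ^+ 2 * n i ^+ 2
                        + (mu - 2^-1 * sigma ^+ 2) * n i - r i = 0)
    (c_fin : ((1 + beta)%:E * (\int[iota]_i (lambda i * c_ i `^ alpha i)%:E)
                < +oo)%E)
    (alpha_lt1 : forall i, alpha i < 1)
    (eps_gt0 : forall i, 0 < (n i - 1) * (1 - alpha i) / alpha i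
                             - growth_exponent iota alpha gamma)
    (q_fin : forall q : R, 0 < q ->
       (\int[iota]_i (lambda i *
          (q * (alpha i * (n i - 1) / ((r i - mu) * n i * k i)))
            `^ (alpha i / (1 - alpha i)))%:E < +oo)%E)
    (phi : R -> R)
    (phi_dc : diff_convex `[0, +oo[ phi)
    (phi_incr : forall xb : R, 0 < xb -> 0 < left_derive (fun x => x * phi x) xb)
    (phi_infty : (x * phi x) @[x --> +oo] --> +oo)
    (phi_growth : forall eps : R, 0 < eps ->
       exists Kt xt : R, 1 < xt /\
         forall xb : R, xt < xb ->
           xb * phi xb <= Kt * xb `^ (growth_exponent iota alpha gamma + eps))
    (i : I) (B : R -> R -> R)
    (B_sol : is_B_fun mu (r i) (n i) (k i) (alpha i) phi B) :
  let Gamma := Gamma_fun mu (r i) (n i) (k i) (alpha i) phi in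
  let Phi := Phi_fun mu (r i) (n i) (k i) (alpha i) phi in
  let w := w_fun mu (r i) (n i) (k i) (alpha i) phi B in
  HJB_solution sigma mu (r i) (k i) (alpha i) phi w /\
  exists K theta : R, [/\ 0 < K, 0 < theta &
    forall c x xb : R, 0 < c -> 0 < x -> x <= xb ->
    [/\ 0 < x * Gamma x xb `^ alpha i
          <= K * (1 + xb `^ (n i - theta)),
        0 < x * Phi xb `^ alpha i <= K * (1 + xb `^ (n i - theta))
      & 0 < w c x xb
          <= K * (1 + xb `^ (n i - theta)
                  + (1 + xb `^ (n i - theta)) * (c * (Phi xb)^-1) `^ alpha i
                  + xb `^ (n i - theta)
                    * (c^-1 * Phi xb) `^ (n i * (1 - alpha i) - 1))]].
Proof.
move=> Gamma Phi w.
set p := growth_exponent iota alpha gamma in eps_gt0 phi_growth.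
have [gamma0 gamma1] := andP gamma01.
have p01 : 0 <= p <= 1 by apply: growth_exponent01 => //; exact: measure0.
have p0 : 0 <= p by case/andP : p01.
rewrite /w /Phi /Gamma => {w Phi Gamma}.
move: (alpha i) (r i) (n i) (k i) (alpha_gt0 i) (alpha_lt1 i) (r_gt0 i) (k_gt0 i)
  (eps_gt0 i) (n_root i) B_sol => a ri ni ki a0 a1 r0 k0 eps0 root Bsol.
have b0 : 0 < 1 - a by rewrite subr_gt0.
(* This is eps_i > 0 solved for n - 1; since p >= 0 it also yields n > 1. *)
have pn : p * a / (1 - a) < ni - 1.
  by rewrite ltr_pdivrMr// -ltr_pdivlMr//; lra.
have n1 : 1 < ni.
  rewrite -subr_gt0; apply: le_lt_trans pn.
  by rewrite divr_ge0 ?(ltW b0)// mulr_ge0 ?(ltW a0).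
have mur := root_gt1 r0 n1 root.
have params : [/\ 0 < a, a < 1, 1 < ni & 0 < ki] by [].
have [q [K1 [q0 qn K10 Pg Pg']]] := Phi_fun_growth params mur phi_dc phi_incr p01 pn phi_growth.
have P0 := Phi_fun_gt0 params mur phi_dc phi_incr.
have Pmono := Phi_fun_lt params mur phi_dc phi_incr.
have PK := Phi_invK params mur phi_dc phi_incr phi_infty.
have Pinv0 := Phi_inv_gt0 params mur phi_dc phi_incr phi_infty.
have [T [dT T0 Tcvg [K2 [K20 Tg]]]] := inv_pow_tail n1 P0 Pinv0 PK Pmono q0 qn K10 Pg.
have dT' y (y0 : 0 < y) := HasDeriv (dT y y0).
have [U dU] : exists U : R -> R, forall y, 0 < y ->
    has_deriv U y (y `^ (- a) * inv_pow ni (Phi_inv mu ri ni ki a phi) y).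
  have [|U dU] := @antiderivative R
    (fun y => y `^ (- a) * inv_pow ni (Phi_inv mu ri ni ki a phi) y).
    move=> y y0; apply: (@continuousM_at _ _ (fun y => y `^ (- a))).
      exact: continuous_powR.
    exact: (inv_pow_continuous Pinv0 PK Pmono y0).
  by exists U => y /dU; exact: HasDeriv.
have [E dE E1] : exists2 E : R -> R, forall u, 0 < u ->
    has_deriv E u (- u `^ (- (ni * (1 - a)))) & E 1 = 0.
  have [|E dE] := @antiderivative R (fun u => - u `^ (- (ni * (1 - a)))).
    by move=> u u0; apply: cvgN; exact: continuous_powR.
  exists (fun u => E u - E 1); last by rewrite subrr.
  move=> u /dE dEu; apply: has_deriv_eq.
    by apply: has_derivB (HasDeriv dEu) _; exact: has_deriv_cst.
  by rewrite subr0.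
split.
  exact: (HJB_solution_w_fun params mur phi_dc phi_incr phi_infty dT' Tcvg dU dE E1 Bsol).
have [K [K0 wK]] := wmod_bounds params P0 dT' dU dE E1 T0 K10 K20 Pg Tg.
have GE x z x0 z0 := @Gamma_funE R mu ri ni ki a phi params mur phi_dc phi_incr x z x0 z0.
(* K1 comes from the growth of x Phi^a, K from that of w; theta is chosen so that n - theta = q. *)
exists (K + K1), (ni - q); split; [exact: addr_gt0|by rewrite subr_gt0|].
rewrite (_ : ni - (ni - q) = q); last by rewrite opprB addrC subrK.
move=> c x z c0 x0 xz; have z0 := lt_le_trans x0 xz.
move: (Phi_fun mu ri ni ki a phi) P0 (Pg' z z0)
  (w_funE params mur phi_dc phi_incr phi_infty dT' Tcvg dU dE E1 Bsol c0 x0 xz)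
  (GE x z x0 z0) (wK c x z c0 x0 xz) => P P0 Pz -> -> /andP[w0 wle].
have zq : 0 <= z `^ q := powR_ge0 _ _.
have KK : K1 * (1 + z `^ q) <= (K + K1) * (1 + z `^ q).
  by rewrite ler_wpM2r ?lerDr ?addr_ge0 ?(ltW K0).
have Pzz := P0 _ z0; have G0 := Gam_gt0 a P0 x0 z0.
have xP : x * P z `^ a <= (K + K1) * (1 + z `^ q).
  apply: le_trans KK; apply: le_trans Pz.
  by rewrite ler_wpM2r ?powR_ge0.
have GP := Gam_leP params P0 x0 xz.
split.
- rewrite mulr_gt0 ?powR_gt0//=; apply: le_trans xP.
  by rewrite ler_wpM2l ?(ltW x0)//; exact: (le_powR_pos (ltW a0) G0 GP).
- by rewrite mulr_gt0 ?powR_gt0.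
- rewrite w0/=; apply: (le_trans wle).
  (* [wmod_bounds] estimates w by a multiple of the terms gathered in X; the remaining summand Y is
     nonnegative. *)
  set X := 1 + z `^ q + _; set Y := z `^ q * _.
  have Y0 : 0 <= Y by rewrite mulr_ge0 ?powR_ge0.
  have X0 : 0 <= X by rewrite /X !addr_ge0// mulr_ge0 ?powR_ge0 ?addr_ge0.
  apply: ler_pM => //; first exact: ltW.
    by rewrite lerDl ltW.
  by rewrite lerDl.
Qed.
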